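(* For every prime $\ell\in R$ and every $n\in\mathcal N$ with $\ell\nmid n$, one has $$\mathfrak H_{\ell,*}(\mathrm{Frob}_\lambda^{-1})\,y_n=\mathrm{Tr}^{E[n\ell]}_{E[n]}(y_{n\ell})$$ as elements of $\mathcal Z(U_{g_n})$. Here $\lambda$ is the chosen prime of $E$ above $\ell$, $y_n\in\mathcal Z(U_{g_n})$ is the $n$-th Euler system divisor class, and $$\mathfrak H_{\ell}(X)=\ell\,\mathrm{ch}(K)-\mathrm{ch}(K\sigma_\ell^{-1}K)X+\mathrm{ch}(K\tau_\ell^{-1}K)X^2$$ is the reverse geometric Hecke polynomial at $\ell$, acting through covariant Hecke operators and the Galois action.
   Context: Groups. $\mathbb A_f$ and $\mathbb A_{E,f}$ are the finite adeles of $\mathbb Q$ and of an imaginary quadratic field $E\subset\mathbb C$. $\mathbf G=\mathrm{GL}_2$ over $\mathbb Q$, $\mathbf H=\mathrm{Res}_{E/\mathbb Q}\mathbb G_m$. Fix an ordered $\mathbb Q$-basis $(\omega_1,\omega_2)$ of $E$; sending an element to the matrix of multiplication by it in this basis (acting on column vectors) gives an embedding $\iota:\mathbf H\hookrightarrow\mathbf G$, through which $\mathbf H$ is viewed as a subgroup of $\mathbf G$. CM divisors. $\mathcal X_{\mathrm{std}}$ is the $\mathbf G(\mathbb R)$-conjugacy class of the homomorphism $h_{\mathrm{std}}:\mathrm{Res}_{\mathbb C/\mathbb R}\mathbb G_m\to\mathbf G_{\mathbb R}$, $a+bi\mapsto\left(\begin{smallmatrix}a&b\\-b&a\end{smallmatrix}\right)$;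 $h_0\in\mathcal X_{\mathrm{std}}$ is the homomorphism induced by $\iota$ and the identification $\mathbb C\simeq E\otimes_{\mathbb Q}\mathbb R$. Fix a compact open subgroup $K\subset\mathbf G(\mathbb A_f)$. The modular curve $\mathcal S_K$ has complex points $\mathcal S_K(\mathbb C)=\mathbf G(\mathbb Q)\backslash(\mathcal X_{\mathrm{std}}\times\mathbf G(\mathbb A_f))/K$, with points written $[x,g]_K$. Let $\mathcal P_K=\{[h_0,g]_K: g\in\mathbf G(\mathbb A_f)\}$ (the points with CM by $E$) and $\mathcal Z=\mathbb Z\langle\mathcal P_K\rangle$ the free abelian group on $\mathcal P_K$. $\mathbf H(\mathbb A_f)$ acts on $\mathcal Z$ by $h\cdot[h_0,g]_K=[h_0,hg]_K$; $\mathrm{Gal}(E^{\mathrm{ab}}/E)$ acts on $\mathcal Z$ through the Artin isomorphism $E^\times\backslash\mathbb A_{E,f}^\times\simeq\mathrm{Gal}(E^{\mathrm{ab}}/E)$ normalized so that uniformizers map to geometric Frobenii: if $\sigma$ corresponds to $h$ then $\sigma[h_0,g]_K=[h_0,hg]_K$. For a compact open $V\subset\mathbf H(\mathbb A_f)$, $\mathcal Z(V)=\mathcal Z^V$. For $g\in\mathbf G(\mathbb A_f)$ the covariant Hecke operator is $\mathrm{ch}(KgK)_*[h_0,g_1]_K=\sum_{\gamma\in KgK/K}[h_0,g_1\gamma]_K$. For a topological space $X$, $\mathcal C_{\mathbb Z}(X)$ denotes the $\mathbb Z$-valued functions of finite support on the (discrete) space $X$; $\mathrm{ch}$ denotes characteristic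 functions. There is a bijection $\psi:\mathcal C_{\mathbb Z}(\mathbf H(\mathbb Q)\backslash\mathbf G(\mathbb A_f)/K)\to\mathcal Z$, $\mathrm{ch}(E^\times gK)\mapsto[h_0,g]_K$. For $\xi\in\mathcal C_{\mathbb Z}(\mathbf G(\mathbb A_f)/K)$, $[\xi]$ denotes its image under the linear map $\mathrm{ch}(gK)\mapsto\mathrm{ch}(E^\times gK)$. Primes. $R$ is the set of rational primes $\ell$ such that: (1) $\ell\nmid\mathrm{disc}(E)$; (2) the $\mathbb Z_\ell$-span of $\omega_1\otimes1,\omega_2\otimes1$ in $E\otimes\mathbb Q_\ell$ is $\mathcal O_\ell:=\mathcal O_E\otimes\mathbb Z_\ell$; (3) $K$ is unramified at $\ell$, i.e. $K=K_\ell K^\ell$ with $K_\ell=\mathrm{GL}_2(\mathbb Z_\ell)$ and $K^\ell$ a subgroup of the points of $\mathbf G$ in the finite adeles away from $\ell$; (4) if $\ell$ is inert in $E$, $K^\ell$ contains $\mathrm{diag}(\ell,\ell)\in\mathbf G(\mathbb Q)$ embedded diagonally away from $\ell$. For inert $\ell\in R$, $\lambda$ is the prime of $E$ above $\ell$; for split $\ell\in R$, $\lambda$ is a fixed choice of one of the two primes above $\ell$. $\mathcal N$ is the set of square-free products of primes in $R$ (with $1\in\mathcal N$). Local elements at $\ell\in R$ (elements at $\ell$ are viewed in the adelic groups with trivial components elsewhere). $\sigma_\ell=\mathrm{diag}(\ell,1)$ and $\tau_\ell=\mathrm{diag}(\ell,\ell)$ in $\mathbf G(\mathbb Q_\ell)$.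 If $\ell$ is split, $\beta_1,\beta_2\in\mathcal O_\ell$ are the two idempotents, $\beta_1$ corresponding to $\lambda$, and $k_\ell=\left(\begin{smallmatrix}a&b\\c&d\end{smallmatrix}\right)\in\mathrm{GL}_2(\mathbb Z_\ell)$ is defined by $\beta_1=a\omega_1+c\omega_2$, $\beta_2=b\omega_1+d\omega_2$. Put $g_\ell=\left(\begin{smallmatrix}1/\ell&0\\0&1\end{smallmatrix}\right)$ if $\ell$ is inert and $g_\ell=k_\ell\left(\begin{smallmatrix}1&0\\1/\ell&1\end{smallmatrix}\right)k_\ell^{-1}$ if $\ell$ is split. For $n\in\mathcal N$, $g_n=\prod_{\ell\mid n}g_\ell\in\mathbf G(\mathbb A_f)$, $g_1=1$. Fields. Fix a compact open subgroup $U\subseteq\mathbf H(\mathbb A_f)\cap K$ which is unramified at every $\ell\in R$, i.e. $U=U^\ell\mathcal O_\ell^\times$ with $U^\ell$ away from $\ell$; write $U=U^RU_R$ with $U_R=\prod_{\ell\in R}\mathcal O_\ell^\times$. Put $U_{g_n}=U\cap g_nKg_n^{-1}$; $E[n]$ is the abelian extension of $E$ such that $\mathrm{Gal}(E^{\mathrm{ab}}/E[n])$ corresponds to $E^\times\backslash E^\times U_{g_n}$ under the Artin isomorphism; $v_n=|U_{g_n}\cap E^\times|$. Divisor classes. For $\ell\in R$, $\zeta_\ell=\mathrm{ch}(K_\ell)-\mathrm{ch}(g_\ell K_\ell)$ and $\zeta_{0,\ell}=\mathrm{ch}(K_\ell)$ in $\mathcal C_{\mathbb Z}(\mathbf G(\mathbb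 Q_\ell)/K_\ell)$. Let $\mathbb A_f^R$ be the finite adeles away from $R$, write $K=K_RK^R$ with $K_R=\prod_{\ell\in R}\mathrm{GL}_2(\mathbb Z_\ell)$, and fix any $\zeta^R\in\mathcal C_{\mathbb Z}(\mathbf G(\mathbb A_f^R)/K^R)$ invariant under left translation by $U^R$. Set $\zeta_{n,f}=\zeta^R\otimes\bigotimes_{\ell\in R,\ell\nmid n}\zeta_{0,\ell}\otimes\bigotimes_{\ell\mid n}\zeta_\ell\in\mathcal C_{\mathbb Z}(\mathbf G(\mathbb A_f)/K)$. The $n$-th Euler system divisor class is $y_n=\psi(v_1v_n^{-1}[\zeta_{n,f}])$; it lies in $\mathcal Z(U_{g_n})$. Operators. $\mathrm{Frob}_\lambda^{-1}\in\mathrm{Gal}(E^{\mathrm{ab}}/E)$ is a choice of geometric Frobenius at $\lambda$; its action on $y_n$ for $\ell\nmid n$ does not depend on the choice. $\mathfrak H_{\ell,*}(\mathrm{Frob}_\lambda^{-1})$ denotes the operator $\ell\,\mathrm{ch}(K)_*-\mathrm{ch}(K\sigma_\ell^{-1}K)_*\mathrm{Frob}_\lambda^{-1}+\mathrm{ch}(K\tau_\ell^{-1}K)_*\mathrm{Frob}_\lambda^{-2}$. $\mathrm{Tr}^{E[n\ell]}_{E[n]}:\mathcal Z(U_{g_{n\ell}})\to\mathcal Z(U_{g_n})$ is the sum over conjugates by $\mathrm{Gal}(E[n\ell]/E[n])$. *)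

(* Defs.v *)
From HB Require Import structures.
From mathcomp Require Import all_boot all_order fingroup all_algebra all_field.
From mathcomp Require Import finmap all_classical all_reals topology.
From mathcomp.real_closed Require Import complex.

Set Implicit Arguments.
Unset Strict Implicit.
Unset Printing Implicit Defensive.

Import Order.TTheory GRing.Theory Num.Theory.

Local Open Scope classical_set_scope.
Local Open Scope ring_scope.

Record place := Place { place_val :> nat; _ : prime place_val }.
HB.instance Definition _ := [isSub for place_val].
HB.instance Definition _ := [Countable of place by <:].

Lemma place_prime (p : place) : prime p. Proof. by case: p. Qed.

Definition dprod (I : Type) (R : I -> comPzRingType) : Type := forall i, R i.

Section DProd.
Context (I : Type) (R : I -> comPzRingType).
Local Notation P := (dprod R).

HB.instance Definition _ := Choice.copy P (forall i, R i).

Let addA : associative (fun x y : P => (fun i => x i + y i) : P).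
Proof. by move=> x y z; apply: functional_extensionality_dep => i; rewrite addrA. Qed.
Let addC : commutative (fun x y : P => (fun i => x i + y i) : P).
Proof. by move=> x y; apply: functional_extensionality_dep => i; rewrite addrC. Qed.
Let add0 : left_id ((fun=> 0) : P) (fun x y : P => (fun i => x i + y i) : P).
Proof. by move=> x; apply: functional_extensionality_dep => i; rewrite add0r. Qed.
Let addN : left_inverse ((fun=> 0) : P) (fun x : P => (fun i => - x i) : P)
  (fun x y : P => (fun i => x i + y i) : P).
Proof. by move=> x; apply: functional_extensionality_dep => i; rewrite addNr. Qed.
HB.instance Definition _ := GRing.isZmodule.Build P addA addC add0 addN.

Let mulA : associative (fun x y : P => (fun i => x i * y i) : P).
Proof. by move=> x y z; apply: functional_extensionality_dep => i; rewrite mulrA. Qed.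
Let mulC : commutative (fun x y : P => (fun i => x i * y i) : P).
Proof. by move=> x y; apply: functional_extensionality_dep => i; rewrite mulrC. Qed.
Let mul1 : left_id ((fun=> 1) : P) (fun x y : P => (fun i => x i * y i) : P).
Proof. by move=> x; apply: functional_extensionality_dep => i; rewrite mul1r. Qed.
Let mulD : left_distributive (fun x y : P => (fun i => x i * y i) : P) +%R.
Proof. by move=> x y z; apply: functional_extensionality_dep => i; rewrite mulrDl. Qed.
HB.instance Definition _ := GRing.Zmodule_isComPzRing.Build P mulA mulC mul1 mulD.

Lemma dprodBE (x y : P) i : (x - y) i = x i - y i. Proof. by []. Qed.
Lemma dprodME (x y : P) i : (x * y) i = x i * y i. Proof. by []. Qed.
Lemma dprod1E i : (1 : P) i = 1. Proof. by []. Qed.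
End DProd.

Section ClassicalInverse.
Context (T : comNzRingType).
Definition cunit : {pred T} := fun x => `[< exists y, y * x = 1 >].
Definition cinv (x : T) : T := if cunit x then xget x [set y | y * x = 1] else x.
Lemma cmulVx : {in cunit, left_inverse 1 cinv *%R}.
Proof.
move=> x; rewrite unfold_in /cinv => ux.
have [y yx] : exists y, y * x = 1 by exact/asboolP.
by rewrite ifT //; case: xgetP => [z _ //|/(_ y)]; case.
Qed.
Lemma cunitPl (x y : T) : y * x = 1 -> cunit x.
Proof. by move=> yx; apply/asboolP; exists y. Qed.
Lemma cinv_out : {in [predC cunit], cinv =1 id}.
Proof. by move=> x ux; rewrite /cinv ifF //; apply: negbTE. Qed.
End ClassicalInverse.

(* Z_p is the inverse limit of the rings Z/p^(n+1). *)
Section Zp.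
Context (p : place).

Definition zpprod : Type := dprod (fun n => 'Z_(p ^ n.+1) : comPzRingType).
HB.instance Definition _ := GRing.ComPzRing.on zpprod.

Definition zp_compat : {pred zpprod} := fun x : zpprod =>
  `[< forall n, (x n.+1 : nat) = x n %[mod p ^ n.+1] >].

Let q_gt1 n : (1 < p ^ n.+1)%N.
Proof. by rewrite -{1}(exp1n n.+1) ltn_exp2r // prime_gt1 // place_prime. Qed.

Let valZ n (x : 'Z_(p ^ n.+1)) : (x : nat) = (x %% p ^ n.+1)%N.
Proof. by rewrite modn_small // -{2}(Zp_cast (q_gt1 n)). Qed.

Let zp_compatE (x : zpprod) :
  reflect (forall n, x n = ((x n.+1 : nat)%:R : 'Z_(p ^ n.+1))) (zp_compat x).
Proof.
apply: (iffP (asboolP _)) => h n.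
  by apply: val_inj => /=; rewrite val_Zp_nat // h -valZ.
by rewrite [in RHS]h (val_Zp_nat (q_gt1 _)) modn_mod.
Qed.

Let red n (x : 'Z_(p ^ n.+2)) : 'Z_(p ^ n.+1) := (x : nat)%:R.
Let redE n (m : nat) : red (m%:R : 'Z_(p ^ n.+2)) = m%:R.
Proof.
rewrite /red (val_Zp_nat (q_gt1 _)); apply: ord_inj.
by rewrite !(val_Zp_nat (q_gt1 _)) modn_dvdm // (expnS p n.+1) dvdn_mull.
Qed.
Let natZ n (x : 'Z_(p ^ n.+1)) : x = (x : nat)%:R. Proof. by rewrite natr_Zp. Qed.
Let redD n (x y : 'Z_(p ^ n.+2)) : red (x + y) = red x + red y.
Proof. by rewrite (natZ x) (natZ y) -natrD !redE natrD. Qed.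
Let redM n (x y : 'Z_(p ^ n.+2)) : red (x * y) = red x * red y.
Proof. by rewrite (natZ x) (natZ y) -natrM !redE natrM. Qed.

Lemma zp_subring_closed : subring_closed zp_compat.
Proof.
split; first by apply/zp_compatE => n; rewrite !dprod1E -[X in (nat_of_ord X)]/(1%:R) -/(red _) redE.
- move=> x y /zp_compatE hx /zp_compatE hy; apply/zp_compatE => n.
  rewrite !dprodBE hx hy -!/(red _); apply: (addIr (red (y n.+1))).
  by rewrite subrK -redD subrK.
- move=> x y /zp_compatE hx /zp_compatE hy; apply/zp_compatE => n.
  by rewrite !dprodME hx hy -!/(red _) redM.
Qed.

Record Zp := MkZp { zp_val : zpprod; _ : zp_val \in zp_compat }.
HB.instance Definition _ := [isSub for zp_val].
HB.instance Definition _ := [Choice of Zp by <:].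
HB.instance Definition _ :=
  GRing.SubChoice_isSubComPzRing.Build zpprod zp_compat Zp zp_subring_closed.

Lemma zp_oner_neq0 : (1 : Zp) != 0.
Proof. by apply/eqP => /(congr1 (fun x => zp_val x 0%N)) /eqP. Qed.
HB.instance Definition _ := GRing.PzSemiRing_isNonZero.Build Zp zp_oner_neq0.
HB.instance Definition _ :=
  GRing.ComNzRing_hasMulInverse.Build Zp (@cmulVx Zp) (@cunitPl Zp) (@cinv_out Zp).

Lemma zp_modn (x : Zp) n m : (n <= m)%N ->
  (zp_val x m : nat) = zp_val x n %[mod p ^ n.+1].
Proof.
case: x => x /= /asboolP hx; elim: m => [|m IH]; first by rewrite leqn0 => /eqP->.
rewrite leq_eqVlt => /orP[/eqP-> //|]; rewrite ltnS => nm; rewrite -IH //.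
have dv : (p ^ n.+1 %| p ^ m.+1)%N by rewrite dvdn_exp2l.
by rewrite -(modn_dvdm _ dv) hx modn_dvdm.
Qed.

Lemma zp_neq0 (x : Zp) : x != 0 -> exists n, (zp_val x n : nat) != 0%N.
Proof.
move=> x0; apply/not_existsP => h; case/negP: x0; apply/eqP/val_inj.
apply: functional_extensionality_dep => n; apply: ord_inj.
by apply/eqP; apply: contrapT => /negP /h.
Qed.

Lemma zp_logn (x : Zp) n m : (zp_val x n : nat) != 0%N -> (n <= m)%N ->
  (0 < zp_val x m)%N && (logn p (zp_val x m) <= n)%N.
Proof.
move=> x0 nm; have : ~~ (p ^ n.+1 %| zp_val x m)%N.
  by rewrite /dvdn (zp_modn x nm) -valZ.
case: posnP => [->|xm]; first by rewrite dvdn0.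
by rewrite pfactor_dvdn ?place_prime //= -leqNgt.
Qed.

Lemma zp_integral : GRing.integral_domain_axiom Zp.
Proof.
move=> x y xy0; case: eqVneq => //= x0; apply: contra_eqT xy0 => y0.
have [n xn] := zp_neq0 x0; have [m ym] := zp_neq0 y0.
have /andP[xN lx] := zp_logn xn (leq_addr m n).
have /andP[yN ly] := zp_logn ym (leq_addl n m).
apply/eqP => xy0; have xyN : zp_val x (n + m)%N * zp_val y (n + m)%N = 0.
  exact: (congr1 (fun z => zp_val z (n + m)%N) xy0).
have {xyN} := congr1 (@nat_of_ord _) xyN.
rewrite (natZ (zp_val x _)) (natZ (zp_val y _)) -natrM (val_Zp_nat (q_gt1 _)).
move=> /eqP; rewrite -/(dvdn _ _) pfactor_dvdn ?place_prime ?muln_gt0 ?xN //.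
by rewrite lognM // ltnNge leq_add.
Qed.
HB.instance Definition _ := GRing.ComUnitRing_isIntegral.Build Zp zp_integral.
End Zp.

Definition Qp (p : place) : Type := {fraction (Zp p)}.
HB.instance Definition _ (p : place) := GRing.Field.on (Qp p).

Definition qp_of_zp (p : place) (x : Zp p) : Qp p := tofrac x.
Definition qp_int (p : place) : set (Qp p) := range (@qp_of_zp p).
(* A_f is the restricted product of the Q_p with respect to the Z_p. *)
Definition qprod : Type := dprod (fun p : place => Qp p : comPzRingType).
HB.instance Definition _ := GRing.ComPzRing.on qprod.

Definition almost_int : {pred qprod} := fun a : qprod =>
  `[< finite_set [set p : place | ~ qp_int (a p)] >].

Lemma almost_intP (a : qprod) :
  reflect (finite_set [set p : place | ~ qp_int (a p)]) (a \in almost_int).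
Proof. exact: asboolP. Qed.

Lemma adele_subring_closed : subring_closed almost_int.
Proof.
split.
- apply/almost_intP; apply: (@sub_finite_set _ _ set0) => // p /=; apply.
  by exists 1 => //; rewrite /qp_of_zp rmorph1.
- move=> a b /almost_intP fa /almost_intP fb; apply/almost_intP.
  apply: (@sub_finite_set _ _ ([set p | ~ qp_int (a p)] `|` [set p | ~ qp_int (b p)])).
    move=> p /= nab; apply: contrapT => /not_orP[/contrapT [x _ xa] /contrapT [y _ yb]].
    by apply: nab; rewrite dprodBE -xa -yb; exists (x - y); rewrite // /qp_of_zp rmorphB.
  by rewrite finite_setU.
- move=> a b /almost_intP fa /almost_intP fb; apply/almost_intP.
  apply: (@sub_finite_set _ _ ([set p | ~ qp_int (a p)] `|` [set p | ~ qp_int (b p)])).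
    move=> p /= nab; apply: contrapT => /not_orP[/contrapT [x _ xa] /contrapT [y _ yb]].
    by apply: nab; rewrite dprodME -xa -yb; exists (x * y); rewrite // /qp_of_zp rmorphM.
  by rewrite finite_setU.
Qed.

Record Af := MkAf { af_val : qprod; _ : af_val \in almost_int }.
HB.instance Definition _ := [isSub for af_val].
HB.instance Definition _ := [Choice of Af by <:].
HB.instance Definition _ :=
  GRing.SubChoice_isSubComPzRing.Build qprod almost_int Af adele_subring_closed.

Lemma af_oner_neq0 : (1 : Af) != 0.
Proof.
apply/eqP => /(congr1 (fun a => af_val a (Place (isT : prime 2)))) /eqP.
by rewrite [X in X == _]/(1 : Qp _) oner_eq0.
Qed.
HB.instance Definition _ := GRing.PzSemiRing_isNonZero.Build Af af_oner_neq0.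
HB.instance Definition _ :=
  GRing.ComNzRing_hasMulInverse.Build Af (@cmulVx Af) (@cunitPl Af) (@cinv_out Af).

Definition af_int : set Af := [set a | forall p, qp_int (af_val a p)].

Lemma adele_at_proof (l : place) (x : Qp l) (a : Af) :
  (@eqtype.dfwith place Qp (af_val a) l x : qprod) \in almost_int.
Proof.
apply/almost_intP; case: a => a /= /almost_intP fa.
apply: (@sub_finite_set _ _ ([set p | ~ qp_int (a p)] `|` [set l])); last first.
  by rewrite finite_setU.
move=> p /=; case: (eqVneq l p) => [<- _|lp]; first by right.
by rewrite (@eqtype.dfwith_out place Qp a l x) // => ?; left.
Qed.
Definition adele_at (l : place) (x : Qp l) (a : Af) : Af :=
  MkAf (adele_at_proof x a).

Lemma adele_glue_proof (S : set place) (a b : Af) :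
  ((fun p => if p \in S then af_val a p else af_val b p) : qprod) \in almost_int.
Proof.
apply/almost_intP; case: a b => a /= /almost_intP fa [b /= /almost_intP fb].
apply: (@sub_finite_set _ _ ([set p | ~ qp_int (a p)] `|` [set p | ~ qp_int (b p)])).
  by move=> p /=; case: ifP => _; [left|right].
by rewrite finite_setU.
Qed.
Definition adele_glue (S : set place) (a b : Af) : Af :=
  MkAf (adele_glue_proof S a b).

Section GL2.
Context (A : comUnitRingType).

Record GL2 := MkGL2 { gl_val :> 'M[A]_2; _ : gl_val \in unitmx }.
HB.instance Definition _ := [isSub for gl_val].
HB.instance Definition _ := [Choice of GL2 by <:].

Lemma gl_unit (g : GL2) : (g : 'M_2) \in unitmx. Proof. by case: g. Qed.

Definition gl_one : GL2 := MkGL2 (unitmx1 A 2).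
Lemma gl_mul_proof (g h : GL2) : (g : 'M_2) *m h \in unitmx.
Proof. by rewrite unitmx_mul !gl_unit. Qed.
Definition gl_mul (g h : GL2) : GL2 := MkGL2 (gl_mul_proof g h).
Lemma gl_inv_proof (g : GL2) : invmx (g : 'M_2) \in unitmx.
Proof. by rewrite unitmx_inv gl_unit. Qed.
Definition gl_inv (g : GL2) : GL2 := MkGL2 (gl_inv_proof g).

Lemma gl_mulA : associative gl_mul.
Proof. by move=> x y z; apply: val_inj; rewrite /= mulmxA. Qed.
Lemma gl_mul1 : left_id gl_one gl_mul.
Proof. by move=> x; apply: val_inj; rewrite /= mul1mx. Qed.
Lemma gl_mulr1 : right_id gl_one gl_mul.
Proof. by move=> x; apply: val_inj; rewrite /= mulmx1. Qed.
Lemma gl_mulV : left_inverse gl_one gl_inv gl_mul.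
Proof. by move=> x; apply: val_inj; rewrite /= mulVmx ?gl_unit. Qed.
Lemma gl_mulrV : right_inverse gl_one gl_inv gl_mul.
Proof. by move=> x; apply: val_inj; rewrite /= mulmxV ?gl_unit. Qed.
HB.instance Definition _ := isGroup.Build GL2 gl_mulA gl_mul1 gl_mulr1 gl_mulV gl_mulrV.

(* M as an element of GL_2; only used when M is invertible. *)
Definition gl_of (M : 'M[A]_2) : GL2 := insubd (1%g : GL2) M.

Definition mx22 (a b c d : A) : 'M[A]_2 :=
  \matrix_(i < 2, j < 2) if i == 0 then (if j == 0 then a else b)
                         else (if j == 0 then c else d).
End GL2.

Section Cosets.
Context (G : groupType).
Implicit Types (K : set G) (g : G).

Definition is_subgroup K : Prop :=
  [/\ K 1%g, forall g h, K g -> K h -> K (g * h)%g & forall g, K g -> K (g^-1)%g].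
Definition setmulg (A B : set G) : set G := [set (a * b)%g | a in A & b in B].
Definition lcos K g : set G := [set (g * k)%g | k in K].
Definition lcosets (A K : set G) : set (set G) := [set lcos K g | g in A].
Definition dbl K g : set G := setmulg (setmulg K [set g]) K.
End Cosets.

(* The adelic topology on GL_2(A_f): the principal congruence subgroups of
   GL_2(Z^) form a basis of neighbourhoods of 1. *)
Definition GL2_Zhat : set (GL2 Af) :=
  [set u : GL2 Af | forall i j, af_int (u i j) /\ af_int ((u^-1)%g i j)].
Definition congruence_subgroup (N : nat) : set (GL2 Af) :=
  [set u : GL2 Af | GL2_Zhat u /\
     forall i j, exists2 a, af_int a & u i j - (1%g : GL2 Af) i j = N%:R * a].
Definition gl_open (O : set (GL2 Af)) : Prop :=
  forall g, O g -> exists2 N, (0 < N)%N & lcos (congruence_subgroup N) g `<=` O.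

Lemma congruence_subgroupM M N : congruence_subgroup (M * N) `<=`
  congruence_subgroup M `&` congruence_subgroup N.
Proof.
have intM a : forall n : nat, af_int a -> af_int (n%:R * a).
  elim=> [|n IH] ai p; first by rewrite mul0r; exists 0; rewrite // /qp_of_zp rmorph0.
  have [x _ xa] := ai p; have [y _ ya] := IH ai p.
  rewrite -natr1 mulrDl mul1r addrC.
  change (qp_int (af_val a p + af_val (n%:R * a) p)); rewrite -xa -ya.
  by exists (x + y); rewrite // /qp_of_zp rmorphD.
move=> u [uZ uMN]; split; split=> // i j; have [a ai ua] := uMN i j.
  by exists (N%:R * a); [exact: intM | rewrite ua natrM mulrA].
by exists (M%:R * a); [exact: intM | rewrite ua mulnC natrM mulrA].
Qed.

Lemma gl_openT : gl_open setT. Proof. by move=> g _; exists 1%N. Qed.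
Lemma gl_openI : setI_closed gl_open.
Proof.
move=> O P hO hP g [/hO [M M0 sM] /hP [N N0 sN]]; exists (M * N)%N.
  by rewrite muln_gt0 M0.
move=> _ [u /congruence_subgroupM [uM uN] <-].
by split; [apply: sM|apply: sN]; exists u.
Qed.
Lemma gl_open_bigU (I : Type) (f : I -> set (GL2 Af)) :
  (forall i, gl_open (f i)) -> gl_open (\bigcup_i f i).
Proof.
move=> hf g [i _ /hf [N N0 sN]]; exists N => // h /sN fh; by exists i.
Qed.
HB.instance Definition _ :=
  isOpenTopological.Build (GL2 Af) gl_openT gl_openI gl_open_bigU.

(* H carries the topology induced by GL_2(A_f). *)
Definition compact_open_in (H V : set (GL2 Af)) : Prop :=
  [/\ is_subgroup V, V `<=` H, compact V & exists2 O, open O & V = O `&` H].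

Definition gl_comp (l : place) (g : GL2 Af) : GL2 (Qp l) :=
  gl_of (\matrix_(i, j) (af_val (g i j) l : Qp l)).
Definition gl_at (l : place) (g : GL2 (Qp l)) : GL2 Af :=
  gl_of (\matrix_(i, j) adele_at (g i j) ((1%g : GL2 Af) i j)).
Definition GL2_Z (l : place) : set (GL2 (Qp l)) :=
  [set g : GL2 (Qp l) | forall i j, qp_int (g i j) /\ qp_int ((g^-1)%g i j)].
Arguments GL2_Z l : clear implicits.

(* The points of GL_2 in the finite adeles away from S are identified with the
   elements of GL_2(A_f) with trivial components at S. *)
Definition trivial_at (S : set place) : set (GL2 Af) :=
  [set g | forall l, S l -> gl_comp l g = 1%g].
Definition away_part (S : set place) (g : GL2 Af) : GL2 Af :=
  gl_of (\matrix_(i, j) adele_glue S ((1%g : GL2 Af) i j) (g i j)).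
Definition away (S : set place) (V : set (GL2 Af)) := V `&` trivial_at S.
(* V = V_l V^l with V_l = D. *)
Definition unramified_at (l : place) (D : set (GL2 (Qp l))) (V : set (GL2 Af)) :=
  V = setmulg (@gl_at l @` D) (away [set l] V).

Definition int_closure (T : nzRingType) : set T :=
  [set x | integralOver (intr : int -> T) x].
Arguments int_closure T : clear implicits.

Definition is_prime_ideal (T : nzRingType) (O P : set T) : Prop :=
  [/\ P `<=` O, P 0 & forall x y, P x -> P y -> P (x + y)] /\
  [/\ forall a x, O a -> P x -> P (a * x), ~ P 1 &
      forall x y, O x -> O y -> P (x * y) -> P x \/ P y].

Section Torus.
Context (E : fieldExtType rat).
Implicit Types (w : 2.-tuple E) (x : E) (l : place) (P Q : set E).

Definition mulE w x : 'M[rat]_2 := \matrix_(i, j) coord w i (x * w`_j).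

(* E (x)_Q A is identified with A^2 through the basis w: [vecE w A] is the
   embedding of E, [iota w v] is the matrix of the multiplication by v, and
   H(A_f) is the group of the invertible matrices of this form. *)
Definition vecE w (A : comUnitRingType) x : 'cV[A]_2 := \col_i ratr (coord w i x).
Definition iota w (A : comUnitRingType) (v : 'cV[A]_2) : 'M[A]_2 :=
  \sum_(k < 2) v k 0 *: map_mx ratr (mulE w w`_k).
Definition tmul w (A : comUnitRingType) (u v : 'cV[A]_2) : 'cV[A]_2 := iota w u *m v.

Definition H_Af w : set (GL2 Af) := [set g | exists v, (g : 'M_2) = iota w v].
Definition H_Q w : set (GL2 Af) :=
  [set g | exists2 x, x != 0 & (g : 'M_2) = iota w (vecE w Af x)].

Local Notation O_E := (int_closure E).

Definition integral_basis w : Prop :=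
  basis_of fullv w /\ O_E = range (fun c : 'I_2 -> int => \sum_(i < 2) w`_i *~ c i).
(* The discriminant of E, computed from any Z-basis of its ring of integers. *)
Definition disc : int := xget 0 [set d | exists2 w, integral_basis w &
  d%:~R = \det (\matrix_(i < 2, j < 2) \tr (mulE w (w`_i * w`_j)))].

Definition prime_ideal_above l P : Prop := is_prime_ideal O_E P /\ P l%:R.
Definition inert l : Prop := is_prime_ideal O_E [set l%:R * x | x in O_E].

Definition Zp_span w l (S : set E) : set 'cV[Qp l]_2 :=
  [set v | exists (n : nat) (c : 'I_n -> Zp l) (s : 'I_n -> E),
     (forall i, S (s i)) /\ v = \sum_i qp_of_zp (c i) *: vecE w (Qp l) (s i)].
Arguments Zp_span w l S : clear implicits.
Definition O_at w l : set 'cV[Qp l]_2 := Zp_span w l O_E.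
Arguments O_at w l : clear implicits.
Definition O_at_units w l : set (GL2 (Qp l)) :=
  [set g | exists u v, [/\ O_at w l u, O_at w l v,
     tmul w u v = vecE w (Qp l) 1 & (g : 'M_2) = iota w u]].
Arguments O_at_units w l : clear implicits.

(* The idempotent of O_l = \prod_(Q | l) O_Q which is 1 in O_P and 0 in the
   other factors. *)
Definition idempotent w l P : 'cV[Qp l]_2 := xget 0
  [set e | [/\ O_at w l e, tmul w e e = e, ~ Zp_span w l P e &
     forall Q, prime_ideal_above l Q -> Q <> P -> Zp_span w l Q e]].

(* v is a uniformizer of E_P, with components 1 at the other primes above l. *)
Definition uniformizer w l P (v : 'cV[Qp l]_2) : Prop :=
  [/\ O_at w l v, [set tmul w v u | u in O_at w l] = Zp_span w l P &
      let e := vecE w (Qp l) 1 - idempotent w l P in tmul w e v = e].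

Definition in_R w (K : set (GL2 Af)) : set place := [set l : place |
  [/\ ~~ (l %| disc)%Z,
      Zp_span w l [set x | x \in (w : seq E)] = O_at w l,
      unramified_at (GL2_Z l) K &
      inert l -> exists2 g : GL2 Af, away [set l] K g &
        (g : 'M_2) = (adele_at (1 : Qp l) l%:R)%:M]].

Definition in_N w (K : set (GL2 Af)) : set nat :=
  [set n | exists s : seq place,
     [/\ uniq s, forall l, l \in s -> in_R w K l & n = (\prod_(l <- s) l)%N]].
End Torus.
Arguments Zp_span {E} w l S.
Arguments O_at {E} w l.
Arguments O_at_units {E} w l.
Arguments idempotent {E} w l P.
Arguments uniformizer {E} w l P v.

Definition places (n : nat) : seq place := pmap insub (primes n).

Section Galois.
Context (R : realType) (E : fieldExtType rat) (emb : {rmorphism E -> R[i]}).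
Implicit Types (k L : set R[i]) (s : R[i] -> R[i]).

Definition imaginary_quadratic : Prop :=
  \dim {: E} = 2%N /\ exists x : E, complex.Im (emb x) != 0.

Definition is_subfield k : Prop :=
  [/\ k 1, forall x y, k x -> k y -> k (x - y) &
      forall x y, k x -> k y -> k (x * y) /\ k (x^-1)].

(* Gal(L/k) for subfields k and L of C. An automorphism of L is represented by
   its extension to C by the identity outside L. *)
Definition Gal L k : set (R[i] -> R[i]) := [set s |
  [/\ set_bij L L s,
      forall x y, L x -> L y -> s (x + y) = s x + s y /\ s (x * y) = s x * s y,
      forall x, k x -> s x = x & forall x, ~ L x -> s x = x]].

(* The union in C of the finite abelian Galois extensions of E. *)
Definition Eab : set R[i] := [set x |
  exists (L : splittingFieldType E) (j : {rmorphism L -> R[i]}),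
    [/\ forall a : E, j a%:A = emb a, galois 1 {: L},
        abelian 'Gal({: L} / 1) & range j x]].

Definition O_Eab : set R[i] := Eab `&` int_closure R[i].

(* phi^-1 is an arithmetic Frobenius at P: for a prime PP of O_Eab above P,
   phi^-1 y = y ^ N(P) modulo PP, that is x = (phi x) ^ N(P) modulo PP. *)
Definition geometric_Frobenius (P : set E) (phi : R[i] -> R[i]) : Prop :=
  Gal Eab (range emb) phi /\
  exists (PP : set R[i]) (q : nat),
    [/\ is_prime_ideal O_Eab PP,
        PP `&` (emb @` int_closure E) = emb @` P,
        ([set [set y | P (y - x)] | x in int_closure E] #= `I_q)%card &
        forall x, O_Eab x -> PP (x - phi x ^+ q)].

(* art : A_{E,f}^* -> Gal(E^ab/E) is a continuous surjective homomorphism with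
   kernel E^*, mapping the uniformizers at each prime of E exactly to the
   geometric Frobenii. *)
Definition is_Artin_map (w : 2.-tuple E) (art : GL2 Af -> R[i] -> R[i]) : Prop :=
  [/\ art @` H_Af w = Gal Eab (range emb),
      forall g h, H_Af w g -> H_Af w h -> art (g * h)%g = art g \o art h,
      forall h, H_Af w h -> (art h = id <-> H_Q w h),
      forall x, Eab x -> exists2 O : set (GL2 Af), open O /\ O 1%g &
        forall h, (O `&` H_Af w) h -> art h x = x &
      forall (l : place) (P : set E), prime_ideal_above l P -> forall phi,
        geometric_Frobenius P phi <->
        exists2 v, uniformizer w l P v & phi = art (gl_at (gl_of (iota w v)))].

(* k is the abelian extension of E such that Gal(E^ab/k) corresponds to
   E^* V / E^*. *)
Definition class_field (w : 2.-tuple E) (art : GL2 Af -> R[i] -> R[i])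
    (V : set (GL2 Af)) k : Prop :=
  [/\ is_subfield k, range emb `<=` k, k `<=` Eab &
      Gal Eab k = art @` setmulg (H_Q w) V].
End Galois.

Definition ch (T : Type) (t : T) : T -> int := fun x => if `[< x = t >] then 1 else 0.
(* A function on X is extended by 0 outside X. *)
Definition C_Z (T : Type) (X : set T) : set (T -> int) :=
  [set f | finite_set [set x | f x != 0] /\ [set x | f x != 0] `<=` X].
(* The additive extension of F to the functions of finite support. *)
Definition lin_ext (T : choiceType) (V : zmodType) (F : T -> V) (f : T -> int) : V :=
  \sum_(x \in [set: T]) F x *~ f x.

Section Divisors.
Context (R : realType) (E : fieldExtType rat) (emb : {rmorphism E -> R[i]}).
Context (w : 2.-tuple E) (K : set (GL2 Af)).

(* A homomorphism from Res_{C/R} G_m to GL_2 is given by the map it induces from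
   C^* to GL_2(R), extended by 0 at 0. *)
Definition h_std (z : R[i]) : 'M[R]_2 :=
  mx22 (complex.Re z) (complex.Im z) (- complex.Im z) (complex.Re z).
Definition X_std : set (R[i] -> 'M[R]_2) :=
  range (fun (g : GL2 R) z => g *m h_std z *m invmx g).
(* C is identified with E (x)_Q R. *)
Definition h_0 (z : R[i]) : 'M[R]_2 :=
  iota w (xget 0 [set v : 'cV[R]_2 | z = \sum_(k < 2) (v k 0)%:C%C * emb w`_k]).

Local Notation pair := ((R[i] -> 'M[R]_2) * GL2 Af)%type.
Local Notation point := (set pair).

(* The point [x, g]_K, as an orbit in X_std x G(A_f). *)
Definition pt (x : R[i] -> 'M[R]_2) (g : GL2 Af) : point :=
  [set y : pair | exists c : GL2 rat, exists2 k : GL2 Af, K k &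
     (y.1 = fun z => map_mx ratr c *m x z *m invmx (map_mx ratr c)) /\
     (y.2 : 'M_2) = map_mx ratr c *m g *m k].
Definition S_K : set point := [set c | exists x g, X_std x /\ c = pt x g].
Definition P_K : set point := S_K `&` range (pt h_0).
Definition Div : set (point -> int) := C_Z P_K.

Definition rep (c : point) : GL2 Af := xget 1%g [set g | pt h_0 g = c].

Definition act (h : GL2 Af) : (point -> int) -> point -> int :=
  lin_ext (fun c => ch (pt h_0 (h * rep c)%g)).
Definition Div_inv (V : set (GL2 Af)) := [set z | Div z /\ forall h, V h -> act h z = z].

Definition Hecke (g : GL2 Af) : (point -> int) -> point -> int := lin_ext (fun c =>
  \sum_(D \in [set lcos K x | x in dbl K g]) ch (pt h_0 (rep c * xget 1%g D)%g)).

(* The map C_Z(G(A_f)/K) -> C_Z(H(Q)\G(A_f)/K), ch(gK) |-> ch(E^* g K). *)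
Definition cls : (set (GL2 Af) -> int) -> set (GL2 Af) -> int :=
  lin_ext (fun D => ch (setmulg (H_Q w) D)).
Definition psi : (set (GL2 Af) -> int) -> point -> int :=
  lin_ext (fun D => ch (pt h_0 (xget 1%g D))).

Context (art : GL2 Af -> R[i] -> R[i]).
(* The choice of h is irrelevant: E^* acts trivially on Div. *)
Definition gal_act (s : R[i] -> R[i]) :=
  act (xget 1%g [set h | H_Af w h /\ art h = s]).

(* Each t in Gal(L/k) acts through an extension s of t to E^ab; when L is the
   class field of V, the choice of s is irrelevant on the V-invariant divisors. *)
Definition trace (L k : set R[i]) (z : point -> int) : point -> int :=
  \sum_(t \in Gal L k)
    gal_act (xget (id : R[i] -> R[i]) [set s | Gal (Eab emb) (range emb) s /\
                              forall x, L x -> s x = t x]) z.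

Definition Hecke_poly (l : place) (phi : R[i] -> R[i]) (z : point -> int) : point -> int :=
  let sigma := gl_at (gl_of (mx22 (l%:R : Qp l) 0 0 1)) in
  let tau := gl_at (gl_of (mx22 (l%:R : Qp l) 0 0 l%:R)) in
  Hecke 1%g z *~ (l : nat) - Hecke (sigma^-1)%g (gal_act phi z)
    + Hecke (tau^-1)%g (gal_act (phi \o phi) z).

Context (lam : place -> set E) (U : set (GL2 Af)) (zetaR : set (GL2 Af) -> int).
Local Notation inR := (in_R w K).

(* Only used at the l in R, where l is unramified: it is inert or split. *)
Definition g_loc (l : place) : GL2 (Qp l) :=
  if `[< inert E l >] then gl_of (mx22 (l%:R^-1) 0 0 1)
  else
    let b1 := idempotent w l (lam l) in
    let b2 := vecE w (Qp l) 1 - b1 in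
    let k := gl_of (row_mx b1 b2 : 'M_2) in
    (k * gl_of (mx22 1 0 (l%:R^-1) 1) * k^-1)%g.
Arguments g_loc l : clear implicits.
Definition g_ (n : nat) : GL2 Af :=
  (\big[*%g/1%g]_(l <- places n) gl_at (g_loc l))%g.

Definition U_ (n : nat) : set (GL2 Af) :=
  U `&` [set (g_ n * k * (g_ n)^-1)%g | k in K].
Definition v_ (n : nat) : nat := #|` fset_set (U_ n `&` H_Q w)|%fset.

Definition zeta_loc (n : nat) (l : place) : set (GL2 (Qp l)) -> int :=
  if (l %| n)%N then ch (GL2_Z l) - ch (lcos (GL2_Z l) (g_loc l)) else ch (GL2_Z l).

Definition tame_datum : Prop :=
  C_Z (lcosets (trivial_at inR) (away inR K)) zetaR /\
  forall u g, away inR U u -> trivial_at inR g ->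
    zetaR (lcos (away inR K) (u * g)%g) = zetaR (lcos (away inR K) g).

(* The tensor product of zeta^R with the local functions, evaluated at D = gK;
   almost all the factors of the product over R are 1. *)
Definition zeta_ (n : nat) : set (GL2 Af) -> int := fun D =>
  if `[< lcosets setT K D >] then
    let g := xget 1%g D in
    zetaR (lcos (away inR K) (away_part inR g)) *
    \big[*%R/1]_(l \in inR) zeta_loc n (lcos (GL2_Z l) (gl_comp l g))
  else 0.

(* v_n divides v_1, since U_n is a subgroup of U_1. *)
Definition y_ (n : nat) : point -> int := psi (cls (zeta_ n) *~ (v_ 1 %/ v_ n)%N).
End Divisors.

(* Main.v *)
(* Everything is computed on the points [h_0, g], where g only matters up to E^* on the left and
   K on the right. Writing zeta_n as a combination of cosets g K with g trivial at l, the
   function zeta_(nl) is the same combination of the differences ch(gK) - ch(g g_l K). The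
   double coset K sigma_l^-1 K consists of l + 1 cosets, indexed by the projective line over
   Z/l, and Frob_lambda^-1 acts by multiplication by a uniformizer h of E at lambda.
   If l is inert, h is l times a unit and l acts trivially by condition (4) on K; the group
   O_l^* permutes the l + 1 cosets transitively, the stabilizer of g_l K being
   O_l^* /\ g_l K g_l^-1, so that the Euler factor applied to [gK] is the sum of the translates
   of [gK] - [g g_l K] by representatives of O_l^* modulo this stabilizer.
   If l is split, in the basis of the idempotents h is diag(l, 1): one of the l + 1 terms cancels
   the term in Frob_lambda^-2, another one is [gK], and the remaining l - 1 terms form again one
   orbit of O_l^*.
   Finally O_l^* modulo the stabilizer is U_n / U_(nl), which maps onto Gal(E[nl] / E[n]) with
   fibres of cardinal v_n / v_(nl); these multiplicities match the normalization of y_n. *)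

From HB Require Import structures.
Require Import Defs.
From mathcomp Require Import all_boot all_order fingroup all_algebra all_field.
From mathcomp Require Import finmap all_classical all_reals topology.
From mathcomp.real_closed Require Import complex.
From mathcomp Require Import ring.

Set Implicit Arguments.
Unset Strict Implicit.
Unset Printing Implicit Defensive.

Import Order.TTheory GRing.Theory Num.Theory.

Local Open Scope classical_set_scope.
Local Open Scope ring_scope.

Local Notation Zp := Defs.Zp.
Local Notation iota := Defs.iota.
Local Notation Gal := Defs.Gal.
Local Notation lcosets := Defs.lcosets.

(** * p-adic integers *)

(** The computation on one coset is elementary; most of the work consists in reaching it. The trace
    runs over Gal(L/k) for subfields L and k of C, and its terms act through extensions to E^ab. So
    automorphisms of L have to be extended, and L has to be recognized as the fixed field of
    Gal(E^ab/L). Both are obtained from graphs of partial embeddings of subfields of C, extended by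
    Zorn's lemma. For this E^ab is described as the set of algebraic numbers at which all
    E-embeddings commute, a condition that passes to sums and products without any compositum. At a
    prime of R that is not inert, the splitting has to be produced: an element outside l O_E with
    norm divisible by l has trace prime to l because l does not divide the discriminant, and
    Hensel's lemma then gives the idempotents. Finally, the sum over U_n / U_(nl) is c = v_n /
    v_(nl) times a trace, so the two sides are compared after multiplication by c, in a torsion-free
    group. If the intersection of U and E^* were infinite, v_1 would be 0 by convention and both
    sides would vanish. *)

Lemma zp_eqP (p : place) (x y : Zp p) : (forall n, zp_val x n = zp_val y n) -> x = y.
Proof. by move=> h; apply/val_inj/functional_extensionality_dep. Qed.

Lemma zp_modulus_gt1 (p : place) n : (1 < p ^ n.+1)%N.
Proof. by rewrite -{1}(exp1n n.+1) ltn_exp2r // prime_gt1 // place_prime. Qed.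

Lemma zp_valM (p : place) (x y : Zp p) n : zp_val (x * y) n = zp_val x n * zp_val y n.
Proof. by []. Qed.
Lemma zp_valD (p : place) (x y : Zp p) n : zp_val (x + y) n = zp_val x n + zp_val y n.
Proof. by []. Qed.
Lemma zp_val_nat (p : place) m n : zp_val (m%:R : Zp p) n = m%:R.
Proof. by elim: m => // m IH; rewrite -!natr1 zp_valD IH. Qed.

Lemma zp_of_seq (p : place) (a : nat -> nat) :
  (forall n, a n.+1 = a n %[mod p ^ n.+1]) -> exists x : Zp p, forall n, zp_val x n = (a n)%:R.
Proof.
move=> h; pose x : zpprod p := fun n => (a n)%:R.
have xP : x \in @zp_compat p.
  apply/asboolP => n; rewrite /x !(val_Zp_nat (zp_modulus_gt1 _ _)) modn_dvdm.
    by rewrite modn_mod h.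
  by rewrite (expnS p n.+1) dvdn_mull.
by exists (MkZp xP).
Qed.

Lemma zp_natr_eq0 (p : place) m n : ((m%:R : 'Z_(p ^ n.+1)) == 0) = (p ^ n.+1 %| m)%N.
Proof. by rewrite -val_eqE /= (val_Zp_nat (zp_modulus_gt1 _ _)). Qed.

Lemma zp_val_mod (p : place) (x : Zp p) n m : (n <= m)%N ->
  zp_val x n = (zp_val x m : nat)%:R.
Proof.
move=> nm; apply: ord_inj; rewrite (val_Zp_nat (zp_modulus_gt1 _ _)) zp_modn //.
by rewrite modn_small // -{2}(Zp_cast (zp_modulus_gt1 p n)).
Qed.

Definition pdvd (p : place) (x : Zp p) : bool := zp_val x 0%N == 0.

Lemma pdvd_nat (p : place) m : pdvd (m%:R : Zp p) = (p %| m)%N.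
Proof. by rewrite /pdvd zp_val_nat zp_natr_eq0 expn1. Qed.
Lemma pdvdD (p : place) (x y : Zp p) : pdvd x -> pdvd (x + y) = pdvd y.
Proof. by rewrite /pdvd zp_valD => /eqP->; rewrite add0r. Qed.
Lemma pdvdMl (p : place) (x y : Zp p) : pdvd x -> pdvd (x * y).
Proof. by rewrite /pdvd zp_valM => /eqP->; rewrite mul0r. Qed.
Lemma pdvdMr (p : place) (x y : Zp p) : pdvd x -> pdvd (y * x).
Proof. by rewrite mulrC; apply: pdvdMl. Qed.
Lemma pdvdN (p : place) (x : Zp p) : pdvd (- x) = pdvd x.
Proof. by rewrite /pdvd -(oppr_eq0 (zp_val x 0%N)). Qed.
Lemma pdvd_p (p : place) : pdvd ((p : nat)%:R : Zp p).
Proof. by rewrite pdvd_nat. Qed.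
Lemma pdvd1 (p : place) : pdvd (1 : Zp p) = false.
Proof. by rewrite (pdvd_nat p 1) gtnNdvd // prime_gt1 // place_prime. Qed.

Lemma pdvdP (p : place) (x : Zp p) : reflect (exists y, x = (p : nat)%:R * y) (pdvd x).
Proof.
apply: (iffP idP) => [x0|[y ->]]; last exact/pdvdMl/pdvd_p.
(* Component n of the quotient is component n+1 of x divided by p as a natural number: one level of
   precision is lost. *)
pose b n := (zp_val x n.+1 : nat).
have dv n : (p %| b n)%N.
  by move: x0; rewrite /pdvd (zp_val_mod x (leq0n n.+1)) zp_natr_eq0 expn1.
have p0 : (0 < p)%N by rewrite prime_gt0 // place_prime.
have [|y yE] := @zp_of_seq p (fun n => b n %/ p)%N.
  move=> n; apply/eqP; rewrite -(eqn_pmul2r p0) !muln_modl // -expnSr !divnK //.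
  by apply/eqP; rewrite /b (zp_modn x (leqnSn n.+1)).
exists y; apply: zp_eqP => n; rewrite zp_valM zp_val_nat yE -natrM mulnC divnK //.
exact: zp_val_mod.
Qed.

Lemma zp_pow_dvd_val (p : place) (y : Zp p) n m : (n < m)%N ->
  zp_val ((p : nat)%:R ^+ m * y) n = 0.
Proof.
move=> nm; rewrite zp_valM -natrX zp_val_nat.
by have /eqP-> : ((p ^ m)%:R : 'Z_(p ^ n.+1)) == 0; rewrite ?mul0r // zp_natr_eq0 dvdn_exp2l.
Qed.

(* Newton iteration with the constant slope c, an inverse of B modulo p. *)
Lemma zp_hensel (p : place) (A B C c : Zp p) : pdvd A -> pdvd (1 - c * B) ->
  exists a, A * a ^+ 2 + B * a + C = 0.
Proof.
move=> /pdvdP[A' AE] /pdvdP[d dE].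
pose f a := A * a ^+ 2 + B * a + C.
have step a : f (a - c * f a) =
    (p : nat)%:R * (f a * (d - c * A' * a *+ 2 + A' * c ^+ 2 * f a)).
  transitivity (f a * ((1 - c * B) - c * A * a *+ 2 + A * c ^+ 2 * f a)); last first.
    by rewrite dE AE; ring.
  have hC : C = f a - A * a ^+ 2 - B * a by rewrite /f; ring.
  have fE b : f b = A * b ^+ 2 + B * b + C by [].
  by rewrite fE; move: (f a) hC => F ->; ring.
pose s n := iter n.+1 (fun a => a - c * f a) 0.
have fs n : exists y, f (s n) = (p : nat)%:R ^+ n.+1 * y.
  elim: n => [|n [y IH]].
    exists (f 0 * (d - c * A' * 0 *+ 2 + A' * c ^+ 2 * f 0)).
    by rewrite expr1 -step.
  have -> : s n.+1 = s n - c * f (s n) by [].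
  exists (y * (d - c * A' * s n *+ 2 + A' * c ^+ 2 * f (s n))).
  rewrite step exprS -!mulrA; congr (_ * _); rewrite [RHS]mulrA; congr (_ * _).
  exact: IH.
have [|x xE] := @zp_of_seq p (fun n => zp_val (s n) n).
  move=> n; rewrite (zp_modn _ (leqnSn n)).
  suff -> : zp_val (s n.+1) n = zp_val (s n) n by [].
  have [y yE] := fs n; have -> : s n.+1 = s n + (- c) * f (s n) by rewrite mulNr.
  rewrite zp_valD zp_valM yE zp_pow_dvd_val // mulr0 addr0. done.
exists x; apply: zp_eqP => n; have [y yE] := fs n.
have xn : zp_val x n = zp_val (s n) n by rewrite xE natr_Zp.
rewrite -/(f x); transitivity (zp_val (f (s n)) n); last by rewrite yE zp_pow_dvd_val.
by rewrite /f !expr2 !(zp_valD, zp_valM) xn.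
Qed.

Lemma zp_approx (p : place) (x : Zp p) : exists m y, x = m%:R + (p : nat)%:R * y.
Proof.
have : pdvd (x - (zp_val x 0%N : nat)%:R).
  by rewrite /pdvd -[_ - _]/(x + - _) zp_valD -[zp_val (- _) _]/(- zp_val _ _)
    zp_val_nat natr_Zp subrr.
by case/pdvdP => y yE; exists (zp_val x 0%N), y; rewrite -yE addrC subrK.
Qed.

(** An inverse of x is a root of 0 a^2 + x a - 1. Hensel's lemma applies with A = 0, the slope being
    an inverse modulo p of an integer congruent to x, found by Bezout. *)
Lemma zp_unitE (p : place) (x : Zp p) : (x \is a GRing.unit) = ~~ pdvd x.
Proof.
apply/idP/idP => [ux|nx].
  apply/negP => /(pdvdMr x^-1); rewrite mulVr // pdvd1 //.
have [m [y xE]] := zp_approx x.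
have cm : coprime m p.
  rewrite coprime_sym prime_coprime ?place_prime // -pdvd_nat.
  by apply: contra nx => dm; rewrite xE pdvdD //; apply/pdvdMl/pdvd_p.
have m0 : (0 < m)%N.
  by rewrite lt0n; apply: contraTneq cm => ->; rewrite /coprime gcd0n neq_ltn orbC prime_gt1 ?place_prime.
have [u v uv _] := egcdnP p m0.
have p0 : pdvd (0 : Zp p) by rewrite /pdvd.
have [|a] := @zp_hensel p 0 x (-1) u%:R p0.
  rewrite xE mulrDr -natrM uv natrD natrM (eqP cm) [_ + 1%:R]addrC opprD opprD !addrA subrr sub0r.
  rewrite pdvdD ?pdvdN; first by apply/pdvdMr/pdvdMl/pdvd_p.
  by apply/pdvdMr/pdvd_p.
rewrite mul0r add0r => /eqP; rewrite subr_eq0 => /eqP xa.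
by apply/unitrPr; exists a.
Qed.

Lemma pdvdM (p : place) (x y : Zp p) : pdvd (x * y) = pdvd x || pdvd y.
Proof. by rewrite -[LHS]negbK -zp_unitE unitrM !zp_unitE negb_and !negbK. Qed.

Lemma zp_natr_eq0E (p : place) m : (m%:R == 0 :> Zp p) = (m == 0)%N.
Proof.
apply/eqP/eqP => [m0|-> //]; apply/eqP; rewrite -leqn0 leqNgt; apply/negP => mp.
(* Since m < p^(m+1), the component of index m already detects that m is nonzero. *)
have := congr1 (fun x : Zp p => zp_val x m) m0; rewrite zp_val_nat => /eqP.
rewrite -[X in _ == X](zp_val_nat p 0) zp_natr_eq0 => /(dvdn_leq mp).
rewrite leqNgt (leq_trans (ltnSn m)) //; exact/ltnW/ltn_expl/prime_gt1/place_prime.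
Qed.

HB.instance Definition _ (p : place) := GRing.RMorphism.copy (@qp_of_zp p) (@tofrac (Zp p)).

Lemma qp_of_zp_inj (p : place) : injective (@qp_of_zp p).
Proof. by move=> x y /eqP; rewrite /qp_of_zp tofrac_eq => /eqP. Qed.

Lemma qp_natr_eq0 (p : place) m : (m%:R == 0 :> Qp p) = (m == 0)%N.
Proof. by rewrite -(rmorph_nat (@qp_of_zp p)) -(rmorph0 (@qp_of_zp p)) (inj_eq (@qp_of_zp_inj p)) zp_natr_eq0E. Qed.

Lemma qp_p_neq0 (p : place) : ((p : nat)%:R : Qp p) != 0.
Proof. by rewrite qp_natr_eq0 -lt0n prime_gt0 // place_prime. Qed.

Lemma qp_int0 (p : place) : qp_int (0 : Qp p). Proof. by exists 0; rewrite ?rmorph0. Qed.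
Lemma qp_int1 (p : place) : qp_int (1 : Qp p). Proof. by exists 1; rewrite ?rmorph1. Qed.
Lemma qp_intD (p : place) (x y : Qp p) : qp_int x -> qp_int y -> qp_int (x + y).
Proof. by move=> [a _ <-] [b _ <-]; exists (a + b); rewrite ?rmorphD. Qed.
Lemma qp_intN (p : place) (x : Qp p) : qp_int x -> qp_int (- x).
Proof. by move=> [a _ <-]; exists (- a); rewrite ?rmorphN. Qed.
Lemma qp_intB (p : place) (x y : Qp p) : qp_int x -> qp_int y -> qp_int (x - y).
Proof. by move=> ? ?; apply/qp_intD/qp_intN. Qed.
Lemma qp_intM (p : place) (x y : Qp p) : qp_int x -> qp_int y -> qp_int (x * y).
Proof. by move=> [a _ <-] [b _ <-]; exists (a * b); rewrite ?rmorphM. Qed.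
Lemma qp_int_nat (p : place) m : qp_int (m%:R : Qp p).
Proof. by exists m%:R; rewrite ?rmorph_nat. Qed.
Lemma qp_int_int (p : place) m : qp_int (m%:~R : Qp p).
Proof. by exists m%:~R; rewrite ?rmorph_int. Qed.
Lemma qp_int_sum (p : place) (I : Type) (r : seq I) (P : pred I) (F : I -> Qp p) :
  (forall i, P i -> qp_int (F i)) -> qp_int (\sum_(i <- r | P i) F i).
Proof. by move=> h; apply: big_ind => //; [exact: qp_int0|exact: qp_intD]. Qed.

Definition qdvd (p : place) : set (Qp p) := [set x | exists2 y, qp_int y & x = (p : nat)%:R * y].

Lemma qdvd_zp (p : place) (x : Zp p) : qdvd (qp_of_zp x) <-> pdvd x.
Proof.
split=> [[_ [y _ <-]]|/pdvdP[y ->]].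
  rewrite -[_%:R](rmorph_nat (@qp_of_zp p)) -rmorphM => /qp_of_zp_inj ->.
  exact/pdvdMl/pdvd_p.
by exists (qp_of_zp y); [exists y|rewrite rmorphM rmorph_nat].
Qed.

Lemma qdvd_int (p : place) (x : Qp p) : qdvd x -> qp_int x.
Proof. by move=> [y yi ->]; apply/qp_intM => //; exact: qp_int_nat. Qed.
Lemma qdvd0 (p : place) : qdvd (0 : Qp p).
Proof. by exists 0; [exact: qp_int0|rewrite mulr0]. Qed.
Lemma qdvd1 (p : place) : ~ qdvd (1 : Qp p).
Proof. by rewrite -(rmorph1 (@qp_of_zp p)) qdvd_zp pdvd1. Qed.
Lemma qdvdD (p : place) (x y : Qp p) : qdvd x -> qdvd y -> qdvd (x + y).
Proof. by move=> [a ai ->] [b bi ->]; exists (a + b); [exact: qp_intD|rewrite mulrDr]. Qed.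
Lemma qdvdN (p : place) (x : Qp p) : qdvd x -> qdvd (- x).
Proof. by move=> [a ai ->]; exists (- a); [exact: qp_intN|rewrite mulrN]. Qed.
Lemma qdvdB (p : place) (x y : Qp p) : qdvd x -> qdvd y -> qdvd (x - y).
Proof. by move=> ? ?; apply/qdvdD/qdvdN. Qed.
Lemma qdvdMl (p : place) (x y : Qp p) : qdvd x -> qp_int y -> qdvd (x * y).
Proof. by move=> [a ai ->] yi; exists (a * y); [exact: qp_intM|rewrite mulrA]. Qed.
Lemma qdvdMr (p : place) (x y : Qp p) : qp_int x -> qdvd y -> qdvd (x * y).
Proof. by rewrite mulrC => ? ?; exact: qdvdMl. Qed.
Lemma qdvd_p (p : place) : qdvd ((p : nat)%:R : Qp p).
Proof. by exists 1; [exact: qp_int1|rewrite mulr1]. Qed.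
Lemma qdvdM (p : place) (x y : Qp p) : qp_int x -> qp_int y -> qdvd (x * y) -> qdvd x \/ qdvd y.
Proof.
by move=> [a _ <-] [b _ <-]; rewrite -rmorphM !qdvd_zp pdvdM => /orP.
Qed.
Lemma qdvd_nat (p : place) m : qdvd (m%:R : Qp p) <-> (p %| m)%N.
Proof. by rewrite -(rmorph_nat (@qp_of_zp p)) qdvd_zp pdvd_nat. Qed.
Lemma qdvd_intr (p : place) m : qdvd (m%:~R : Qp p) <-> (p %| `|m|)%N.
Proof.
case: m => m; first exact: qdvd_nat.
rewrite NegzE mulrNz; split=> [/qdvdN|h]; first by rewrite opprK => /qdvd_nat.
exact/qdvdN/qdvd_nat.
Qed.

Lemma qp_int_inv (p : place) (x : Qp p) : qp_int x -> ~ qdvd x -> x != 0 /\ qp_int x^-1.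
Proof.
move=> [a _ <-] /qdvd_zp /negP; rewrite -zp_unitE => ua; split.
  rewrite -(rmorph0 (@qp_of_zp p)) (inj_eq (@qp_of_zp_inj p)).
  by apply: contraTneq ua => ->; rewrite unitr0.
by exists a^-1 => //; rewrite rmorphV.
Qed.
Lemma qp_inv_int (p : place) (x : Qp p) : qp_int x -> qp_int x^-1 -> x != 0 -> ~ qdvd x.
Proof. by move=> xi vi x0 /qdvdMl /(_ vi); rewrite mulfV // => /qdvd1. Qed.

Lemma qp_approx (p : place) (x : Qp p) : qp_int x ->
  exists (m : nat) y, qp_int y /\ x = m%:R + (p : nat)%:R * y.
Proof.
move=> [a _ <-]; have [m [y ->]] := zp_approx a.
exists m, (qp_of_zp y); split; first by exists y.
by rewrite rmorphD rmorphM !rmorph_nat.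
Qed.

(** [ratr] makes sense over every unit ring, but it is a ring morphism only where the nonzero
    integers are invertible. This condition is checked below for Q_p, A_f and the real numbers. *)
Definition qalg (T : comUnitRingType) : Prop := forall n, (n.+1%:R : T) \is a GRing.unit.

Section QAlgebra.
Context (T : comUnitRingType) (hT : qalg T).

Lemma qalg_intr_unit (b : int) : b != 0 -> (b%:~R : T) \is a GRing.unit.
Proof.
case: b => [[|n] //|n] _; first exact: hT.
by rewrite NegzE mulrNz unitrN; exact: hT.
Qed.

Lemma ratr_frac (a b : int) : b != 0 -> ratr (a%:~R / b%:~R) = a%:~R / b%:~R :> T.
Proof.
move=> b0; rewrite /ratr; set q : rat := a%:~R / b%:~R.
have e : numq q * b = a * denq q.
  apply/eqP; rewrite -(eqr_int rat) !rmorphM /= numqE /q.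
  by rewrite mulrAC mulfVK ?intr_eq0.
apply: (canRL (mulrK (qalg_intr_unit b0))).
rewrite mulrAC -rmorphM e rmorphM mulrK //.
by apply: qalg_intr_unit; rewrite denq_eq0.
Qed.

Lemma ratrE_frac (x : rat) : exists a b : int, b != 0 /\ x = a%:~R / b%:~R.
Proof. by exists (numq x), (denq x); rewrite denq_eq0 divq_num_den. Qed.

(** [ratr] tagged by a proof of [qalg T], so that the morphism structures can be attached to it. *)
Definition qratr_of & qalg T : rat -> T := ratr.
Local Notation qratr := (qratr_of hT).

Lemma qratr_zmod_morphism : zmod_morphism qratr.
Proof.
move=> x y; have [a [b [b0 ->]]] := ratrE_frac x; have [c [d [d0 ->]]] := ratrE_frac y.
rewrite -mulNr addf_div ?intr_eq0 // -rmorphN -!rmorphM -rmorphD /qratr_of !ratr_frac ?mulf_neq0 //.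
have ub := qalg_intr_unit b0; have ud := qalg_intr_unit d0.
have ubd : ((b * d)%:~R : T) \is a GRing.unit by rewrite rmorphM unitrM ub.
apply: (canLR (mulrK ubd)); rewrite !rmorphD /= !rmorphM rmorphN /= mulrBl.
by rewrite mulrA divrK // [b%:~R * _]mulrC mulrA divrK // mulNr.
Qed.
Lemma qratr_monoid_morphism : monoid_morphism qratr.
Proof.
split; first by rewrite /qratr_of -[1]divr1 (@ratr_frac 1 1) // divr1.
move=> x y; have [a [b [b0 ->]]] := ratrE_frac x; have [c [d [d0 ->]]] := ratrE_frac y.
rewrite mulf_div -!rmorphM /qratr_of !ratr_frac ?mulf_neq0 //.
have ub := qalg_intr_unit b0; have ud := qalg_intr_unit d0.
by rewrite !rmorphM invrM // [RHS]mulrACA [d%:~R^-1 * _]mulrC.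
Qed.
HB.instance Definition _ := GRing.isZmodMorphism.Build rat T qratr qratr_zmod_morphism.
HB.instance Definition _ := GRing.isMonoidMorphism.Build rat T qratr qratr_monoid_morphism.
End QAlgebra.

(** * Adelic matrices *)

Lemma mem_places (p : place) n : (p \in places n) = ((p : nat) \in primes n). Proof. exact: mem_pmap_sub. Qed.

Lemma dvd_finite (n : nat) : (0 < n)%N -> finite_set [set p : place | (p %| n)%N].
Proof.
move=> n0; apply: (@sub_finite_set _ _ [set` places n]) => // p /= pn.
by rewrite mem_places mem_primes place_prime n0.
Qed.

Lemma qp_qalg (p : place) : qalg (Qp p).
Proof. by move=> n; rewrite unitfE qp_natr_eq0. Qed.

Definition afc (p : place) (a : Af) : Qp p := af_val a p.
Lemma afc_zmod_morphism p : zmod_morphism (@afc p). Proof. by []. Qed.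
Lemma afc_monoid_morphism p : monoid_morphism (@afc p). Proof. by []. Qed.
HB.instance Definition _ p := GRing.isZmodMorphism.Build Af (Qp p) (@afc p) (@afc_zmod_morphism p).
HB.instance Definition _ p := GRing.isMonoidMorphism.Build Af (Qp p) (@afc p) (@afc_monoid_morphism p).

Lemma af_eqP (a b : Af) : (forall p, afc p a = afc p b) -> a = b.
Proof. by move=> h; apply/val_inj/functional_extensionality_dep. Qed.

Lemma af_finite (a : Af) : finite_set [set p | ~ qp_int (afc p a)].
Proof. exact: (elimT (almost_intP _) (valP a)). Qed.

Lemma af_qalg : qalg Af.
Proof.
move=> n; pose x : qprod := fun p => n.+1%:R^-1.
have xP : x \in almost_int.
  apply/almost_intP; apply: sub_finite_set (dvd_finite (ltn0Sn n)) => p /= np.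
  apply: contrapT => npn; apply: np.
  by apply: (qp_int_inv (qp_int_nat _ _) _).2 => /qdvd_nat.
apply/unitrPr; exists (MkAf xP); apply: af_eqP => p.
have e : afc p (MkAf xP) = n.+1%:R^-1 by [].
by rewrite rmorphM rmorph_nat rmorph1 [X in _ * X]e divff // qp_natr_eq0.
Qed.

Lemma afc_ratr p q : afc p (ratr q) = ratr q.
Proof.
have [a [b [b0 ->]]] := ratrE_frac q.
rewrite (ratr_frac af_qalg) // (ratr_frac (@qp_qalg p)) //.
by rewrite rmorphM (rmorphV _ (qalg_intr_unit af_qalg b0)) !rmorph_int.
Qed.

Lemma afmx_eqP m n (A B : 'M[Af]_(m, n)) :
  (forall p, map_mx (afc p) A = map_mx (afc p) B) -> A = B.
Proof.
move=> h; apply/matrixP => i j; apply: af_eqP => p.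
by have /matrixP/(_ i j) := h p; rewrite !mxE.
Qed.

Lemma gl_ofE (A : comUnitRingType) (M : 'M[A]_2) : M \in unitmx -> (gl_of M : 'M_2) = M.
Proof. by move=> uM; rewrite /gl_of insubdK. Qed.

Lemma gl_inj (A : comUnitRingType) (g h : GL2 A) : (g : 'M_2) = h -> g = h.
Proof. exact: val_inj. Qed.
Lemma gl_mulE (A : comUnitRingType) (g h : GL2 A) : ((g * h)%g : 'M_2) = (g : 'M_2) *m h.
Proof. by []. Qed.
Lemma gl_oneE (A : comUnitRingType) : ((1%g : GL2 A) : 'M_2) = 1%:M.
Proof. by []. Qed.
Lemma gl_invE (A : comUnitRingType) (g : GL2 A) : ((g^-1)%g : 'M_2) = invmx g.
Proof. by []. Qed.
Lemma gl_ofK (A : comUnitRingType) (g : GL2 A) : gl_of (g : 'M_2) = g.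
Proof. by apply: gl_inj; rewrite gl_ofE // gl_unit. Qed.

(* Opaque copies of the maps of Defs, so that conversion never computes adelic matrices. *)
HB.lock Definition cmp (p : place) (g : GL2 Af) : GL2 (Qp p) := gl_comp p g.
HB.lock Definition gat (p : place) (g : GL2 (Qp p)) : GL2 Af := gl_at g.
HB.lock Definition awy (S : set place) (g : GL2 Af) : GL2 Af := away_part S g.

Lemma cmpE p (g : GL2 Af) : (cmp p g : 'M_2) = map_mx (afc p) g.
Proof.
rewrite cmp.unlock /gl_comp.
have -> : (\matrix_(i, j) (af_val (g i j) p : Qp p)) = map_mx (afc p) g.
  by apply/matrixP => i j; rewrite !mxE.
by rewrite gl_ofE // unitmxE det_map_mx rmorph_unit // -unitmxE gl_unit.
Qed.

Lemma cmpM p g h : cmp p (g * h)%g = (cmp p g * cmp p h)%g.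
Proof. by apply: gl_inj; rewrite gl_mulE !cmpE gl_mulE map_mxM. Qed.
Lemma cmp1 p : cmp p 1%g = 1%g.
Proof. by apply: gl_inj; rewrite cmpE map_mx1. Qed.
Lemma cmpV p g : cmp p (g^-1)%g = ((cmp p g)^-1)%g.
Proof. by apply: (@mulgI _ (cmp p g)); rewrite -cmpM !mulgV cmp1. Qed.

Lemma gl_eqP (g h : GL2 Af) : (forall p, cmp p g = cmp p h) -> g = h.
Proof. by move=> e; apply/gl_inj/afmx_eqP => p; rewrite -!cmpE e. Qed.

Lemma afc_at p x a : afc p (adele_at x a) = x.
Proof. by rewrite /afc /= eqtype.dfwith_in. Qed.
Lemma afc_at_neq p q (x : Qp p) a : q != p -> afc q (adele_at x a) = afc q a.
Proof. by rewrite eq_sym => pq; rewrite /afc /= eqtype.dfwith_out. Qed.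

Lemma gl_unit_cmpP (M N : 'M[Af]_2) :
  (forall p, map_mx (afc p) M *m map_mx (afc p) N = 1%:M) -> M \in unitmx.
Proof.
move=> h; have /mulmx1_unit[] // : M *m N = 1%:M.
by apply: afmx_eqP => p; rewrite map_mxM h map_mx1.
Qed.

Section At.
Context (l : place).
Implicit Type g : GL2 (Qp l).

Let at_mx (g : GL2 (Qp l)) : 'M[Af]_2 := \matrix_(i, j) adele_at (g i j) ((1%g : GL2 Af) i j).

Let at_mx_in g : map_mx (afc l) (at_mx g) = g.
Proof. by apply/matrixP => i j; rewrite !mxE afc_at. Qed.
Let at_mx_out g p : p != l -> map_mx (afc p) (at_mx g) = 1%:M.
Proof. by move=> pl; apply/matrixP => i j; rewrite !mxE afc_at_neq // rmorph_nat. Qed.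

Let at_mx_unit g : at_mx g \in unitmx.
Proof.
apply: (@gl_unit_cmpP _ (at_mx (g^-1)%g)) => p.
case: (eqVneq p l) => [->|pl]; last by rewrite !at_mx_out // mulmx1.
by rewrite !at_mx_in mulmxV // gl_unit.
Qed.

Lemma cmp_at g : cmp l (gat g) = g.
Proof.
apply: gl_inj; rewrite cmpE gat.unlock -[gl_at g]/(gl_of (at_mx g)) gl_ofE //.
Qed.
Lemma cmp_at_neq g p : p != l -> cmp p (gat g) = 1%g.
Proof. move=> pl; apply: gl_inj; rewrite cmpE gat.unlock -[gl_at g]/(gl_of (at_mx g)) gl_ofE //.
exact: at_mx_out. Qed.

Lemma gat_eqP g (x : GL2 Af) : cmp l x = g ->
  (forall p, p != l -> cmp p x = 1%g) -> x = gat g.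
Proof.
move=> xl xn; apply: gl_eqP => p; case: (eqVneq p l) => [->|pl].
  by rewrite cmp_at.
by rewrite cmp_at_neq // xn.
Qed.

Lemma gatM g h : gat (g * h)%g = (gat g * gat h)%g.
Proof.
apply/esym/gat_eqP => [|p pl]; first by rewrite cmpM !cmp_at.
by rewrite cmpM !cmp_at_neq // mulg1.
Qed.
Lemma gat1 : gat (1%g : GL2 (Qp l)) = 1%g.
Proof. by apply/esym/gat_eqP => [|p pl]; rewrite cmp1. Qed.
Lemma gatV g : gat (g^-1)%g = ((gat g)^-1)%g.
Proof. by apply: (@mulgI _ (gat g)); rewrite -gatM !mulgV gat1. Qed.

Lemma gat_commute g (x : GL2 Af) : cmp l x = 1%g -> (gat g * x = x * gat g)%g.
Proof.
move=> xl; apply: gl_eqP => p; rewrite !cmpM.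
case: (eqVneq p l) => [->|pl]; first by rewrite xl mulg1 mul1g.
by rewrite cmp_at_neq // mulg1 mul1g.
Qed.
End At.

Lemma cmp_awy (S : set place) (g : GL2 Af) p :
  cmp p (awy S g) = if p \in S then 1%g else cmp p g.
Proof.
pose mx (g : GL2 Af) : 'M[Af]_2 := \matrix_(i, j) adele_glue S ((1%g : GL2 Af) i j) (g i j).
have mxP (x : GL2 Af) q : map_mx (afc q) (mx x) = if q \in S then 1%:M else map_mx (afc q) x.
  apply/matrixP => i j; rewrite /mx !mxE /afc /=.
  by case: ifP; rewrite !mxE // -!/(afc q _) rmorph_nat.
have mxU : mx g \in unitmx.
  apply: (@gl_unit_cmpP _ (mx (g^-1)%g)) => q; rewrite !mxP.
  case: ifP => _; first by rewrite mulmx1.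
  by rewrite -map_mxM mulmxV ?gl_unit // map_mx1.
apply: gl_inj; rewrite cmpE awy.unlock -[away_part S g]/(gl_of (mx g)) gl_ofE // mxP.
by case: ifP => // _; rewrite cmpE.
Qed.

Section GL2Z.
Context (p : place).
Implicit Types g h : GL2 (Qp p).

Lemma GL2_Z1 : GL2_Z p (1%g : GL2 (Qp p)).
Proof. by move=> i j; rewrite invg1 !mxE; split; exact: qp_int_nat. Qed.
Lemma GL2_ZM g h : GL2_Z p g -> GL2_Z p h -> GL2_Z p (g * h)%g.
Proof.
move=> gZ hZ i j; rewrite invgM !gl_mulE !mxE; split; apply: qp_int_sum => k _.
  by apply: qp_intM; [exact: (gZ _ _).1|exact: (hZ _ _).1].
by apply: qp_intM; [exact: (hZ _ _).2|exact: (gZ _ _).2].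
Qed.
Lemma GL2_ZV g : GL2_Z p g -> GL2_Z p (g^-1)%g.
Proof. by move=> gZ i j; rewrite invgK; have [] := gZ i j. Qed.
Lemma GL2_Z_subgroup : is_subgroup (GL2_Z p).
Proof. by split; [exact: GL2_Z1|exact: GL2_ZM|exact: GL2_ZV]. Qed.
End GL2Z.

Lemma gl_almost_int (g : GL2 Af) : finite_set [set p | ~ GL2_Z p (cmp p g)].
Proof.
pose F (ij : 'I_2 * 'I_2) := [set p | ~ qp_int (afc p (g ij.1 ij.2))] `|`
  [set p | ~ qp_int (afc p ((g^-1)%g ij.1 ij.2))].
apply: (@sub_finite_set _ _ (\bigcup_(ij in [set: 'I_2 * 'I_2]) F ij)).
  move=> p /= /existsNP[i /existsNP[j nij]]; exists (i, j) => //.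
  rewrite /F /=; apply: contrapT => /not_orP[/contrapT h1 /contrapT h2]; apply: nij.
  by rewrite -cmpV !cmpE !mxE.
by apply: bigcup_finite => // ij _; rewrite finite_setU; split; exact: af_finite.
Qed.

(** * The torus *)

Lemma iota_linear (E : fieldExtType rat) (w : 2.-tuple E) (A : comUnitRingType) :
  linear (@iota E w A).
Proof.
move=> a u v; rewrite /iota scaler_sumr -big_split /=; apply: eq_bigr => k _.
by rewrite !mxE scalerDl scalerA.
Qed.
HB.instance Definition _ (E : fieldExtType rat) (w : 2.-tuple E) (A : comUnitRingType) :=
  GRing.isLinear.Build A _ _ _ (@iota E w A) (@iota_linear E w A).

Lemma iotaZ (E : fieldExtType rat) (w : 2.-tuple E) (A : comUnitRingType) (a : A) v :
  iota w (a *: v) = a *: iota w v.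
Proof. exact: linearZ. Qed.

Lemma iota_sum (E : fieldExtType rat) (w : 2.-tuple E) (A : comUnitRingType)
    (I : Type) (r : seq I) (P : pred I) (F : I -> 'cV[A]_2) :
  iota w (\sum_(i <- r | P i) F i) = \sum_(i <- r | P i) iota w (F i).
Proof. exact: raddf_sum. Qed.

Section TorusAlgebra.
Context (E : fieldExtType rat) (w : 2.-tuple E) (hw : basis_of {: E} w).
Implicit Types x y : E.

Definition cvec x : 'cV[rat]_2 := \col_i coord w i x.

Lemma cvec_linear : linear cvec.
Proof. by move=> a x y; apply/matrixP => i j; rewrite !mxE linearP. Qed.
HB.instance Definition _ := GRing.isLinear.Build rat E 'cV[rat]_2 *:%R cvec cvec_linear.

Lemma coordK x : x = \sum_i coord w i x *: w`_i.
Proof. exact: (coord_basis hw (memvf x)). Qed.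

Lemma cvec_inj : injective cvec.
Proof.
move=> x y e; rewrite (coordK x) (coordK y); apply: eq_bigr => i _.
by have /matrixP/(_ i 0) := e; rewrite !mxE => ->.
Qed.

Lemma coord_w (i j : 'I_2) : coord w i w`_j = (i == j)%:R.
Proof. by rewrite coord_free ?(basis_free hw) 1?eq_sym. Qed.

Lemma mulE_linear : linear (mulE w).
Proof. by move=> a x y; apply/matrixP => i j; rewrite !mxE mulrDl -scalerAl linearP. Qed.
HB.instance Definition _ := GRing.isLinear.Build rat E 'M[rat]_2 *:%R (mulE w) mulE_linear.

Lemma mulEZ (a : rat) x : mulE w (a *: x) = a *: mulE w x.
Proof. by apply/matrixP => i j; rewrite !mxE -scalerAl linearZ. Qed.

Lemma mulE_cvec x y : mulE w x *m cvec y = cvec (x * y).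
Proof.
rewrite [in RHS](coordK y) mulr_sumr raddf_sum /=; apply/matrixP => i j.
rewrite summxE mxE; apply: eq_bigr => k _.
by rewrite -scalerAr linearZ !mxE mulrC.
Qed.

Lemma mulmx_cvec_inj (M N : 'M[rat]_2) : (forall y, M *m cvec y = N *m cvec y) -> M = N.
Proof.
move=> h; apply/matrixP => i j; have /matrixP/(_ i 0) := h w`_j.
have eM (L : 'M[rat]_2) : (L *m cvec w`_j) i 0 = L i j.
  rewrite mxE (bigD1 j) //= mxE coord_w eqxx mulr1 big1 ?addr0 // => k /negPf kj.
  by rewrite mxE coord_w kj mulr0.
by rewrite !eM.
Qed.

Lemma mulEM x y : mulE w (x * y) = mulE w x *m mulE w y.
Proof. by apply: mulmx_cvec_inj => z; rewrite -mulmxA !mulE_cvec mulrA. Qed.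
Lemma mulE1 : mulE w 1 = 1%:M.
Proof. by apply: mulmx_cvec_inj => z; rewrite mulE_cvec mul1r mul1mx. Qed.
Lemma mulE_inj : injective (mulE w).
Proof. by move=> x y e; apply: cvec_inj; rewrite -(mulr1 x) -(mulr1 y) -!mulE_cvec e. Qed.

Section Points.
Context (T : comUnitRingType) (hT : qalg T).
Local Notation f := (qratr_of hT).
Implicit Types u v : 'cV[T]_2.

Lemma vecE_map x : vecE w T x = map_mx f (cvec x).
Proof. by apply/matrixP => i j; rewrite !mxE. Qed.

Lemma vecED x y : vecE w T (x + y) = vecE w T x + vecE w T y.
Proof. by rewrite !vecE_map raddfD map_mxD. Qed.
Lemma vecEB x y : vecE w T (x - y) = vecE w T x - vecE w T y.
Proof. by rewrite !vecE_map raddfB map_mxB. Qed.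
Lemma vecE0 : vecE w T 0 = 0.
Proof. by rewrite !vecE_map raddf0 map_mx0. Qed.
Lemma vecE_nat m x : vecE w T (m%:R * x) = m%:R *: vecE w T x.
Proof. by rewrite mulr_natl scaler_nat !vecE_map raddfMn /= raddfMn. Qed.
Lemma vecE_int m x : vecE w T (m%:~R * x) = m%:~R *: vecE w T x.
Proof. by rewrite mulrzl scaler_int !vecE_map raddfMz /= raddfMz. Qed.

Lemma vecE_w (j : 'I_2) : vecE w T w`_j = delta_mx j 0.
Proof.
apply/matrixP => i k; rewrite (ord1 k) !mxE coord_w -[ratr _]/(f _) rmorph_nat eqxx andbT //.
Qed.

Lemma cv_decomp v : v = \sum_k v k 0 *: vecE w T w`_k.
Proof.
apply/matrixP => i j; rewrite (ord1 j) summxE (bigD1 i) //= mxE vecE_w mxE !eqxx mulr1.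
by rewrite big1 ?addr0 // => k /negPf ki; rewrite mxE vecE_w mxE eq_sym ki mulr0.
Qed.

Lemma iota_vecE x : iota w (vecE w T x) = map_mx f (mulE w x).
Proof.
rewrite [in RHS](coordK x) raddf_sum map_mx_sum /iota; apply: eq_bigr => k _.
by rewrite mxE /= mulEZ map_mxZ.
Qed.

Lemma iota1 : iota w (vecE w T 1) = 1%:M.
Proof. by rewrite iota_vecE mulE1 map_mx1. Qed.

Lemma tmulE u v : tmul w u v = iota w u *m v. Proof. by []. Qed.

Lemma tmul_vecE x y : tmul w (vecE w T x) (vecE w T y) = vecE w T (x * y).
Proof. by rewrite tmulE iota_vecE !vecE_map -map_mxM mulE_cvec. Qed.

(** Expanding both factors in the rational vectors of w reduces identities over T, such as
    commutativity, to identities in E. *)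
Lemma tmul_sum u v : tmul w u v =
  \sum_j \sum_k (u j 0 * v k 0) *: vecE w T (w`_j * w`_k).
Proof.
rewrite tmulE {1}(cv_decomp u) raddf_sum mulmx_suml; apply: eq_bigr => j _.
rewrite {1}(cv_decomp v) mulmx_sumr; apply: eq_bigr => k _.
by rewrite /= iotaZ -scalemxAl -scalemxAr scalerA -tmul_vecE.
Qed.

Lemma tmulC u v : tmul w u v = tmul w v u.
Proof.
rewrite !tmul_sum exchange_big; apply: eq_bigr => j _; apply: eq_bigr => k _.
by rewrite mulrC [w`_j * _]mulrC.
Qed.

Lemma iota_tmul u v : iota w (tmul w u v) = iota w u *m iota w v.
Proof.
rewrite tmul_sum [in RHS](cv_decomp u) [in RHS](cv_decomp v) !iota_sum mulmx_suml.
apply: eq_bigr => j _; rewrite iota_sum mulmx_sumr; apply: eq_bigr => k _.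
by rewrite /= !iotaZ -scalemxAl -scalemxAr scalerA !iota_vecE mulEM map_mxM.
Qed.

Lemma iota_comm u v : iota w u *m iota w v = iota w v *m iota w u.
Proof. by rewrite -!iota_tmul tmulC. Qed.
Lemma tmul1 v : tmul w v (vecE w T 1) = v.
Proof. by rewrite tmulC tmulE iota1 mul1mx. Qed.
Lemma tmul1v v : tmul w (vecE w T 1) v = v.
Proof. by rewrite tmulE iota1 mul1mx. Qed.
Lemma iota_inj u v : iota w u = iota w v -> u = v.
Proof. by move=> e; rewrite -(tmul1 u) -(tmul1 v) !tmulE e. Qed.
Lemma tmulA u v t : tmul w u (tmul w v t) = tmul w (tmul w u v) t.
Proof. by rewrite !tmulE iota_tmul mulmxA. Qed.

Lemma iota_inv u : iota w u \in unitmx ->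
  invmx (iota w u) = iota w (invmx (iota w u) *m vecE w T 1).
Proof.
move=> uu; rewrite -[RHS](mulKmx uu) -iota_tmul tmulE mulmxA mulmxV // mul1mx.
by rewrite iota1 mulmx1.
Qed.
End Points.

Lemma mulE_unit x : x != 0 -> mulE w x \in unitmx.
Proof.
by move=> x0; have /mulmx1_unit[] // : mulE w x *m mulE w x^-1 = 1%:M; rewrite -mulEM divff // mulE1.
Qed.

(** A matrix that commutes with E is E-linear, hence is the multiplication by its value at 1. This
    is what turns an equality of CM points into an element of E^*. *)
Lemma mulE_centralizer (M : 'M[rat]_2) : (forall k : 'I_2, M *m mulE w w`_k = mulE w w`_k *m M) ->
  exists x, M = mulE w x.
Proof.
move=> hM; have hM' y : M *m mulE w y = mulE w y *m M.
  rewrite (coordK y) raddf_sum mulmx_sumr mulmx_suml; apply: eq_bigr => k _.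
  by rewrite /= mulEZ -scalemxAr hM -scalemxAl.
pose c := M *m cvec 1; pose x := \sum_i c i 0 *: w`_i.
have cx : cvec x = c.
  apply/matrixP => i j; rewrite (ord1 j) mxE linear_sum (bigD1 i) //= linearZ /= coord_w eqxx mulr1.
  by rewrite big1 ?addr0 // => k /negPf ki; rewrite linearZ /= coord_w eq_sym ki mulr0.
exists x; apply: mulmx_cvec_inj => y.
by rewrite mulE_cvec mulrC -mulE_cvec cx /c mulmxA -hM' -mulmxA mulE_cvec mulr1.
Qed.
End TorusAlgebra.

Lemma horner_root (F : nzRingType) (p : {poly F}) x : root p x -> p.[x] = 0.
Proof. by move/rootP. Qed.

(** * The Galois group of the abelian closure *)

Section MinimalPolynomial.
Context (F C : fieldType) (i : {rmorphism F -> C}) (a : C).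
Implicit Types p q : {poly F}.

(** The minimal polynomial relative to the embedding i, determined only up to a nonzero scalar. *)
Definition is_minpoly p : Prop :=
  [/\ p != 0, root (map_poly i p) a & forall q, root (map_poly i q) a -> p %| q].

Lemma minpoly_exists P : P != 0 -> root (map_poly i P) a -> exists p, is_minpoly p.
Proof.
move=> P0 rP.
pose isroot n := `[< exists q, [/\ q != 0, size q = n & root (map_poly i q) a] >].
have ex : exists n, isroot n by exists (size P); apply/asboolP; exists P.
case: (ex_minnP ex) => n /asboolP[p [p0 sp rp]] minn.
exists p; split=> // q rq; apply: contrapT => /negP; rewrite /dvdp => m0.
have rm : root (map_poly i (q %% p)) a.
  move: rq; rewrite {1}(divp_eq q p) rmorphD rmorphM /= /root !hornerE (horner_root rp).
  by rewrite mulr0 add0r.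
have := minn (size (q %% p)); rewrite leqNgt -sp ltn_modp p0 => h.
by have /h : isroot (size (q %% p)) by apply/asboolP; exists (q %% p).
Qed.

Lemma minpoly_bezout p q : is_minpoly p -> ~~ root (map_poly i q) a ->
  exists u v, u * q + v * p = 1.
Proof.
move=> [p0 ra minp] q0.
have /Bezout_coprimepP[[u v] /= uv] : coprimep q p.
  rewrite /coprimep; have /dvdpP[h hE] := dvdp_gcdr q p.
  have e1g : ~~ root (map_poly i (gcdp q p)) a.
    apply: contra q0 => g0; have /dvdpP[t ->] := dvdp_gcdl q p.
    by rewrite rmorphM rootM g0 orbT.
  have h0 : h != 0 by apply: contraNneq p0 => h0; rewrite hE h0 mul0r.
  have g0 : gcdp q p != 0 by rewrite gcdp_eq0 negb_and p0 orbT.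
  have : p %| h.
    by apply: minp; move: ra; rewrite {1}hE rmorphM rootM (negPf e1g) orbF.
  move=> /(dvdp_leq h0); rewrite {1}hE size_mul // => le.
  have s1 : (0 < size h)%N by rewrite lt0n size_poly_eq0.
  have s2 : (0 < size (gcdp q p))%N by rewrite lt0n size_poly_eq0.
  rewrite eqn_leq s2 andbT -(leq_add2l (size h).-1).
  by move: le; rewrite -(prednK s1) addSn addn1.
have [k k0 kE] : exists2 k, k != 0 & u * q + v * p = k%:P.
  have : size (u * q + v * p) == 1 by rewrite (eqp_size uv) size_poly1.
  by case/size_poly1P => k k0 ->; exists k.
exists (k^-1 *: u), (k^-1 *: v).
by rewrite -!scalerAl -scalerDr kE -mul_polyC -polyCM mulVf.
Qed.

Lemma minpoly_size p : is_minpoly p -> (1 < size p)%N.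
Proof.
move=> [p0 ra _]; rewrite ltnNge; apply: contraL ra => /size1_polyC pE.
by rewrite pE map_polyC rootC fmorph_eq0 -polyC_eq0 -pE.
Qed.

Lemma minpoly_irreducible p : is_minpoly p -> irreducible_poly p.
Proof.
move=> mp; split=> [|q sq qp]; first exact: minpoly_size.
have [p0 ra minp] := mp; have /dvdpP[h hE] := qp.
have /orP[rh|rq] : root (map_poly i h) a || root (map_poly i q) a.
  by rewrite -rootM -rmorphM -hE.
  have hp := minp _ rh; have h0 : h != 0 by apply: contraNneq p0 => h0; rewrite hE h0 mul0r.
  have q0 : q != 0 by apply: contraNneq p0 => q0; rewrite hE q0 mulr0.
  have := dvdp_leq h0 hp; rewrite {1}hE size_mul // => le.
  have s1 : (0 < size h)%N by rewrite lt0n size_poly_eq0.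
  have s2 : (0 < size q)%N by rewrite lt0n size_poly_eq0.
  case/negP: sq; rewrite eqn_leq s2 andbT -(leq_add2l (size h).-1).
  by move: le; rewrite -(prednK s1) addSn addn1.
by rewrite /eqp qp minp.
Qed.
End MinimalPolynomial.

Section PartialEmbedding.
Context (C : closedFieldType).
Implicit Types (G : set (C * C)) (a b : C).

(* G is the graph of an embedding into C of a subfield of C. *)
Definition pemb G : Prop :=
  [/\ G (1, 1), forall a b c d, G (a, b) -> G (c, d) -> G (a - c, b - d),
      forall a b c d, G (a, b) -> G (c, d) -> G (a * c, b * d),
      forall a b, G (a, b) -> G (a^-1, b^-1) & forall b, G (0, b) -> b = 0].

Lemma pemb_fun G a b b' : pemb G -> G (a, b) -> G (a, b') -> b = b'.
Proof.
move=> [_ hB _ _ h0] g1 g2; apply/eqP; rewrite -subr_eq0.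
by have := hB _ _ _ _ g1 g2; rewrite subrr => /h0/eqP.
Qed.

Lemma pemb0 G : pemb G -> G (0, 0).
Proof. by move=> [h1 hB _ _ _]; have := hB _ _ _ _ h1 h1; rewrite !subrr. Qed.
Lemma pembD G a b c d : pemb G -> G (a, b) -> G (c, d) -> G (a + c, b + d).
Proof.
move=> hG gab gcd; have g0 := pemb0 hG; have [_ hB _ _ _] := hG.
by have := hB _ _ _ _ gab (hB _ _ _ _ g0 gcd); rewrite !sub0r !opprK.
Qed.

Lemma pemb_injective G a a' b : pemb G -> G (a, b) -> G (a', b) -> a = a'.
Proof.
move=> [h1 hB hM hV h0] g1 g2; apply/eqP; rewrite -subr_eq0; apply: contrapT => /negP d0.
have g3 := hB _ _ _ _ g1 g2; rewrite subrr in g3.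
have := hB _ _ _ _ h1 (hM _ _ _ _ (hV _ _ g3) g3).
by rewrite mulVf // mulr0 subrr subr0 => /h0/eqP; rewrite oner_eq0.
Qed.

Section FieldOf.
Context (G : set (C * C)) (hG : pemb G).

(** The graph G is itself a field inside C x C: its two projections are the inclusion of the
    subfield and its embedding. *)
Definition pf_pred : {pred C * C} := fun x => `[< G x >].
Record pf (h : pemb G) := MkPf { pf_val : C * C; _ : pf_val \in pf_pred }.
HB.instance Definition _ := [isSub for @pf_val hG].
HB.instance Definition _ := [Choice of pf hG by <:].

Lemma pf_subring_closed : subring_closed pf_pred.
Proof.
have [h1 hB hM _ _] := hG; split; first exact/asboolP.
- by move=> [a b] [c d] /asboolP g1 /asboolP g2; apply/asboolP; exact: hB.
- by move=> [a b] [c d] /asboolP g1 /asboolP g2; apply/asboolP; exact: hM.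
Qed.
HB.instance Definition _ :=
  GRing.SubChoice_isSubComNzRing.Build (C * C)%type pf_pred (pf hG) pf_subring_closed.
HB.instance Definition _ :=
  GRing.ComNzRing_hasMulInverse.Build (pf hG) (@cmulVx (pf hG)) (@cunitPl (pf hG)) (@cinv_out (pf hG)).

Lemma pf_field_axiom : GRing.field_axiom (pf hG).
Proof.
move=> [[a b] gab] x0; have /asboolP g := gab; have [h1 hB hM hV h0] := hG.
have gV : (a^-1, b^-1) \in pf_pred by apply/asboolP/hV.
apply/unitrPr; exists (MkPf hG gV); apply/val_inj => /=.
have a0 : a != 0.
  apply: contraNneq x0 => a0; apply/eqP/val_inj => /=; rewrite a0 in g *.
  by rewrite (h0 _ g).
have b0 : b != 0.
  apply: contraNneq a0 => b0; rewrite b0 in g.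
  exact/eqP/(pemb_injective hG g (pemb0 hG)).
by congr (_, _); rewrite /= divff.
Qed.
HB.instance Definition _ := GRing.ComUnitRing_isField.Build (pf hG) pf_field_axiom.

Definition pf1 (x : pf hG) : C := (pf_val x).1.
Definition pf2 (x : pf hG) : C := (pf_val x).2.
Lemma pf1_zmod_morphism : zmod_morphism pf1. Proof. by []. Qed.
Lemma pf1_monoid_morphism : monoid_morphism pf1. Proof. by []. Qed.
Lemma pf2_zmod_morphism : zmod_morphism pf2. Proof. by []. Qed.
Lemma pf2_monoid_morphism : monoid_morphism pf2. Proof. by []. Qed.
HB.instance Definition _ := GRing.isZmodMorphism.Build (pf hG) C pf1 pf1_zmod_morphism.
HB.instance Definition _ := GRing.isMonoidMorphism.Build (pf hG) C pf1 pf1_monoid_morphism.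
HB.instance Definition _ := GRing.isZmodMorphism.Build (pf hG) C pf2 pf2_zmod_morphism.
HB.instance Definition _ := GRing.isMonoidMorphism.Build (pf hG) C pf2 pf2_monoid_morphism.

Lemma pfP (x : pf hG) : G (pf1 x, pf2 x).
Proof. by have /asboolP := valP x; case: x => [[a b] ?]. Qed.
Lemma pf_of a b : G (a, b) -> exists x : pf hG, pf1 x = a /\ pf2 x = b.
Proof. by move=> g; have gP : (a, b) \in pf_pred by [apply/asboolP]; exists (MkPf hG gP). Qed.
End FieldOf.

Definition alg_over G a : Prop := exists P : {poly C},
  [/\ P != 0, forall k, exists b, G (P`_k, b) & root P a].

Lemma alg_overS G G' a : G `<=` G' -> alg_over G a -> alg_over G' a.
Proof. by move=> s [P [P0 hP r]]; exists P; split=> // k; have [b /s] := hP k; exists b. Qed.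

Lemma alg_over_minpoly G (hG : pemb G) a : alg_over G a -> exists p, is_minpoly (@pf1 G hG) a p.
Proof.
move=> [P [P0 hP rP]].
have [c cE] : exists c : nat -> pf hG, forall k, pf1 (c k) = P`_k.
  have hc k : exists x : pf hG, pf1 x = P`_k.
    by have [b /(pf_of hG)[x [x1 _]]] := hP k; exists x.
  by have [c hc'] := choice hc; exists c.
have e : map_poly (@pf1 G hG) (\poly_(k < size P) c k) = P.
  apply/polyP => k; rewrite coef_map coef_poly; case: ltnP => h; first exact: cE.
  by rewrite nth_default.
apply: (@minpoly_exists _ _ _ _ (\poly_(k < size P) c k)); last by rewrite e.
by apply: contraNneq P0 => q0; rewrite -e q0 rmorph0.
Qed.

(** The map q(a) -> q(b) is well defined because p divides every q vanishing at a, and its graph is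
    stable under inverses by a Bezout relation between q and p. *)
Lemma adjoin_graph (F : fieldType) (i s : {rmorphism F -> C}) a b p :
  is_minpoly i a p -> root (map_poly s p) b ->
  pemb [set ab | exists q, ab = ((map_poly i q).[a], (map_poly s q).[b])].
Proof.
move=> mp rb; have [p0 ra minp] := mp.
have e2p q : root (map_poly i q) a -> (map_poly s q).[b] = 0.
  by move=> /minp/dvdpP[u ->]; rewrite rmorphM hornerM (horner_root rb) mulr0.
split.
- by exists 1; rewrite !rmorph1 !hornerC.
- move=> c d c' d' [q [-> ->]] [q' [-> ->]]; exists (q - q').
  by rewrite !rmorphB !hornerD !hornerN.
- move=> c d c' d' [q [-> ->]] [q' [-> ->]]; exists (q * q').
  by rewrite !rmorphM !hornerM.
- move=> c d [q [-> ->]]; case: (boolP (root (map_poly i q) a)) => [rq|nrq].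
    by exists 0; rewrite (e2p q rq) (horner_root rq) !rmorph0 !horner0 !invr0.
  have [u [v uv]] := minpoly_bezout mp nrq.
  have inv (t : {rmorphism F -> C}) c' : root (map_poly t p) c' ->
      (map_poly t q).[c']^-1 = (map_poly t u).[c'].
    move=> rc; have := congr1 (fun r => (map_poly t r).[c']) uv.
    rewrite /= rmorphD !rmorphM rmorph1 hornerD !hornerM hornerC (horner_root rc) mulr0 addr0 => e.
    have q0 : (map_poly t q).[c'] != 0 by apply: contra_eqN e => /eqP->; rewrite mulr0 eq_sym oner_eq0.
    by apply: (mulIf q0); rewrite e mulVf.
  by exists u; rewrite (inv i a) ?(inv s b).
- by move=> d [q [q0 ->]]; apply/e2p/rootP.
Qed.

Lemma adjoin_pemb G (hG : pemb G) a b p :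
  is_minpoly (@pf1 G hG) a p -> root (map_poly (@pf2 G hG) p) b ->
  exists G', [/\ pemb G', G `<=` G' & G' (a, b)].
Proof.
move=> mp rb; eexists; split; first exact: (adjoin_graph mp rb).
  move=> [c d] /(pf_of hG)[x [<- <-]]; exists x%:P.
  by rewrite !map_polyC !hornerC.
by exists 'X; rewrite !map_polyX !hornerX.
Qed.

Lemma pemb_extend G : pemb G ->
  exists G', [/\ pemb G', G `<=` G' & forall a, alg_over G a -> exists b, G' (a, b)].
Proof.
(* Zorn's lemma is applied to the sets X to be added to G rather than to the graphs themselves, so
   that the empty chain is bounded by the empty set. *)
move=> hG; pose P X := pemb (G `|` X).
have [|A [hA maxA]] := @Zorn_bigcup _ P.
  move=> F FP totF.
  have two x y : (G `|` \bigcup_(X in F) X) x -> (G `|` \bigcup_(X in F) X) y ->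
      exists X, [/\ P X, X `<=` \bigcup_(X in F) X, (G `|` X) x & (G `|` X) y].
    have P0 : P set0 by rewrite /P setU0.
    move=> [gx|[X FX Xx]] [gy|[Y FY Yy]].
    - by exists set0; split=> //; left.
    - by exists Y; split; [exact: FP|exact: bigcup_sup|left|right].
    - by exists X; split; [exact: FP|exact: bigcup_sup|right|left].
    - have [XY|YX] := totF _ _ FX FY.
        by exists Y; split; [exact: FP|exact: bigcup_sup|right; exact: XY|right].
      by exists X; split; [exact: FP|exact: bigcup_sup|right|right; exact: YX].
  have up X z : X `<=` \bigcup_(X in F) X -> (G `|` X) z -> (G `|` \bigcup_(X in F) X) z.
    by move=> sX [?|/sX ?]; [left|right].
  split; first by left; case: hG.
  - by move=> a b c d g1 g2; have [X [[_ h _ _ _] sX x1 x2]] := two _ _ g1 g2; exact/(up X)/h.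
  - by move=> a b c d g1 g2; have [X [[_ _ h _ _] sX x1 x2]] := two _ _ g1 g2; exact/(up X)/h.
  - by move=> a b g; have [X [[_ _ _ h _] sX x1 _]] := two _ _ g g; exact/(up X)/h.
  - by move=> b g; have [X [[_ _ _ _ h] sX x1 _]] := two _ _ g g; exact/h.
exists (G `|` A); split; [exact: hA|by move=> x gx; left|].
move=> a /(@alg_overS _ (G `|` A)) algA; apply: contrapT => na.
have [p mp] := alg_over_minpoly hA (algA (@subsetUl _ G A)).
have [b rb] : exists b, root (map_poly (@pf2 _ hA) p) b.
  apply/closed_rootP; rewrite size_map_poly.
  by have := minpoly_size mp; case: (size p) => [|[]].
have [G' [hG' sG' gab]] := adjoin_pemb mp rb.
apply: (maxA G'); last first.
  rewrite /P setUC (_ : G' `|` G = G') //; apply/setUidPl => x gx; apply: sG'; by left.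
split; first by move=> x ax; apply: sG'; right.
by move=> /(_ _ gab) Aab; apply: na; exists b; right.
Qed.
End PartialEmbedding.

Section AbelianClosure.
Context (R : realType) (E : fieldExtType rat) (emb : {rmorphism E -> R[i]}).
Local Notation C := R[i].
Local Notation Eab := (Eab emb).
Implicit Types (G : set (C * C)) (M : set C).

(** Plays the role of an element of the absolute Galois group of E: only its values at the numbers
    algebraic over E matter, and its domain contains all of them. *)
Definition epemb G : Prop :=
  [/\ pemb G, forall e, G (emb e, emb e) & forall a, algebraicOver emb a -> exists b, G (a, b)].

Lemma pemb_horner G a b (q : {poly E}) : pemb G -> (forall e, G (emb e, emb e)) -> G (a, b) ->
  G ((map_poly emb q).[a], (map_poly emb q).[b]).
Proof.
move=> hG hE hab; have [_ _ hM _ _] := hG.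
elim/poly_ind: q => [|q c IH]; first by rewrite rmorph0 !horner0; exact: pemb0.
rewrite rmorphD rmorphM /= map_polyX map_polyC !hornerE /=.
exact: pembD (hM _ _ _ _ IH hab) (hE c).
Qed.

Lemma pemb_root G a b (q : {poly E}) : pemb G -> (forall e, G (emb e, emb e)) -> G (a, b) ->
  root (map_poly emb q) a -> root (map_poly emb q) b.
Proof.
move=> hG hE hab /horner_root qa; have := pemb_horner q hG hE hab.
by rewrite qa => gb; apply/rootP; exact: (pemb_fun hG gb (pemb0 hG)).
Qed.

Lemma epemb_exists G : pemb G -> (forall e, G (emb e, emb e)) ->
  exists G', epemb G' /\ G `<=` G'.
Proof.
move=> hG hE; have [G' [hG' sG tot]] := pemb_extend hG.
exists G'; split=> //; split=> // [e|a [q q0 rq]]; first exact: sG.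
apply: tot; exists (map_poly emb q); split=> //; first by rewrite map_poly_eq0.
by move=> k; exists ((map_poly emb q)`_k); rewrite coef_map; exact: hE.
Qed.

Lemma epemb_algebraic G a b : epemb G -> G (a, b) -> algebraicOver emb a -> algebraicOver emb b.
Proof. by move=> [hG hE _] gab [q q0 rq]; exists q => //; exact: (pemb_root hG hE gab). Qed.

Section Embedded.
Context (L : splittingFieldType E) (j : {rmorphism L -> C}) (hj : forall a : E, j a%:A = emb a).

Lemma embedded_minPoly y : exists2 q : {poly E}, minPoly 1 y = map_poly (in_alg L) q &
  map_poly emb q = map_poly j (minPoly 1 y).
Proof.
have /polyOver1P[q qE] := minPolyOver 1 y; exists q => //.
by rewrite qE -map_poly_comp; apply: eq_map_poly => e /=; rewrite hj.
Qed.

Lemma embedded_algebraic y : algebraicOver emb (j y).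
Proof.
have [q qE eE] := embedded_minPoly y; exists q.
  by apply: contraTneq (monic_neq0 (monic_minPoly 1 y)) => q0; rewrite qE q0 rmorph0 eqxx.
by rewrite eE; apply: rmorph_root; exact: root_minPoly.
Qed.

(** Normality of L: the image of j y is a root of the minimal polynomial of y, which splits in L, so
    G carries j(L) into itself. *)
Lemma gal_of_epemb G : epemb G -> exists2 g, g \in 'Gal({: L} / 1)%g & forall y, G (j y, j (g y)).
Proof.
move=> [hG hE tot]; have [_ hB hM _ _] := hG.
have ex y : exists c, G (j y, j c).
  have [b gb] := tot _ (embedded_algebraic y); have [q qE eE] := embedded_minPoly y.
  have rb : root (map_poly j (minPoly 1 y)) b.
    rewrite -eE; apply: (pemb_root hG hE gb); rewrite eE; apply: rmorph_root.
    exact: root_minPoly.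
  have /normalFieldP/(_ y (memvf y))[r _ rE] := normalFieldf (1%AS : {subfield L}).
  move: rb; rewrite rE rmorph_prod /root horner_prod => /eqP/eqP.
  rewrite prodf_seq_eq0 => /hasP[c _]; rewrite /= map_polyXsubC hornerXsubC subr_eq0 => /eqP bE.
  by exists c; rewrite -bE.
have [f fE] := choice ex.
have jinj y z z' : G (j y, j z) -> G (j y, j z') -> z = z'.
  by move=> g1 g2; apply: (fmorph_inj j); exact: (pemb_fun hG g1 g2).
have fM y z : f (y * z) = f y * f z.
  by apply: (jinj _ _ _ (fE _)); rewrite !rmorphM; exact: hM.
have fA e : f e%:A = e%:A by apply: (jinj _ _ _ (fE _)); rewrite hj; exact: hE.
have fD y z : f (y + z) = f y + f z.
  by apply: (jinj _ _ _ (fE _)); rewrite !rmorphD; exact: pembD.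
have flin : linear f.
  move=> a y z; rewrite fD -(mulr_algl a y) fM fA.
  by rewrite (mulr_algl a (f y)).
pose fL : {linear L -> L} := HB.pack f (GRing.isLinear.Build E L L *:%R f flin).
have kf : kHom 1 {: L} (linfun fL).
  apply/kHomP_tmp; split=> [x /vlineP[a ->]|x y _ _]; rewrite !lfunE /=; first exact: fA.
  exact: fM.
have s1 : ((1%AS : {subfield L}) <= {:L}%AS <= {:L}%AS)%VS by rewrite subvv sub1v.
have [g gG gE] := kHom_to_gal s1 (normalFieldf (1%AS : {subfield L})) kf.
by exists g => // y; rewrite -gE ?memvf // lfunE /=; exact: fE.
Qed.

Lemma epemb_of_gal (g : gal_of {: L}) : g \in 'Gal({: L} / 1)%g ->
  exists2 G, epemb G & forall y, G (j y, j (g y)).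
Proof.
move=> gg; pose G0 : set (C * C) := [set ab | exists y, ab = (j y, j (g y))].
have [|e|G [hG sG]] := @epemb_exists G0.
- split.
  + by exists 1; rewrite !rmorph1.
  + by move=> a b c d [y [-> ->]] [z [-> ->]]; exists (y - z); rewrite !rmorphB.
  + by move=> a b c d [y [-> ->]] [z [-> ->]]; exists (y * z); rewrite !rmorphM.
  + by move=> a b [y [-> ->]]; exists y^-1; rewrite !fmorphV.
  + by move=> b [y [/esym/eqP]]; rewrite fmorph_eq0 => /eqP-> ->; rewrite !rmorph0.
- exists e%:A; rewrite (fixed_gal (sub1v _) gg) ?hj //.
  by apply/vlineP; exists e.
by exists G => // y; apply: sG; exists y.
Qed.
End Embedded.

(** An elementwise form of membership in an abelian extension. Unlike the definition of [Eab] by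
    finite extensions, it is visibly stable under the ring operations. *)
Definition comm_at x : Prop := forall G1 G2 u v u' v', epemb G1 -> epemb G2 ->
  G1 (x, u) -> G2 (u, v) -> G2 (x, u') -> G1 (u', v') -> v = v'.

Lemma Eab_comm x : Eab x -> algebraicOver emb x /\ comm_at x.
Proof.
move=> [L [j [hj _ abL [y _ <-]]]]; split; first exact: embedded_algebraic.
move=> G1 G2 u v u' v' h1 h2.
have [g1 g1G g1E] := gal_of_epemb hj h1; have [g2 g2G g2E] := gal_of_epemb hj h2.
have [[p1 _ _] [p2 _ _]] := (h1, h2).
move=> /(pemb_fun p1 (g1E y)) <- /(pemb_fun p2 (g2E (g1 y))) <-.
move=> /(pemb_fun p2 (g2E y)) <- /(pemb_fun p1 (g1E (g2 y))) <-.
by have := centsP abL _ g1G _ g2G => /(congr1 (fun g : gal_of _ => j (g y))); rewrite !galM ?memvf.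
Qed.

Lemma comm_atB x y : algebraicOver emb x -> algebraicOver emb y ->
  comm_at x -> comm_at y -> comm_at (x - y).
Proof.
move=> ax ay cx cy G1 G2 u v u' v' h1 h2.
have [[p1 _ t1] [p2 _ t2]] := (h1, h2).
have [[_ b1 _ _ _] [_ b2 _ _ _]] := (p1, p2).
have [[x1 gx1] [y1 gy1]] := (t1 _ ax, t1 _ ay).
have [[x2 gx2] [y2 gy2]] := (t2 _ ax, t2 _ ay).
have [x12 gx12] := t2 _ (epemb_algebraic h1 gx1 ax).
have [y12 gy12] := t2 _ (epemb_algebraic h1 gy1 ay).
have [x21 gx21] := t1 _ (epemb_algebraic h2 gx2 ax).
have [y21 gy21] := t1 _ (epemb_algebraic h2 gy2 ay).
move=> /(pemb_fun p1 (b1 _ _ _ _ gx1 gy1)) <- /(pemb_fun p2 (b2 _ _ _ _ gx12 gy12)) <-.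
move=> /(pemb_fun p2 (b2 _ _ _ _ gx2 gy2)) <- /(pemb_fun p1 (b1 _ _ _ _ gx21 gy21)) <-.
by rewrite (cx _ _ _ _ _ _ h1 h2 gx1 gx12 gx2 gx21) (cy _ _ _ _ _ _ h1 h2 gy1 gy12 gy2 gy21).
Qed.

Lemma comm_atM x y : algebraicOver emb x -> algebraicOver emb y ->
  comm_at x -> comm_at y -> comm_at (x * y).
Proof.
move=> ax ay cx cy G1 G2 u v u' v' h1 h2.
have [[p1 _ t1] [p2 _ t2]] := (h1, h2).
have [[_ _ b1 _ _] [_ _ b2 _ _]] := (p1, p2).
have [[x1 gx1] [y1 gy1]] := (t1 _ ax, t1 _ ay).
have [[x2 gx2] [y2 gy2]] := (t2 _ ax, t2 _ ay).
have [x12 gx12] := t2 _ (epemb_algebraic h1 gx1 ax).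
have [y12 gy12] := t2 _ (epemb_algebraic h1 gy1 ay).
have [x21 gx21] := t1 _ (epemb_algebraic h2 gx2 ax).
have [y21 gy21] := t1 _ (epemb_algebraic h2 gy2 ay).
move=> /(pemb_fun p1 (b1 _ _ _ _ gx1 gy1)) <- /(pemb_fun p2 (b2 _ _ _ _ gx12 gy12)) <-.
move=> /(pemb_fun p2 (b2 _ _ _ _ gx2 gy2)) <- /(pemb_fun p1 (b1 _ _ _ _ gx21 gy21)) <-.
by rewrite (cx _ _ _ _ _ _ h1 h2 gx1 gx12 gx2 gx21) (cy _ _ _ _ _ _ h1 h2 gy1 gy12 gy2 gy21).
Qed.

(** Separability in characteristic 0: a is a simple root of p, since otherwise p would divide its
    nonzero derivative. So the cofactor of X - a, which is not constant, has its roots different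
    from a. *)
Lemma second_root (F : fieldType) (i : {rmorphism F -> C}) a p :
  is_minpoly i a p -> (2 < size p)%N -> exists2 b, b != a & root (map_poly i p) b.
Proof.
move=> [p0 ra minp] sp; have [Q QE] := factor_theorem _ _ ra.
have Qa : ~~ root Q a.
  apply/negP => /horner_root Qa.
  have rd : root (map_poly i p^`()) a.
    by rewrite -deriv_map QE derivM derivXsubC mulr1 /root hornerD hornerM hornerXsubC subrr mulr0 Qa addr0.
  have d0 : p^`() != 0.
    apply/eqP => /(congr1 (fun q : {poly F} => q`_(size p).-2)).
    rewrite coef_deriv coef0 prednK; last by move: sp; case: (size p) => [|[|[]]].
    move=> /(congr1 i)/eqP; rewrite rmorphMn rmorph0 mulrn_eq0 fmorph_eq0.
    by rewrite -lead_coefE lead_coef_eq0 (negPf p0) orbF; case: (size p) sp => [|[|[]]].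
  have := dvdp_leq d0 (minp _ rd); rewrite leqNgt => /negP; apply.
  by rewrite lt_size_deriv.
have Q0 : Q != 0 by apply: contraNneq Qa => ->; rewrite root0.
have sQ : size Q != 1%N.
  have := congr1 (fun q : {poly C} => size q) QE; rewrite size_map_poly size_Mmonic ?monicXsubC //.
  rewrite size_XsubC addn2 /= => sE; apply: contraTneq sp => sQ.
  by rewrite sE sQ.
have /closed_rootP[b rb] := sQ.
by exists b; [apply: contraNneq Qa => <-|rewrite QE rootM rb].
Qed.

(** Outside M the minimal polynomial over M has degree at least 2, hence a second root, and x can be
    sent to it by an embedding that fixes M. *)
Lemma epemb_moving M x : is_subfield M -> range emb `<=` M -> algebraicOver emb x -> ~ M x ->
  exists G, [/\ epemb G, forall m, M m -> G (m, m) & exists2 y, G (x, y) & y != x].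
Proof.
move=> [M1 MB MM] sEM [q q0 rq] nMx.
pose G0 : set (C * C) := [set ab | M ab.1 /\ ab.2 = ab.1].
have M0 : M 0 by rewrite -(subrr 1); exact: MB.
have hG0 : pemb G0.
  split=> //.
  - by move=> a b c d [/= ? ->] [/= ? ->]; split=> //; exact: MB.
  - by move=> a b c d [/= ? ->] [/= ? ->]; split=> //; exact: (MM _ _ _ _).1.
  - by move=> a b [/= ? ->]; split=> //; by apply: (MM _ _ _ M1).2.
  - by move=> b [].
have EG0 e : G0 (emb e, emb e) by split=> //; apply: sEM; exists e.
have algx : alg_over G0 x.
  exists (map_poly emb q); split=> //; first by rewrite map_poly_eq0.
  by move=> k; exists ((map_poly emb q)`_k); rewrite coef_map; exact: EG0.
have [p mp] := alg_over_minpoly hG0 algx.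
have e12 (c : pf hG0) : pf2 c = pf1 c by have [] := pfP c.
have sp : (2 < size p)%N.
  have sp1 := minpoly_size mp; rewrite ltn_neqAle sp1 andbT.
  apply/negP => /eqP/esym s2; apply: nMx.
  have [p0 rp _] := mp; have l0 : p`_1 != 0.
    by move: p0; rewrite -lead_coef_eq0 lead_coefE s2.
  have Mp c : M (pf1 (c : pf hG0)) by have [] := pfP c.
  move: (horner_root rp); rewrite (@horner_coef_wide _ 2) ?size_map_poly ?s2 //.
  rewrite big_ord_recl big_ord1 !coef_map /= expr0 expr1 mulr1 => /eqP.
  have l1 : pf1 (p`_1 : pf hG0) != 0 by rewrite fmorph_eq0.
  rewrite addrC addr_eq0 => /eqP e.
  have -> : x = - pf1 (p`_0 : pf hG0) * (pf1 (p`_1 : pf hG0))^-1.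
    by rewrite -e mulrAC mulfV ?mul1r.
  apply: (MM _ _ _ _).1; last exact: (MM _ _ (Mp _) M1).2.
  by rewrite -sub0r; exact: MB.
have [b bx rb] := second_root mp sp.
have rb2 : root (map_poly (@pf2 _ _ hG0) p) b.
  suff -> : map_poly (@pf2 _ _ hG0) p = map_poly (@pf1 _ _ hG0) p by [].
  by apply: eq_map_poly => c; exact: e12.
have [G' [hG' sG' gxb]] := adjoin_pemb mp rb2.
have [|G [hG sG]] := epemb_exists hG'; first by move=> e; exact/sG'/EG0.
exists G; split=> //; first by move=> m Mm; apply/sG/sG'.
by exists b => //; exact: sG.
Qed.
End AbelianClosure.

Lemma gal_abelian_generator (F : fieldType) (L : splittingFieldType F) (z : L) :
  <<1; z>>%VS = {: L}%VS ->
  (forall g h : gal_of {: L}, g \in 'Gal({: L} / 1)%g -> h \in 'Gal({: L} / 1)%g ->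
     g (h z) = h (g z)) -> abelian 'Gal({: L} / 1).
Proof.
move=> genL hz; apply/centsP => g gG h hG; apply/eqP/gal_eqP => a _.
have ghG : (g * h)%g \in 'Gal({: L} / 1)%g by rewrite groupM.
have hgG : (h * g)%g \in 'Gal({: L} / 1)%g by rewrite groupM.
have : a \in <<1; z>>%VS by rewrite genL memvf.
case/Fadjoin_polyP => r r1 ->.
rewrite -!horner_map !(fixedPoly_gal (sub1v _)) //=.
by rewrite !galM ?memvf // hz.
Qed.

Section GaloisAbelianClosure.
Context (R : realType) (E : fieldExtType rat) (emb : {rmorphism E -> R[i]}).
Local Notation C := R[i].
Local Notation Eab := (Eab emb).

(** The field L = E[X]/(p) is a copy of E(z). If a conjugate b of z were outside of it, an embedding
    fixing E(z) and moving b would fail to commute at z with an embedding sending z to b. So L is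
    normal, and commutation at the generator makes its group abelian. *)
Lemma comm_Eab z : algebraicOver emb z -> comm_at emb z -> Eab z.
Proof.
move=> [q q0 rq] cz; have [p mp] := minpoly_exists q0 rq.
have irrp := minpoly_irreducible mp; have [p0 rp minp] := mp.
have algz : algebraicOver emb z by exists p.
pose L : fieldExtType E := SubFieldExtType rp irrp.
pose j : {rmorphism L -> C} := (@subfx_inj E C emb z p : {rmorphism _ -> _}).
pose zL : L := subfx_root emb z p.
have jz : j zL = z by exact: subfx_inj_root.
have jE a : j a%:A = emb a by exact: subfx_inj_base.
have genL : <<1; zL>>%VS = {: L}%VS.
  apply/vspaceP => x; rewrite memvf; apply/Fadjoin1_polyP.
  by have [r] := subfxEroot rp p0 x; exists r.
pose M : set C := range j.
have subM : is_subfield M.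
  split; first by exists 1; rewrite ?rmorph1.
    by move=> _ _ [x _ <-] [y _ <-]; exists (x - y); rewrite ?rmorphB.
  move=> _ _ [x _ <-] [y _ <-]; split; first by exists (x * y); rewrite ?rmorphM.
  by exists x^-1; rewrite ?fmorphV.
have EM : range emb `<=` M by move=> _ [e _ <-]; exists e%:A.
have conj b : root (map_poly emb p) b -> M b.
  move=> rb; apply: contrapT => nMb.
  have hE0 : exists2 G, epemb emb G & G (z, b).
    have hG := adjoin_graph mp rb.
    have [|G [hG' sG]] := @epemb_exists _ _ emb _ hG.
      by move=> e; exists e%:P; rewrite !map_polyC !hornerC.
    by exists G => //; apply: sG; exists 'X; rewrite !map_polyX !hornerX.
  have [G1 h1 g1] := hE0; have [G2 [h2 fix2 [y g2 yb]]] := epemb_moving subM EM (ex_intro2 _ _ p p0 rb) nMb.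
  have Mz : M z by exists zL.
  by case/eqP: yb; rewrite (cz _ _ _ _ _ _ h1 h2 g1 g2 (fix2 _ Mz) g1).
have [bs bsE] := closed_field_poly_normal (map_poly emb p).
have lc0 : lead_coef (map_poly emb p) != 0 by rewrite lead_coef_eq0 map_poly_eq0.
have bsr b : b \in bs -> root (map_poly emb p) b.
  by move=> hb; rewrite bsE rootZ // root_prod_XsubC.
have [cs csE] : exists cs : seq L, bs = map j cs.
  elim: (bs) bsr => [|b s IH] h; first by exists nil.
  have [|cs ->] := IH; first by move=> c hc; apply: h; rewrite inE hc orbT.
  have [c _ cb] := conj _ (h b (mem_head _ _)); by exists (c :: cs); rewrite /= cb.
pose pL := map_poly (in_alg L) p.
have pLj : map_poly j pL = map_poly emb p.
  by rewrite -map_poly_comp; apply: eq_map_poly => e /=; rewrite jE.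
have pLE : pL = lead_coef pL *: \prod_(c <- cs) ('X - c%:P).
  apply: (map_inj_poly (fmorph_inj j) (rmorph0 j)); rewrite map_polyZ rmorph_prod /=.
  rewrite pLj {1}bsE csE big_map -lead_coef_map pLj; congr (_ *: _).
  by apply: eq_bigr => c _; rewrite map_polyXsubC.
have pL0 : lead_coef pL != 0 by rewrite lead_coef_eq0 map_poly_eq0.
have rpL : root pL zL by rewrite -(fmorph_root j) pLj jz.
have zcs : zL \in cs by move: rpL; rewrite pLE rootZ // root_prod_XsubC.
have splitL : splitting_field_axiom L.
  exists pL; first by apply/polyOver1P; exists p.
  exists cs; first by rewrite {1}pLE; exact: eqp_scale.
  apply/eqP; rewrite eqEsubv subvf /= -genL; apply/FadjoinP.
  by split; [exact: subv_adjoin_seq|exact: seqv_sub_adjoin].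
pose Ls : splittingFieldType E := HB.pack L (FieldExt_isSplittingField.Build E L splitL).
pose js : {rmorphism Ls -> C} := j.
exists Ls, js; split.
- exact: jE.
- rewrite /galois sub1v normalFieldf andbT /=; apply/separableP => y _.
  apply: pcharf0_separable => r; by rewrite -(fmorph_pchar js) pchar_num.
- have genLs : <<1; (zL : Ls)>>%VS = {: Ls}%VS by exact: genL.
  apply: (gal_abelian_generator genLs) => g h gG hG.
  have jsE e : js e%:A = emb e by exact: jE.
  have [G1 h1 g1] := epemb_of_gal jsE gG; have [G2 h2 g2] := epemb_of_gal jsE hG.
  apply: (fmorph_inj js); apply/esym; apply: (cz G1 G2 _ _ _ _ h1 h2 _ (g2 _) _ (g1 _)).
    by rewrite -{1}jz; exact: g1.
  by rewrite -{1}jz; exact: g2.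
- by exists (zL : Ls).
Qed.

Lemma EabB x y : Eab x -> Eab y -> Eab (x - y).
Proof.
move=> /Eab_comm[ax cx] /Eab_comm[ay cy]; apply: comm_Eab; first exact: algebraic_sub.
exact: comm_atB.
Qed.
Lemma EabM x y : Eab x -> Eab y -> Eab (x * y).
Proof.
move=> /Eab_comm[ax cx] /Eab_comm[ay cy]; apply: comm_Eab; first exact: algebraic_mul.
exact: comm_atM.
Qed.
Lemma EabD x y : Eab x -> Eab y -> Eab (x + y).
Proof.
move=> hx hy; have := EabB hx (EabB (EabB hx hx) hy).
by rewrite subrr sub0r opprK.
Qed.

(** [Eab] is a union of normal extensions, so the embedding maps it onto itself. Outside [Eab] the
    restriction is the identity, as [Gal] prescribes. *)
Lemma epemb_Gal G (M : set C) : epemb emb G -> (forall m, M m -> G (m, m)) ->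
  exists2 s, Gal Eab M s & forall x, Eab x -> G (x, s x).
Proof.
move=> hG fixM; have [pG _ tot] := hG; have [_ _ GM _ _] := pG.
pose s x := if `[< Eab x >] then xget 0 [set b | G (x, b)] else x.
have sE x : Eab x -> G (x, s x).
  move=> hx; rewrite /s asboolT //; have [ax _] := Eab_comm hx.
  by have [b gb] := tot _ ax; case: xgetP => [y _ //|/(_ b)].
have funs x y : Eab x -> G (x, y) -> s x = y.
  by move=> hx gxy; exact: (pemb_fun pG (sE _ hx) gxy).
exists s => //; split.
- split.
  + move=> x hx /=; have [L [j [hj gL abL [y _ yx]]]] := hx.
    have [g gg gE] := gal_of_epemb hj hG; rewrite (funs _ (j (g y)) hx); last by rewrite -yx.
    by exists L, j; split=> //; exists (g y).
  + move=> x y /set_mem hx /set_mem hy e; apply: (pemb_injective pG (sE _ hx)).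
    by rewrite e; exact: sE.
  + move=> x hx; have [L [j [hj gL abL [y _ yx]]]] := hx.
    have [g gg gE] := gal_of_epemb hj hG; have hz : Eab (j ((g^-1)%g y)).
      by exists L, j; split=> //; exists ((g^-1)%g y).
    exists (j ((g^-1)%g y)) => //; rewrite -yx; apply: funs => //.
    have -> : y = g ((g^-1)%g y) by rewrite -galM ?memvf // mulVg gal_id.
    have -> : (g^-1)%g (g ((g^-1)%g y)) = (g^-1)%g y.
      by rewrite -galM ?memvf // mulgV gal_id.
    exact: gE.
- move=> x y hx hy; split; first by apply: funs; [exact: EabD|apply: pembD => //; exact: sE].
  by apply: funs; [exact: EabM|apply: GM; exact: sE].
- move=> x Mx; case: (pselect (Eab x)) => hx; first by apply: funs => //; exact: fixM.
  by rewrite /s asboolF.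
- by move=> x hx; rewrite /s asboolF.
Qed.

Lemma Gal_fixed_field (M : set C) x : is_subfield M -> range emb `<=` M -> Eab x ->
  (forall s, Gal Eab M s -> s x = x) -> M x.
Proof.
move=> sM EM hx fixx; apply: contrapT => nMx; have [ax _] := Eab_comm hx.
have [G [hG fixG [y gy yx]]] := epemb_moving sM EM ax nMx.
have [s hs sE] := epemb_Gal hG fixG; case/eqP: yx.
have [pG _ _] := hG; rewrite (pemb_fun pG gy (sE _ hx)); exact: fixx.
Qed.
End GaloisAbelianClosure.

(** * Cosets and the trace *)

Section FibreCount.
Context (G : groupType) (Q V V' : set G).
Hypotheses (hQ : is_subgroup Q) (hV : is_subgroup V) (hV' : is_subgroup V') (V'V : V' `<=` V).
Context (m : nat) (a : 'I_m -> G).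
Hypotheses (aV : forall j, V (a j)) (aex : forall u, V u -> exists j, V' ((a j)^-1 * u)%g)
  (ainj : forall i j, V' ((a i)^-1 * a j)%g -> i = j).

Definition fibre (j0 : 'I_m) : pred 'I_m := fun j => `[< setmulg Q V' ((a j0)^-1 * a j)%g >].

(** Send e in the intersection of V and Q to the index of the coset of a_(j0) e modulo V'. The
    values are exactly the indices in the fibre, and each is taken on a coset of the intersection of
    V' and Q. *)
Lemma fibre_count (j0 : 'I_m) : finite_set (V `&` Q) ->
  (#|fibre j0| * #|` fset_set (V' `&` Q)|%fset)%N = #|` fset_set (V `&` Q)|%fset.
Proof.
have [Q1 QM QV] := hQ; have [V1 VM VV] := hV; have [V'1 V'M V'V'] := hV'.
move=> finN; have finN' : finite_set (V' `&` Q).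
  by apply: sub_finite_set finN => x [/V'V ? ?].
have phiex (e : G) : exists j, (V `&` Q) e -> V' ((a j)^-1 * (a j0 * e))%g.
  have [[Ve _]|nVe] := pselect ((V `&` Q) e); last by exists j0.
  by have [j hj] := aex (VM _ _ (aV j0) Ve); exists j.
have [phi phiE] := choice phiex.
have e0 := in_fset_set finN; have e0' := in_fset_set finN'.
have cls j : (\sum_(e <- fset_set (V `&` Q) | phi e == j) 1 =
    if fibre j0 j then #|` fset_set (V' `&` Q)|%fset else 0)%N.
  rewrite sum1_count -size_filter; case: ifPn => [/asboolP[q Qq [v' V'v' qvE]]|nf]; last first.
    apply/eqP; rewrite size_eq0 -[_ == _]negbK -has_filter; apply/negP => /hasP[e].
    rewrite e0 => /set_mem[Ve Qe] /eqP phie; move/asboolP: nf; apply.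
    exists e => //; exists ((a j)^-1 * (a j0 * e))^-1%g.
      by apply: V'V'; rewrite -phie; exact: phiE.
    by rewrite !invgM invgK !mulgA mulgV mul1g.
  rewrite -[RHS](size_map (fun n => q * n)%g); apply/perm_size/uniq_perm.
  - by rewrite filter_uniq ?fset_uniq.
  - by rewrite map_inj_uniq ?fset_uniq // => x y; exact: mulgI.
  have aj : a j = (a j0 * (q * v'))%g by rewrite qvE mulgA mulgV mul1g.
  have Vq : V q.
    have -> : q = ((a j0)^-1 * a j * v'^-1)%g by rewrite -qvE mulgK.
    by apply/VM/VV/V'V; [apply/VM/aV/VV/aV|].
  move=> e; rewrite mem_filter e0; apply/andP/mapP => [[/eqP phie /set_mem[Ve Qe]]|[n]].
    exists (q^-1 * e)%g; last by rewrite mulVKg.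
    rewrite e0'; apply/mem_set; split; last exact/QM/Qe/QV.
    have := phiE e (conj Ve Qe); rewrite phie aj => h.
    have := V'M _ _ V'v' h; congr (V' _).
    by rewrite !invgM -!mulgA mulVKg mulKg.
  rewrite e0' => /set_mem[V'n Qn] ->; have Nqn : (V `&` Q) (q * n)%g.
    by split; [exact/VM/V'V|exact: QM].
  split; last exact/mem_set.
  apply/eqP/ainj; have := phiE _ Nqn => h.
  have -> : ((a (phi (q * n)))^-1 * a j = ((a (phi (q * n)))^-1 * (a j0 * (q * n))) * (n^-1 * v'))%g.
    by rewrite aj -!mulgA; congr (_ * _)%g; congr (_ * _)%g; congr (_ * _)%g; rewrite mulVKg.
  exact: (V'M _ _ h (V'M _ _ (V'V' _ V'n) V'v')).
have -> : #|` fset_set (V `&` Q)|%fset = (\sum_(e <- fset_set (V `&` Q)) 1)%N by rewrite sum1_size.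
rewrite (partition_big phi xpredT) //=.
under eq_bigr do rewrite cls.
by rewrite -big_mkcond /= sum_nat_const.
Qed.
End FibreCount.

(** * Restriction of the Artin map to a layer L/k of the abelian closure *)

Section ArtinTrace.
Context (R : realType) (E : fieldExtType rat) (emb : {rmorphism E -> R[i]}).
Context (G : groupType) (HA HQ : set G) (art : G -> R[i] -> R[i]).
Hypotheses (hHA : is_subgroup HA) (hHQ : is_subgroup HQ).
Hypothesis (HAC : forall g h, HA g -> HA h -> (g * h = h * g)%g).
Hypotheses (art_surj : art @` HA = Gal (Eab emb) (range emb))
  (artM : forall g h, HA g -> HA h -> art (g * h)%g = art g \o art h)
  (artK : forall h, HA h -> (art h = id <-> HQ h)).
Context (V V' : set G) (hV : is_subgroup V) (hV' : is_subgroup V').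
Hypotheses (V'V : V' `<=` V) (VHA : V `<=` HA).
Context (k L : set R[i]).
Hypotheses (kF : is_subfield k) (Ek : range emb `<=` k) (kab : k `<=` Eab emb)
  (Galk : Gal (Eab emb) k = art @` setmulg HQ V).
Hypotheses (LF : is_subfield L) (EL : range emb `<=` L) (Lab : L `<=` Eab emb)
  (GalL : Gal (Eab emb) L = art @` setmulg HQ V').
Hypothesis (HQA : HQ `<=` HA).

Let HA1 : HA 1%g. Proof. by case: hHA. Qed.
Let HAM g h : HA g -> HA h -> HA (g * h)%g. Proof. by case: hHA => _ h1 _; exact: h1. Qed.
Let HAV g : HA g -> HA g^-1%g. Proof. by case: hHA => _ _; exact. Qed.
Let V'A : V' `<=` HA. Proof. exact: subset_trans VHA. Qed.

Let art_gal h : HA h -> Gal (Eab emb) (range emb) (art h).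
Proof. by move=> Hh; rewrite -art_surj; exists h. Qed.

Let art1 : art 1%g = id.
Proof. by apply/(artK HA1); case: hHQ. Qed.

Let artVK h x : HA h -> art h^-1%g (art h x) = x.
Proof.
move=> Hh; have := artM (HAV Hh) Hh; rewrite mulVg art1.
by move/(congr1 (fun f => f x)).
Qed.

Let artKV h x : HA h -> art h (art h^-1%g x) = x.
Proof. by move=> Hh; have := artVK x (HAV Hh); rewrite invgK. Qed.

Let fixL h x : setmulg HQ V' h -> L x -> art h x = x.
Proof.
move=> Qh Lx; have : Gal (Eab emb) L (art h) by rewrite GalL; exists h.
by case=> _ _ fL _; exact: fL.
Qed.

Let fixLE h : HA h -> (forall x, L x -> art h x = x) -> setmulg HQ V' h.
Proof.
move=> Hh fL; have : Gal (Eab emb) L (art h) by have [h1 h2 h3 h4] := art_gal Hh; split.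
rewrite GalL => -[h' [e Qe [v V'v eE]] artE].
have He := HQA Qe; have Hv := V'A V'v.
have Hh' : HA h' by rewrite -eE; exact: HAM.
have : HQ (h * h'^-1)%g.
  apply/artK; first exact/HAM/HAV.
  rewrite artM ?artE //; last exact: HAV.
  by apply: funext => x /=; rewrite -artE artKV.
move=> Qhh; have [_ QM _] := hHQ.
exists (h * h'^-1 * e)%g; first exact: QM.
by exists v => //; rewrite -mulgA eE mulgVK.
Qed.

Lemma art_eq_on h h' : HA h -> HA h' ->
  (forall x, L x -> art h x = art h' x) <-> setmulg HQ V' (h^-1 * h')%g.
Proof.
move=> Hh Hh'; have Hhh : HA (h^-1 * h')%g by exact/HAM/Hh'/HAV.
split=> [e|Qh x Lx].
  apply: fixLE => // x Lx; rewrite artM //=; last exact: HAV.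
  by rewrite -e // artVK.
have := fixL Qh Lx; rewrite artM //=; last exact: HAV.
by move=> e; rewrite -[in LHS]e artKV.
Qed.

Let artL h x : HA h -> L x -> L (art h x).
Proof.
move=> Hh Lx; have [[funh _ _] _ _ _] := art_gal Hh.
apply: (Gal_fixed_field LF EL); first exact/funh/Lab.
rewrite GalL => _ [h' Qh' <-]; have Hh' : HA h'.
  by case: Qh' => e Qe [v V'v <-]; apply: HAM; [exact: HQA|exact: V'A].
(* L is stable because the torus is commutative: [art h] permutes the fixed points of
   Gal(E^ab/L). *)
have -> : art h' (art h x) = art h (art h' x).
  by have := artM Hh' Hh; rewrite HAC // artM // => /(congr1 (fun f => f x)).
by rewrite (fixL Qh').
Qed.

Definition res_art h : R[i] -> R[i] := fun x => if `[< L x >] then art h x else x.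

Let res_artE h x : L x -> res_art h x = art h x.
Proof. by move=> Lx; rewrite /res_art asboolT. Qed.

Lemma res_art_Gal h : V h -> Gal L k (res_art h).
Proof.
move=> Vh; have Hh := VHA Vh; have [[_ injh _] morh _ _] := art_gal Hh.
have [L1 LB LM] := LF; split.
- split.
  + by move=> x Lx /=; rewrite res_artE //; exact: artL.
  + move=> x y /set_mem Lx /set_mem Ly; rewrite !res_artE // => e.
    by apply: injh => //; apply/mem_set/Lab.
  + move=> x Lx; exists (art h^-1%g x); first exact/artL/Lx/HAV.
    rewrite res_artE; last exact/artL/Lx/HAV.
    by rewrite artKV.
- move=> x y Lx Ly; have L0 : L 0 by rewrite -(subrr 1); exact: LB.
  have LD : L (x + y) by rewrite -[y]opprK -[- y]sub0r; exact/LB/LB.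
  have LMxy : L (x * y) by exact: (LM _ _ Lx Ly).1.
  by rewrite !res_artE //; exact/morh/Lab/Ly/Lab.
- move=> x kx; have : Gal (Eab emb) k (art h).
    by rewrite Galk; exists h => //; exists 1%g; [case: hHQ|exists h; rewrite ?mul1g].
  case=> _ _ fk _; have [Lx|nLx] := pselect (L x); first by rewrite res_artE // fk.
  by rewrite /res_art asboolF.
- by move=> x nLx; rewrite /res_art asboolF.
Qed.

Let kL : k `<=` L.
Proof.
move=> x kx; apply: (Gal_fixed_field LF EL); first exact: kab.
rewrite GalL => _ [h [e Qe [v V'v eE]] <-].
have : Gal (Eab emb) k (art h) by rewrite Galk; exists h => //; exists e => //; exists v => //; exact: V'V.
by case=> _ _ fk _; exact: fk.
Qed.

(** The graph of t is a partial embedding. Extended to the algebraic numbers and restricted to E^ab,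
    it lies in Gal(E^ab/k), hence is the Artin image of a product of an element of HQ, which acts
    trivially, and an element of V. *)
Lemma Gal_res_art t : Gal L k t -> exists2 h, V h & t = res_art h.
Proof.
move=> [[funt injt surjt] mort fixt outt]; have [L1 LB LM] := LF.
have L0 : L 0 by rewrite -(subrr 1); exact: LB.
have tB x y : L x -> L y -> t (x - y) = t x - t y.
  move=> Lx Ly; apply/eqP; rewrite -subr_eq opprK -(mort _ _ (LB _ _ Lx Ly) Ly).1.
  by rewrite subrK.
have t1 : t 1 = 1 by apply: fixt; case: kF.
have t0 : t 0 = 0 by rewrite -(subrr 1) tB // t1.
pose G0 : set (R[i] * R[i]) := [set ab | L ab.1 /\ ab.2 = t ab.1].
have hG0 : pemb G0.
  split.
  - by split.
  - by move=> a b c d [/= La ->] [/= Lc ->]; split=> /=; [exact: LB|rewrite tB].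
  - by move=> a b c d [/= La ->] [/= Lc ->]; split=> /=; [exact: (LM _ _ La Lc).1|rewrite (mort _ _ La Lc).2].
  - move=> a b [/= La ->]; have La' := (LM _ _ La L1).2; split=> //=.
    have [->|a0] := eqVneq a 0; first by rewrite invr0 t0 invr0.
    have e : t a * t a^-1 = 1 by rewrite -(mort _ _ La La').2 divff.
    have ta0 : t a != 0 by apply: contra_eqN e => /eqP->; rewrite mul0r eq_sym oner_eq0.
    by apply: (mulfI ta0); rewrite e divff.
  - by move=> b [/= _ ->].
have kfix x : k x -> G0 (x, x) by move=> kx; split=> /=; [exact: kL|rewrite fixt].
have [|G1 [hG1 sG]] := @epemb_exists _ _ emb _ hG0.
  by move=> e; apply: kfix; apply: Ek; exists e.
have [s hs sE] := epemb_Gal hG1 (fun m km => sG _ (kfix m km)).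
have st x : L x -> s x = t x.
  move=> Lx; have [p1 _ _] := hG1; apply: (pemb_fun p1 (sE _ (Lab Lx))).
  by apply: sG; split.
rewrite Galk in hs; case: hs => h [e Qe [v Vv eE]] artE.
have He := HQA Qe; exists v => //; apply: funext => x.
have [Lx|nLx] := pselect (L x); last by rewrite outt // /res_art asboolF.
rewrite res_artE // -st // -artE -eE artM //; last exact: VHA.
by rewrite ((artK He).2 Qe).
Qed.

Context (m : nat) (a : 'I_m -> G).
Hypotheses (aV : forall j, V (a j)) (aex : forall u, V u -> exists j, V' ((a j)^-1 * u)%g)
  (ainj : forall i j, V' ((a i)^-1 * a j)%g -> i = j).

(** Restriction to L maps V/V' onto Gal(L/k). By [fibre_count] all its fibres have c elements, so
    that a sum over coset representatives repeats the sum over the Galois group c times. *)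
Lemma art_trace_sum (Z : zmodType) (f : G -> Z) (T : (R[i] -> R[i]) -> Z) (c : nat) :
  (forall h h', HA h -> HA h' -> setmulg HQ V' (h^-1 * h')%g -> f h = f h') ->
  (forall h, V h -> T (res_art h) = f h) ->
  finite_set (V `&` HQ) ->
  (c * #|` fset_set (V' `&` HQ)|%fset)%N = #|` fset_set (V `&` HQ)|%fset ->
  \sum_j f (a j) = (\sum_(t \in Gal L k) T t) *+ c.
Proof.
move=> fE TE finN cE; pose r j := res_art (a j).
have rP i j : r i = r j <-> setmulg HQ V' ((a i)^-1 * a j)%g.
  rewrite -art_eq_on; [|exact/VHA/aV|exact/VHA/aV]; split=> [e x Lx|e].
    by rewrite -!res_artE // -/(r i) e.
  apply: funext => x; rewrite /r /res_art.
  by case: asboolP => // Lx; exact: e.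
have rsurj t : Gal L k t -> exists j, r j = t.
  move=> /Gal_res_art[h Vh ->]; have [j V'j] := aex Vh; exists j.
  apply: funext => x; rewrite /r /res_art; case: asboolP => // Lx.
  apply: (art_eq_on _ _).2 => //; [exact/VHA/aV|exact: VHA|].
  by exists 1%g; [case: hHQ|exists ((a j)^-1 * h)%g; rewrite ?mul1g].
have finG : finite_set (Gal L k).
  apply: (@sub_finite_set _ _ (r @` [set: 'I_m])); last exact: finite_image.
  by move=> t /rsurj[j <-]; exists j.
have v'0 : (0 < #|` fset_set (V' `&` HQ)|%fset)%N.
  have finN' : finite_set (V' `&` HQ) by apply: sub_finite_set finN => x [/V'V ? ?].
  rewrite cardfs_gt0; apply/fset0Pn; exists 1%g; rewrite in_fset_set //.
  by apply/mem_set; split; [case: hV'|case: hHQ].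
rewrite fsbig_finite //= -sumrMnl.
transitivity (\sum_j \sum_(t <- fset_set (Gal L k) | t == r j) T t).
  apply: eq_bigr => j _; rewrite -big_filter.
  have -> : [seq t <- fset_set (Gal L k) | t == r j] = [:: r j].
    rewrite filter_pred1_uniq ?fset_uniq // in_fset_set //.
    exact/mem_set/res_art_Gal.
  by rewrite big_seq1 TE.
rewrite (exchange_big_dep xpredT) //= big_seq_cond [RHS]big_seq_cond.
apply: eq_bigr => t; rewrite andbT in_fset_set // => /set_mem /rsurj[j0 <-].
rewrite sumr_const; congr (_ *+ _); apply/eqP; rewrite -(eqn_pmul2r v'0) cE.
rewrite -(fibre_count hHQ hV hV' V'V aV aex ainj j0 finN); apply/eqP; congr (_ * _)%N.
apply: eq_card => j; apply/idP/idP => h.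
  have /asboolP/rP h' : `[< r j0 = r j >] := h.
  by have : fibre HQ V' a j0 j by exact/asboolP.
have /asboolP/rP h' : fibre HQ V' a j0 j := h.
by have : `[< r j0 = r j >] by exact/asboolP.
Qed.
End ArtinTrace.

(** * The ring of integers *)

Section Matrix2.
Context (A : comNzRingType).
Implicit Types M N : 'M[A]_2.

Lemma mulmx2E m n (M : 'M[A]_(m, 2)) (N : 'M[A]_(2, n)) i j :
  (M *m N) i j = M i 0 * N 0 j + M i 1 * N 1 j.
Proof.
rewrite mxE big_ord_recl big_ord1 /=; congr (_ + M i _ * N _ j); exact/val_inj.
Qed.

Lemma mxtrace2 M : \tr M = M 0 0 + M 1 1.
Proof. by rewrite /mxtrace big_ord_recl big_ord1 /=; congr (_ + M _ _); exact/val_inj. Qed.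

Lemma ord2P (i : 'I_2) : i = 0 \/ i = 1.
Proof. by case: i => [[|[|//]] ?]; [left|right]; exact/val_inj. Qed.

Lemma mx2P (M N : 'M[A]_2) : M 0 0 = N 0 0 -> M 0 1 = N 0 1 -> M 1 0 = N 1 0 ->
  M 1 1 = N 1 1 -> M = N.
Proof. by move=> *; apply/matrixP => i j; case: (ord2P i) => ->; case: (ord2P j) => ->. Qed.

Lemma cv2P (u v : 'cV[A]_2) : u 0 0 = v 0 0 -> u 1 0 = v 1 0 -> u = v.
Proof. by move=> *; apply/matrixP => i j; rewrite (ord1 j); case: (ord2P i) => ->. Qed.

Lemma det2 M : \det M = M 0 0 * M 1 1 - M 0 1 * M 1 0.
Proof.
rewrite (expand_det_row _ 0) big_ord_recl big_ord1 /cofactor !det_mx11 !mxE /=.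
rewrite expr0 expr1 !mul1r mulN1r mulrN.
by congr (M _ _ * M _ _ - M _ _ * M _ _); exact/val_inj.
Qed.

Lemma cayley2 M : M *m M = \tr M *: M - (\det M)%:M.
Proof.
by apply: mx2P; rewrite mulmx2E mxtrace2 det2 !mxE /=; ring.
Qed.

(** The case det P = 0 of the identity P B P = tr(B P) P - det(P) (tr(B) - B), valid for all
    matrices of size 2. *)
Lemma rank1_sandwich (P B : 'M[A]_2) : \det P = 0 -> P *m B *m P = \tr (B *m P) *: P.
Proof.
move=> dP; pose adj2 := \tr B *: 1%:M - B.
have -> : P *m B *m P = \tr (B *m P) *: P - \det P *: adj2.
  by apply: mx2P; rewrite det2 /adj2 !mxtrace2 !(mulmx2E, mxE) /=; ring.
by rewrite dP scale0r subr0.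
Qed.
End Matrix2.

Section RingOfIntegers.
Context (E : fieldExtType rat) (w : 2.-tuple E) (hw : basis_of {: E} w).
Implicit Types x y : E.
Local Notation O_E := (int_closure E).

Definition trE x : rat := \tr (mulE w x).
Definition nmE x : rat := \det (mulE w x).
Definition conjE x : E := (trE x)%:A - x.

Lemma mulE_alg (a : rat) : mulE w a%:A = a%:M.
Proof. by rewrite mulEZ mulE1 // scalemx1. Qed.

Lemma mul_conjE x : x * conjE x = (nmE x)%:A.
Proof.
apply: (mulE_inj hw); rewrite mulEM // mulE_alg /conjE raddfB /= mulE_alg mulmxBr cayley2.
by rewrite mul_mx_scalar opprB addrC subrK.
Qed.

Lemma trED x y : trE (x + y) = trE x + trE y.
Proof. by rewrite /trE raddfD /= mxtraceD. Qed.
Lemma trEZ (a : rat) x : trE (a *: x) = a * trE x.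
Proof. by rewrite /trE mulEZ mxtraceZ. Qed.
Lemma trE_alg (a : rat) : trE a%:A = a *+ 2.
Proof. by rewrite /trE mulE_alg mxtrace_scalar. Qed.
Lemma trEN x : trE (- x) = - trE x.
Proof. by rewrite -scaleN1r trEZ mulN1r. Qed.
Lemma nmEM x y : nmE (x * y) = nmE x * nmE y.
Proof. by rewrite /nmE mulEM // det_mulmx. Qed.
Lemma nmE_alg (a : rat) : nmE a%:A = a ^+ 2.
Proof. by rewrite /nmE mulE_alg det_scalar. Qed.
Lemma trE_conj x : trE (conjE x) = trE x.
Proof. by rewrite /conjE trED trE_alg trEN mulr2n addrK. Qed.
Lemma conjEK x : conjE (conjE x) = x.
Proof. by rewrite {1}/conjE trE_conj /conjE opprB addrC subrK. Qed.
Lemma trE_sqr x : trE x ^+ 2 = trE (x ^+ 2) + nmE x *+ 2.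
Proof.
have -> : x ^+ 2 = trE x *: x - (nmE x)%:A.
  by rewrite -mul_conjE /conjE mulrBr -scalerAr mulr1 opprB addrC subrK expr2.
by rewrite trED trEN trEZ trE_alg subrK expr2.
Qed.

Lemma OE1 : O_E 1. Proof. exact: integral1. Qed.
Lemma OE_sub x y : O_E x -> O_E y -> O_E (x - y). Proof. exact: integral_sub. Qed.
Lemma OE_add x y : O_E x -> O_E y -> O_E (x + y). Proof. exact: integral_add. Qed.
Lemma OE_opp x : O_E x -> O_E (- x). Proof. exact: integral_opp. Qed.
Lemma OE_mul x y : O_E x -> O_E y -> O_E (x * y). Proof. exact: integral_mul. Qed.
Lemma OE_int (m : int) : O_E m%:~R. Proof. exact: integral_id. Qed.
Lemma OE_nat (m : nat) : O_E m%:R. Proof. exact: (OE_int m). Qed.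
Lemma OE0 : O_E 0. Proof. exact: (OE_int 0). Qed.

Context (b : 2.-tuple E) (hb : integral_basis b).
Let hbb : basis_of {: E} b. Proof. by case: hb. Qed.

Lemma OE_coord x : O_E x <-> forall i, exists m : int, coord b i x = m%:~R.
Proof.
have [_ ->] := hb; split=> [[c _ <-] i|/choice[c cE]].
  exists (c i); rewrite raddf_sum (bigD1 i) //= -scaler_int linearZ /= coord_w // eqxx mulr1.
  rewrite big1 ?addr0 // => k /negPf ki.
  by rewrite -scaler_int linearZ /= coord_w // eq_sym ki mulr0.
exists c => //; rewrite [RHS](coordK hbb); apply: eq_bigr => i _.
by rewrite cE scaler_int.
Qed.

Lemma OE_basis (i : 'I_2) : O_E b`_i.
Proof. by apply/OE_coord => k; exists (k == i)%:R; rewrite coord_w // rmorph_nat. Qed.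

Let B : 'M[rat]_2 := \matrix_(i, j) coord w i b`_j.

(** The basis w is any Q-basis, while integrality is visible in the integral basis b. Conjugation by
    the change of basis shows that traces and norms agree. *)
Lemma mulE_change : exists2 B' : 'M[rat]_2, B *m B' = 1%:M &
  forall x, cvec w x = B *m cvec b x /\ mulE b x = B' *m mulE w x *m B.
Proof.
have cB x : cvec w x = B *m cvec b x.
  apply/matrixP => i j; rewrite (ord1 j) !mxE {1}(coordK hbb x) raddf_sum /=.
  by apply: eq_bigr => k _; rewrite linearZ /= !mxE mulrC.
pose B' : 'M[rat]_2 := \matrix_(i, j) coord b i w`_j.
have cB' x : cvec b x = B' *m cvec w x.
  apply/matrixP => i j; rewrite (ord1 j) !mxE {1}(coordK hw x) raddf_sum /=.
  by apply: eq_bigr => k _; rewrite linearZ /= !mxE mulrC.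
exists B'.
  by apply: (mulmx_cvec_inj hw) => y; rewrite -mulmxA -cB' -cB mul1mx.
move=> x; split=> //; apply: (mulmx_cvec_inj hbb) => y.
by rewrite -!mulmxA -cB !mulE_cvec // cB'.
Qed.

Lemma trE_basis x : trE x = \tr (mulE b x).
Proof.
have [B' BB' /(_ x)[_ ->]] := mulE_change.
by rewrite mxtrace_mulC mulmxA BB' mul1mx.
Qed.
Lemma nmE_basis x : nmE x = \det (mulE b x).
Proof.
have [B' BB' /(_ x)[_ ->]] := mulE_change; rewrite /nmE !det_mulmx mulrAC mulrC.
by rewrite [\det B' * _]mulrC -det_mulmx BB' det1 mulr1.
Qed.

Lemma mulE_int x : O_E x -> exists M : 'M[int]_2, mulE b x = map_mx intr M.
Proof.
move=> Ox; have h (ij : 'I_2 * 'I_2) : exists m : int, mulE b x ij.1 ij.2 = m%:~R.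
  have /OE_coord/(_ ij.1)[m mE] := OE_mul Ox (OE_basis ij.2).
  by exists m; rewrite mxE mE.
have [f fE] := choice h; exists (\matrix_(i, j) f (i, j)).
by apply/matrixP => i j; rewrite !mxE -(fE (i, j)) mxE.
Qed.

Lemma trE_int x : O_E x -> exists m : int, trE x = m%:~R.
Proof. by move=> /mulE_int[M ME]; exists (\tr M); rewrite trE_basis ME trace_map_mx. Qed.
Lemma nmE_int x : O_E x -> exists m : int, nmE x = m%:~R.
Proof. by move=> /mulE_int[M ME]; exists (\det M); rewrite nmE_basis ME det_map_mx. Qed.

Lemma OE_conj x : O_E x -> O_E (conjE x).
Proof.
move=> Ox; have [t tE] := trE_int Ox; rewrite /conjE tE scaler_int.
by apply: OE_sub => //; exact: OE_int.
Qed.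

(** By Bezout, an integer prime to l is invertible modulo any ideal containing l. *)
Lemma ideal_unscale (l : nat) (P : set E) (d : nat) x : coprime d l ->
  (forall u v, P u -> P v -> P (u + v)) -> (forall a u, O_E a -> P u -> P (a * u)) ->
  P l%:R -> O_E x -> P (d%:R * x) -> P x.
Proof.
move=> cdl PD PM Pl Ox Pdx.
have [u [v uv]] := Bezoutz d l.
have e : u%:~R * d%:R + v%:~R * l%:R = 1 :> E.
  have := congr1 (fun m : int => m%:~R : E) uv; rewrite rmorphD !rmorphM /= => ->.
  by rewrite /gcdz !absz_nat (eqP cdl).
have -> : x = u%:~R * (d%:R * x) + (v%:~R * x) * l%:R.
  by rewrite mulrA [v%:~R * x * _]mulrAC -mulrDl e mul1r.
by apply: PD; apply: PM => //; [exact: OE_int|exact/OE_mul/Ox/OE_int].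
Qed.

Lemma disc_nondegenerate (l : place) (d : int) x :
  d%:~R = \det (\matrix_(i < 2, j < 2) \tr (mulE b (b`_i * b`_j))) -> ~~ (l %| d)%Z ->
  O_E x -> (forall y, O_E y -> exists m : int, trE (x * y) = (l%:Z * m)%:~R) ->
  exists2 z, O_E z & x = l%:R * z.
Proof.
move=> dE ld Ox htr; set T := \matrix_(i, j) _ in dE.
have [T0 TE] : exists T0 : 'M[int]_2, T = map_mx intr T0.
  have h (ij : 'I_2 * 'I_2) : exists m : int, T ij.1 ij.2 = m%:~R.
    have [m mE] := trE_int (OE_mul (OE_basis ij.1) (OE_basis ij.2)).
    by exists m; rewrite mxE -trE_basis mE.
  have [f fE] := choice h; exists (\matrix_(i, j) f (i, j)).
  by apply/matrixP => i j; rewrite !mxE -(fE (i, j)) mxE.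
have dT : d = \det T0 by apply/eqP; rewrite -(eqr_int rat) dE TE det_map_mx.
have [c cE] : exists c : 'I_2 -> int, forall i, coord b i x = (c i)%:~R.
  by have /OE_coord/choice[c cE] := Ox; exists c.
have [m mE] : exists m : 'I_2 -> int, forall j : 'I_2, trE (x * b`_j) = (l%:Z * m j)%:~R.
  have h (j : 'I_2) : exists m : int, trE (x * b`_j) = (l%:Z * m)%:~R by exact/htr/OE_basis.
  by have [m mE] := choice h; exists m.
pose cv : 'rV[int]_2 := \row_i c i; pose mv : 'rV[int]_2 := \row_i m i.
have cT : cv *m T0 = l%:Z *: mv.
  apply/matrixP => i j; apply/eqP; rewrite (ord1 i) -(eqr_int rat); apply/eqP.
  have -> : (l%:Z *: mv) 0 j = l%:Z * m j by rewrite !mxE.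
  rewrite -mE {1}(coordK hbb x) mulr_suml /trE !raddf_sum mxE rmorph_sum /=.
  apply: eq_bigr => k _; rewrite -scalerAl -/(trE _) trEZ cE mxE rmorphM; congr (_ * _).
  by have /matrixP/(_ k j) := TE; rewrite mxE [RHS]mxE => e; rewrite trE_basis e.
have ld_c i : (l %| c i)%Z.
  have /matrixP/(_ 0 i) := congr1 (fun u => u *m \adj T0) cT.
  rewrite /= -mulmxA mul_mx_adj -dT mul_mx_scalar -scalemxAl !mxE => e.
  have : (l %| d * c i)%Z by rewrite e dvdz_mulr.
  rewrite Gauss_dvdzr // coprimezE absz_nat prime_coprime ?place_prime //.
have hq i : exists q, c i = q * l%:Z by apply/dvdzP/ld_c.
have [q qE] := choice hq.
exists (\sum_i (q i)%:~R * b`_i).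
  apply/OE_coord => i; exists (q i); rewrite raddf_sum (bigD1 i) //= mulrzl -scaler_int linearZ /= coord_w // eqxx mulr1.
  rewrite big1 ?addr0 // => k /negPf ki.
  by rewrite mulrzl -scaler_int linearZ /= coord_w // eq_sym ki mulr0.
rewrite [LHS](coordK hbb) mulr_sumr; apply: eq_bigr => i _.
by rewrite cE qE scaler_int mulrzA mulrzl mulr_natl pmulrn.
Qed.
End RingOfIntegers.

(** By default [disc] is 0 when there is no integral basis, and l divides 0. So the hypothesis that
    l does not divide it yields an integral basis. *)
Lemma disc_integral_basis (E : fieldExtType rat) (l : place) : ~~ (l %| disc E)%Z ->
  exists2 b : 2.-tuple E, integral_basis b &
    (disc E)%:~R = \det (\matrix_(i < 2, j < 2) \tr (mulE b (b`_i * b`_j))).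
Proof.
move=> ld; pose S : set int := [set d | exists2 b : 2.-tuple E, integral_basis b &
  d%:~R = \det (\matrix_(i < 2, j < 2) \tr (mulE b (b`_i * b`_j)))].
have : S (disc E); last by [].
have -> : disc E = xget 0 S by [].
case: xgetP => [d _ //|nS]; move: ld.
suff -> : disc E = 0 by rewrite dvdz0.
by rewrite -[disc E]/(xget 0 S); case: xgetP => // d _ /nS.
Qed.

(** * The local order *)

Section LocalVectors.
Context (l : place).
Implicit Types u v : 'cV[Qp l]_2.

Definition ivec v : Prop := forall i, qp_int (v i 0).
Definition lvec v : Prop := forall i, qdvd (v i 0).
Definition imx (M : 'M[Qp l]_2) : Prop := forall i j, qp_int (M i j).

Lemma ivecD u v : ivec u -> ivec v -> ivec (u + v).
Proof. by move=> hu hv i; rewrite mxE; exact: qp_intD. Qed.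
Lemma ivecB u v : ivec u -> ivec v -> ivec (u - v).
Proof. by move=> hu hv i; rewrite !mxE; exact: qp_intB. Qed.
Lemma ivecZ c u : qp_int c -> ivec u -> ivec (c *: u).
Proof. by move=> hc hu i; rewrite mxE; exact: qp_intM. Qed.
Lemma ivec0 : ivec 0. Proof. by move=> i; rewrite mxE; exact: qp_int0. Qed.
Lemma lvecD u v : lvec u -> lvec v -> lvec (u + v).
Proof. by move=> hu hv i; rewrite mxE; exact: qdvdD. Qed.
Lemma lvecBD u v u' v' : lvec (u - u') -> lvec (v - v') -> lvec (u + v - (u' + v')).
Proof. by move=> h h'; have := lvecD h h'; rewrite addrACA -opprD. Qed.
Lemma lvecZ c u : qp_int c -> lvec u -> lvec (c *: u).
Proof. by move=> hc hu i; rewrite mxE; exact: qdvdMr. Qed.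
Lemma lvecP u : lvec u <-> exists2 v, ivec v & u = (l : nat)%:R *: v.
Proof.
split=> [h|[v iv ->] i]; last by rewrite mxE; exists (v i 0).
have [f fE] : exists f : 'I_2 -> Qp l, forall i, qp_int (f i) /\ u i 0 = (l : nat)%:R * f i.
  have h' i : exists y, qp_int y /\ u i 0 = (l : nat)%:R * y by have [y yi yE] := h i; exists y.
  by have [f fE] := choice h'; exists f.
exists (\col_i f i); first by move=> i; rewrite mxE; case: (fE i).
by apply/matrixP => i j; rewrite (ord1 j) !mxE; case: (fE i).
Qed.
Lemma lvec_ivec u : lvec u -> ivec u. Proof. by move=> h i; exact: qdvd_int. Qed.

Lemma imx_mulv M v : imx M -> ivec v -> ivec (M *m v).
Proof. by move=> hM hv i; rewrite mxE; apply: qp_int_sum => k _; exact: qp_intM. Qed.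
Lemma imx_det M : imx M -> qp_int (\det M).
Proof. by move=> hM; rewrite det2; apply: qp_intB; apply: qp_intM. Qed.

Lemma imx_inv M : imx M -> ~ qdvd (\det M) -> M \in unitmx /\ imx (invmx M).
Proof.
move=> hM nd; have [d0 dVi] := qp_int_inv (imx_det hM) nd.
have uM : M \in unitmx by rewrite unitmxE unitfE.
split=> // i j; rewrite /invmx uM !mxE; apply: qp_intM => //.
rewrite /cofactor det_mx11 !mxE; apply: qp_intM => //.
rewrite -signr_odd; case: odd; rewrite ?expr0 ?expr1; last exact: qp_int1.
exact/qp_intN/qp_int1.
Qed.

Lemma qdvd_detB M N : imx M -> imx N -> (forall i j, qdvd ((M - N) i j)) -> qdvd (\det M - \det N).
Proof.
move=> hM hN h; have h' i j : qdvd (M i j - N i j) by have := h i j; rewrite !mxE.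
rewrite !det2; set x := _ - _.
have -> : x = (M 0 0 - N 0 0) * M 1 1 + N 0 0 * (M 1 1 - N 1 1)
    - ((M 0 1 - N 0 1) * M 1 0 + N 0 1 * (M 1 0 - N 1 0)) by rewrite /x; ring.
by apply: qdvdB; apply: qdvdD; rewrite /qdvd; [exact: qdvdMl|exact: qdvdMr|exact: qdvdMl|exact: qdvdMr].
Qed.

Lemma qp_int_ratr (q : rat) : qp_int (ratr q : Qp l) -> coprime `|denq q| l.
Proof.
move=> hq; rewrite coprime_sym prime_coprime ?place_prime //; apply/negP => ld.
have /qdvd_intr hd : (l %| `|denq q|)%N by [].
have : qdvd ((numq q)%:~R : Qp l).
  have -> : (numq q)%:~R = ratr q * (denq q)%:~R :> Qp l.
    by rewrite /ratr mulfVK // -(rmorph_int (qratr_of (qp_qalg l))) fmorph_eq0 intr_eq0 denq_eq0.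
  exact: qdvdMr.
move/qdvd_intr => ln; have := coprime_num_den q.
move/eqP => cg; have : (l %| gcdn `|numq q| `|denq q|)%N by rewrite dvdn_gcd ln.
by rewrite cg dvdn1 => /eqP l1; have := place_prime l; rewrite l1.
Qed.
End LocalVectors.

Section LocalOrder.
Context (E : fieldExtType rat) (w : 2.-tuple E) (hw : basis_of {: E} w).
Context (b : 2.-tuple E) (hb : integral_basis b) (l : place).
Hypothesis hspan : Zp_span w l [set x | x \in (w : seq E)] = O_at w l.
Local Notation O_E := (int_closure E).
Local Notation vE := (vecE w (Qp l)).
Let hT := qp_qalg l.
Let hbb : basis_of {: E} b. Proof. by case: hb. Qed.
Implicit Types (x y z : E) (u v : 'cV[Qp l]_2).

Lemma vED x y : vE (x + y) = vE x + vE y. Proof. exact: (vecED w hT). Qed.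
Lemma vEB x y : vE (x - y) = vE x - vE y. Proof. exact: (vecEB w hT). Qed.
Lemma vE0 : vE 0 = 0. Proof. exact: (vecE0 w hT). Qed.
Lemma vE_nat m x : vE (m%:R * x) = m%:R *: vE x. Proof. exact: (vecE_nat w hT). Qed.
Lemma tmul_vE x y : tmul w (vE x) (vE y) = vE (x * y). Proof. exact: (tmul_vecE hw hT). Qed.

Lemma ivec_w (j : 'I_2) : ivec (vE w`_j).
Proof. by move=> i; rewrite (vecE_w hw hT) mxE; exact: qp_int_nat. Qed.

(** Condition (2) on l, in the form [hspan], identifies O_l with Z_l^2 in the coordinates given by
    w. *)
Lemma O_atE v : O_at w l v <-> ivec v.
Proof.
rewrite -hspan; split=> [[n [c [s [sw ->]]]]|iv].
  apply: big_ind => [||k _]; [exact: ivec0|exact: ivecD|].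
  apply: ivecZ; first by exists (c k).
  have /tnthP[j ->] : s k \in (w : seq E) by exact: sw.
  by rewrite (tnth_nth 0); exact: ivec_w.
have h i : exists c : Zp l, qp_of_zp c = v i 0 by have [c _ <-] := iv i; exists c.
have [c cE] := choice h; exists 2%N, c, (fun i => w`_i); split=> [i|].
  by rewrite /= mem_nth ?size_tuple.
by rewrite {1}(cv_decomp hw hT v); apply: eq_bigr => i _; rewrite cE.
Qed.

Lemma ivec_OE x : O_E x -> ivec (vE x).
Proof.
move=> Ox; apply/O_atE; exists 1%N, (fun=> 1), (fun=> x); split=> //.
by rewrite big_ord1 rmorph1 scale1r.
Qed.

Lemma ivec_ind (P : 'cV[Qp l]_2 -> Prop) : (forall u v, P u -> P v -> P (u + v)) ->
  (forall c u, qp_int c -> P u -> P (c *: u)) -> (forall s, O_E s -> P (vE s)) ->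
  forall v, ivec v -> P v.
Proof.
move=> PD PZ PE v /O_atE[n [c [s [sO ->]]]]; apply: big_ind => // [|k _].
  by rewrite -vE0; apply/PE/OE0.
by apply: PZ; [exists (c k)|exact/PE/sO].
Qed.

Lemma ivec_tmul u v : ivec u -> ivec v -> ivec (tmul w u v).
Proof.
move=> hu; move: v; apply: ivec_ind => [v v'|c v hc|s Os].
- by rewrite !tmulE mulmxDr; exact: ivecD.
- by rewrite !tmulE -scalemxAr; exact: ivecZ.
move: u hu; apply: ivec_ind => [u u'|c u hc|s' Os'].
- by rewrite !tmulE raddfD /= mulmxDl; exact: ivecD.
- by rewrite !tmulE iotaZ -scalemxAl; exact: ivecZ.
- by rewrite tmul_vE; apply/ivec_OE/OE_mul.
Qed.

Lemma imx_iota v : ivec v -> imx (iota w v).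
Proof.
move=> hv i j; have := ivec_tmul hv (ivec_w j) i.
rewrite tmulE (vecE_w hw hT) -colE mxE //.
Qed.

(** The coordinates of x in the integral basis are rational numbers integral at l; d is the product
    of their denominators. *)
Lemma local_global x : ivec (vE x) -> exists2 d, coprime d l & O_E (d%:R * x).
Proof.
move=> /O_atE[n [c [s [sO vxE]]]].
have coordi i : qp_int (ratr (coord b i x) : Qp l).
  pose B : 'M[Qp l]_2 := map_mx (qratr_of hT) (\matrix_(i, j) coord b i w`_j).
  have BE y : B *m vE y = vecE b (Qp l) y.
    rewrite (vecE_map w hT) (vecE_map b hT) -map_mxM; congr map_mx.
    apply/matrixP => k j; rewrite (ord1 j) !mxE {2}(coordK hw y) raddf_sum /=.
    by apply: eq_bigr => m _; rewrite linearZ /= !mxE mulrC.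
  have -> : ratr (coord b i x) = vecE b (Qp l) x i 0 by rewrite mxE.
  rewrite -BE vxE mulmx_sumr summxE; apply: qp_int_sum => k _.
  rewrite -scalemxAr BE mxE; apply: qp_intM; first by exists (c k).
  rewrite mxE; have /(OE_coord hb)/(_ i)[m ->] := sO k.
  by rewrite -[ratr _]/(qratr_of hT _) rmorph_int; exact: qp_int_int.
exists (\prod_i `|denq (coord b i x)|)%N.
  elim/big_ind: _ => [|m n' cm cn|i _]; [exact: coprime1n|by rewrite coprimeMl cm|exact: qp_int_ratr].
have dE q : (`|denq q|%N)%:R = (denq q)%:~R :> rat by rewrite pmulrn absz_denq.
apply/(OE_coord hb) => i; rewrite (bigD1 i) //=; set m := (\prod_(j < 2 | _) _)%N.
exists (numq (coord b i x) * m%:Z).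
by rewrite mulr_natl -scaler_nat linearZ /= natrM dE rmorphM /= numqE mulrC mulrA.
Qed.

Lemma E_natr_neq0 n : (0 < n)%N -> (n%:R : E) != 0.
Proof. by move=> n0; rewrite -(rmorph_nat (in_alg E)) fmorph_eq0 pnatr_eq0 -lt0n. Qed.

(** By [local_global] some multiple d (x/l), with d prime to l, lies in O_E; [ideal_unscale] then
    removes d. *)
Lemma lvec_OE x : O_E x -> lvec (vE x) -> exists2 z, O_E z & x = (l : nat)%:R * z.
Proof.
move=> Ox /lvecP[u iu uE].
have l0 : ((l : nat)%:R : E) != 0 by rewrite E_natr_neq0 // prime_gt0 // place_prime.
have [|d cdl Od] := @local_global (x / (l : nat)%:R).
  suff -> : vE (x / (l : nat)%:R) = u by [].
  apply: (scalerI (qp_p_neq0 l)); by rewrite -uE -vE_nat mulrCA mulfV ?mulr1.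
pose P : set E := [set y | exists2 z, O_E z & y = (l : nat)%:R * z].
suff: P x by [].
apply: (@ideal_unscale _ _ P _ _ cdl _ _ _ Ox _).
- by move=> _ _ [z Oz ->] [z' Oz' ->]; exists (z + z'); [exact: OE_add|rewrite mulrDr].
- by move=> a _ Oa [z Oz ->]; exists (a * z); [exact: OE_mul|rewrite mulrCA].
- by exists 1; [exact: OE1|rewrite mulr1].
- by exists (d%:R * (x / (l : nat)%:R)) => //; rewrite mulrCA [(l : nat)%:R * _]mulrCA mulfV ?mulr1.
Qed.

Lemma OE_approx v : ivec v -> exists2 x, O_E x & lvec (v - vE x).
Proof.
move: v; apply: ivec_ind => [u v' [x Ox hx] [y Oy hy]|c u hc [x Ox hx]|s Os].
- exists (x + y); first exact: OE_add.
  rewrite vED; exact: (lvecBD hx hy).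
- have [m [y [iy ->]]] := qp_approx hc.
  exists (m%:R * x); first exact/OE_mul/Ox/OE_nat.
  rewrite vE_nat scalerDl addrAC -scalerBr; apply: lvecD.
    by apply: lvecZ => //; exact: qp_int_nat.
  apply/lvecP; exists (y *: u); last by rewrite scalerA.
  apply: ivecZ => //; rewrite -(subrK (vE x) u); apply: ivecD; last exact: ivec_OE.
  exact: lvec_ivec.
- exists s => //; rewrite subrr => i; rewrite mxE; exact: qdvd0.
Qed.

Definition is_ideal (P : set E) : Prop := [/\ P `<=` O_E, P 0,
  forall x y, P x -> P y -> P (x + y) & forall a x, O_E a -> P x -> P (a * x)].

(** As l lies in P, the Z_l-span of P is P + l O_l. Membership is thus decided modulo l, with a
    single element of P. *)
Lemma span_ideal (P : set E) v : is_ideal P -> P (l : nat)%:R ->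
  Zp_span w l P v <-> ivec v /\ exists2 x, P x & lvec (v - vE x).
Proof.
move=> [PO P0 PD PM] Pl; split=> [[n [c [s [sP ->]]]]|[iv [x Px /lvecP[u /O_atE[n [c [s [sO uE]]]] vE']]]].
  pose S u := ivec u /\ exists2 x, P x & lvec (u - vE x).
  apply: (@big_ind _ S) => [|u v' [iu [x Px hx]] [iv [y Py hy]]|k _].
  - split; first exact: ivec0.
    by exists 0 => //; rewrite vE0 subrr => i; rewrite mxE; exact: qdvd0.
  - split; first exact: ivecD.
    exists (x + y); first exact: PD.
    by rewrite vED; exact: (lvecBD hx hy).
  - have [m [y [iy cE]]] := qp_approx (ex_intro2 _ _ (c k) I erefl : qp_int (qp_of_zp (c k))).
    have iks : ivec (vE (s k)) by exact/ivec_OE/PO.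
    split; first by apply: ivecZ => //; exists (c k).
    exists (m%:R * s k); first exact/PM/sP/OE_nat.
    rewrite vE_nat cE scalerDl addrAC subrr add0r -scalerA.
    by apply/lvecP; exists (y *: vE (s k)) => //; exact: ivecZ.
pose c' (i : 'I_n.+1) := oapp c 1 (unlift ord0 i).
pose s' (i : 'I_n.+1) := oapp (fun k => (l : nat)%:R * s k) x (unlift ord0 i).
exists n.+1, c', s'; split=> [i|].
  rewrite /s'; case: unliftP => [k|] _ //=; rewrite mulrC; exact/PM/Pl/sO.
rewrite big_ord_recl /c' /s' unlift_none /= rmorph1 scale1r -[LHS](subrK (vE x)) addrC vE' uE.
congr (_ + _); rewrite scaler_sumr; apply: eq_bigr => k _.
by rewrite liftK /= vE_nat !scalerA mulrC.
Qed.
End LocalOrder.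

Section LocalTorus.
Context (E : fieldExtType rat) (w : 2.-tuple E) (hw : basis_of {: E} w).
Context (b : 2.-tuple E) (hb : integral_basis b) (l : place).
Hypothesis hspan : Zp_span w l [set x | x \in (w : seq E)] = O_at w l.
Local Notation O_E := (int_closure E).
Local Notation vE := (vecE w (Qp l)).
Let hT := qp_qalg l.
Implicit Types (x y z : E) (u v : 'cV[Qp l]_2) (P : set E).

Lemma prime_ideal_ideal P : is_prime_ideal O_E P -> is_ideal P.
Proof. by move=> [[PO P0 PD] [PM _ _]]; split. Qed.

Lemma ideal_opp P x : is_ideal P -> P x -> P (- x).
Proof. by move=> [PO P0 PD PM] Px; rewrite -mulN1r; apply: PM => //; exact/OE_opp/OE1. Qed.

Lemma ideal_sub P x y : is_ideal P -> P x -> P y -> P (x - y).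
Proof. by move=> Pi Px Py; have [PO P0 PD PM] := Pi; apply: PD => //; exact: ideal_opp. Qed.

Lemma prime_above_int P (m : int) : prime_ideal_above l P -> P m%:~R -> (l %| `|m|)%N.
Proof.
move=> [Pp Pl] Pm; have Pi := prime_ideal_ideal Pp.
have [[PO P0 PD] [PM P1 PP]] := Pp; apply: contrapT => /negP nl.
have cml : coprime `|m| l by rewrite coprime_sym prime_coprime // place_prime.
apply: P1; apply: (ideal_unscale cml PD PM Pl); [exact: OE1|rewrite mulr1].
case: m Pm {nl cml} => m //=; rewrite NegzE mulrNz => Pm.
by rewrite -[_%:R]opprK; exact: ideal_opp.
Qed.

Lemma ideal_int P (m : int) : is_ideal P -> P l%:R -> (l %| `|m|)%N -> P m%:~R.
Proof.
move=> Pi Pl; have [PO P0 PD PM] := Pi => lm.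
have Pn : P (`|m|%N)%:R.
  by have /dvdnP[k ->] := lm; rewrite natrM; apply: PM Pl; exact: OE_nat.
case: m Pn {lm} => m //= Pn; rewrite NegzE mulrNz; exact: ideal_opp.
Qed.

Lemma lE_ideal P x : is_ideal P -> P l%:R -> O_E x -> P ((l : nat)%:R * x).
Proof. by move=> [PO P0 PD PM] Pl Ox; rewrite mulrC; exact: PM. Qed.

Lemma det_iota_approx u x : ivec u -> O_E x -> lvec (u - vE x) ->
  qdvd (\det (iota w u) - ratr (nmE w x)).
Proof.
move=> iu Ox hux; have ix := ivec_OE hw hspan Ox.
have -> : ratr (nmE w x) = \det (iota w (vE x)).
  by rewrite (iota_vecE hw hT) det_map_mx.
apply: qdvd_detB; [exact: (imx_iota hw hspan iu)|exact: (imx_iota hw hspan ix)|].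
have [u' iu' e] := (lvecP _).1 hux.
move=> i j; rewrite -raddfB /= e iotaZ mxE; exists (iota w u' i j) => //.
exact: (imx_iota hw hspan iu').
Qed.

Lemma mul_conj_int x (m : int) : nmE w x = m%:~R -> x * conjE w x = m%:~R.
Proof. by move=> mE; rewrite mul_conjE // mE scaler_int. Qed.

Definition lO : set E := [set (l : nat)%:R * x | x in O_E].

Lemma lO_ideal : is_ideal lO.
Proof.
split.
- by move=> _ [x Ox <-]; apply: OE_mul => //; exact: OE_nat.
- by exists 0; [exact: OE0|rewrite mulr0].
- by move=> _ _ [x Ox <-] [y Oy <-]; exists (x + y); [exact: OE_add|rewrite mulrDr].
- by move=> a _ Oa [x Ox <-]; exists (a * x); [exact: OE_mul|rewrite mulrCA].
Qed.

Lemma lO_l : lO (l : nat)%:R.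
Proof. by exists 1; [exact: OE1|rewrite mulr1]. Qed.

Lemma lO_lvec x : O_E x -> lO x <-> lvec (vE x).
Proof.
move=> Ox; split=> [[z Oz <-]|/(lvec_OE hw hb hspan Ox)[z Oz ->]]; last by exists z.
by apply/lvecP; exists (vE z); [exact: (ivec_OE hw hspan)|exact: (vE_nat w)].
Qed.

Lemma trE_mulnat (m : nat) x : trE w (m%:R * x) = m%:R * trE w x.
Proof. by rewrite mulr_natl -scaler_nat trEZ. Qed.

Lemma lO_conj x : lO (conjE w x) -> lO x.
Proof.
move=> [z Oz zE]; have [t tE] := trE_int hw hb Oz.
exists (t%:~R - z); first by apply: OE_sub => //; exact: OE_int.
rewrite -(conjEK hw x) -zE /conjE trE_mulnat tE mulrBr; congr (_ - _).
by rewrite -scalerA scaler_int scaler_nat mulr_natl.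
Qed.

Lemma nmE_mulnat (m : nat) x : nmE w (m%:R * x) = m%:R ^+ 2 * nmE w x.
Proof. by rewrite nmEM // -[m%:R in LHS](rmorph_nat (in_alg E)) nmE_alg. Qed.

(** Taking norms in 1 = l z would make l^2 divide 1. *)
Lemma not_lO1 : ~ lO 1.
Proof.
move=> [z Oz zE]; have [m mE] := nmE_int hw hb Oz.
have := nmE_alg hw 1; rewrite scale1r -zE nmE_mulnat mE expr1n => /eqP.
rewrite -natrX pmulrn -rmorphM /= -[1]/(1%:~R) eqr_int => /eqP/(congr1 absz).
rewrite abszM absz_nat => /eqP; rewrite muln_eq1 => /andP[/eqP l1 _].
by have := prime_gt1 (place_prime l); rewrite -(ltn_exp2r 1 l (isT : 0 < 2)%N) l1.
Qed.

Section Inert.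
Hypothesis hin : inert E l.

Lemma inert_norm x (m : int) : O_E x -> nmE w x = m%:~R -> (l %| `|m|)%N -> lO x.
Proof.
move=> Ox mE lm; have [_ [_ _ hp]] := hin.
have : lO (x * conjE w x) by rewrite (mul_conj_int mE); apply: ideal_int lm; [exact: lO_ideal|exact: lO_l].
by case/hp => //; [exact: (OE_conj hw hb Ox)|exact: lO_conj].
Qed.

Lemma inert_prime_above P : prime_ideal_above l P -> P = lO.
Proof.
move=> Pa; have [Pp Pl] := Pa; have Pi := prime_ideal_ideal Pp.
apply/seteqP; split=> [x Px|_ [x Ox <-]]; last exact: lE_ideal.
have [PO P0 PD PM] := Pi; have Ox := PO _ Px.
have [m mE] := nmE_int hw hb Ox; apply: (inert_norm Ox mE); apply: (prime_above_int Pa).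
rewrite -(mul_conj_int mE) mulrC; apply: PM => //; exact: (OE_conj hw hb Ox).
Qed.

(** Some x in O_E is congruent to u modulo l, and its norm is congruent to the determinant. As l is
    inert, it divides the norm only if it divides x, hence u. *)
Lemma inert_det u : ivec u -> ~ lvec u -> ~ qdvd (\det (iota w u)).
Proof.
move=> iu nlu ld; have [x Ox hx] := OE_approx hw hspan iu.
have [m mE] := nmE_int hw hb Ox; apply: nlu.
have : qdvd (m%:~R : Qp l).
  have := qdvdB ld (det_iota_approx iu Ox hx); rewrite opprB addrC subrK mE.
  by rewrite -[ratr _]/(qratr_of hT _) rmorph_int.
move=> /qdvd_intr lm; have := inert_norm Ox mE lm.
move=> /(lO_lvec Ox) lx; have := lvecD hx lx; by rewrite subrK.
Qed.

(** The only prime above l is l O_E, so l divides v. Conversely l is a multiple of v, so that u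
    divides 1 and is not divisible by l. *)
Lemma inert_uniformizer P v : prime_ideal_above l P -> uniformizer w l P v ->
  exists u, [/\ ivec u, ~ lvec u & v = (l : nat)%:R *: u].
Proof.
move=> /inert_prime_above PE [/(O_atE hw hspan) iv vP _].
have i1 : ivec (vE 1) by apply/(ivec_OE hw hspan)/OE1.
have spE u : Zp_span w l P u <-> lvec u.
  rewrite PE (span_ideal hw hspan _ lO_ideal lO_l); split.
    move=> [iu [x lOx hx]]; have [Ox] : O_E x /\ True by split=> //; case: lO_ideal => h _ _ _; exact: h.
    move=> _; have := lvecD hx ((lO_lvec Ox).1 lOx); by rewrite subrK.
  move=> lu; split; first exact: lvec_ivec lu.
  by exists 0; [case: lO_ideal|rewrite (vE0 w) subr0].
have lv : lvec v.
  apply/spE; rewrite -vP; exists (vE 1); last exact: tmul1.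
  exact/(O_atE hw hspan).
have [u iu uE] := (lvecP _).1 lv; exists u; split=> //.
move=> lu; have : Zp_span w l P ((l : nat)%:R *: vE 1).
  by apply/spE/lvecP; exists (vE 1).
rewrite -vP => -[t /(O_atE hw hspan) it].
rewrite tmulE uE iotaZ -scalemxAl => /(scalerI (qp_p_neq0 l)) ut.
have [u' iu' uE'] := (lvecP _).1 lu; have it' := ivec_tmul hw hspan iu' it.
have l1 : lvec (vE 1).
  by apply/lvecP; exists (tmul w u' t) => //; rewrite -ut uE' iotaZ -scalemxAl.
by apply: not_lO1; exact: ((lO_lvec (OE1 E)).2 l1).
Qed.
End Inert.
End LocalTorus.

(** * Split primes *)

Section Characters.
Context (E : fieldExtType rat) (w : 2.-tuple E) (hw : basis_of {: E} w) (l : place).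
Hypothesis hspan : Zp_span w l [set x | x \in (w : seq E)] = O_at w l.
Local Notation vE := (vecE w (Qp l)).
Let hT := qp_qalg l.
Implicit Types (u v f : 'cV[Qp l]_2).

(* For an idempotent f of trace 1, E (x) Q_l acts on the line spanned by f through chi f. *)
Definition chi f v : Qp l := \tr (iota w v *m iota w f).
Definition rank1_idem f : Prop := tmul w f f = f /\ \tr (iota w f) = 1.

Lemma chiD f u v : chi f (u + v) = chi f u + chi f v.
Proof. by rewrite /chi raddfD mulmxDl mxtraceD. Qed.
Lemma chiZ f c v : chi f (c *: v) = c * chi f v.
Proof. by rewrite /chi iotaZ -scalemxAl mxtraceZ. Qed.
Lemma chiB f u v : chi f (u - v) = chi f u - chi f v.
Proof. by rewrite chiD -scaleN1r chiZ mulN1r. Qed.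

Lemma tmulZr c u v : tmul w u (c *: v) = c *: tmul w u v.
Proof. by rewrite !tmulE -scalemxAr. Qed.
Lemma tmulZl c u v : tmul w (c *: u) v = c *: tmul w u v.
Proof. by rewrite !tmulE iotaZ -scalemxAl. Qed.
Lemma tmulDl u v t : tmul w (u + v) t = tmul w u t + tmul w v t.
Proof. by rewrite !tmulE raddfD mulmxDl. Qed.
Lemma tmulDr u v t : tmul w t (u + v) = tmul w t u + tmul w t v.
Proof. by rewrite !tmulE mulmxDr. Qed.
Lemma tmulBl u v t : tmul w (u - v) t = tmul w u t - tmul w v t.
Proof. by rewrite -scaleN1r tmulDl tmulZl scaleN1r. Qed.
Lemma tmulBr u v t : tmul w t (u - v) = tmul w t u - tmul w t v.
Proof. by rewrite -scaleN1r tmulDr tmulZr scaleN1r. Qed.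
Lemma tmulv1 v : tmul w v (vE 1) = v. Proof. exact: (tmul1 hw hT). Qed.
Lemma tmul1v' v : tmul w (vE 1) v = v. Proof. exact: (tmul1v hw hT). Qed.
Lemma tmulCv u v : tmul w u v = tmul w v u. Proof. exact: (tmulC hw hT). Qed.
Lemma tmulAv u v t : tmul w u (tmul w v t) = tmul w (tmul w u v) t.
Proof. exact: (tmulA hw hT). Qed.
Lemma iota_tmulv u v : iota w (tmul w u v) = iota w u *m iota w v.
Proof. exact: (iota_tmul hw hT). Qed.
Lemma iotav_inj u v : iota w u = iota w v -> u = v. Proof. exact: (iota_inj hw hT). Qed.
Lemma iotav1 : iota w (vE 1) = 1%:M. Proof. exact: (iota1 hw hT). Qed.

(** By Cayley-Hamilton an idempotent of trace 1 has determinant 0, and [rank1_sandwich] makes v f a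
    scalar multiple of f. *)
Lemma chiE f v : rank1_idem f -> tmul w v f = chi f v *: f.
Proof.
move=> [ff trf]; have d0 : \det (iota w f) = 0.
  have := cayley2 (iota w f); rewrite trf scale1r -iota_tmulv ff => e.
  have /matrixP/(_ 0 0) : (\det (iota w f))%:M = 0 :> 'M_2.
    by apply/eqP; rewrite -oppr_eq0 -[X in - X](subKr (iota w f)) -e subrr oppr0.
  by rewrite !mxE.
apply: iotav_inj; rewrite iotaZ /chi -(rank1_sandwich _ d0) -!iota_tmulv.
by rewrite (tmulCv f v) -tmulAv ff.
Qed.

Lemma chi_id f : rank1_idem f -> chi f f = 1.
Proof. by move=> [ff trf]; rewrite /chi -iota_tmulv ff. Qed.
Lemma chi1 f : rank1_idem f -> chi f (vE 1) = 1.
Proof. by move=> [ff trf]; rewrite /chi -iota_tmulv tmul1v'. Qed.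

Lemma chiM f u v : rank1_idem f -> chi f (tmul w u v) = chi f u * chi f v.
Proof.
move=> hf; have := congr1 (chi f) (chiE (tmul w u v) hf).
rewrite chiZ (chi_id hf) mulr1 => <-; rewrite -tmulAv (chiE v hf) tmulZr (chiE u hf).
by rewrite scalerA chiZ (chi_id hf) mulr1 mulrC.
Qed.

Definition idemC f : 'cV[Qp l]_2 := vE 1 - f.

Lemma idemC_rank1 f : rank1_idem f -> rank1_idem (idemC f).
Proof.
move=> [ff trf]; split.
  by rewrite /idemC tmulBl tmul1v' tmulBr tmulv1 ff subrr subr0.
rewrite raddfB raddfB /= trf iotav1 mxtrace1 addrK //.
Qed.

Lemma chiC f : rank1_idem f -> chi (idemC f) f = 0.
Proof.
move=> [ff trf]; rewrite /chi -iota_tmulv /idemC tmulBr tmulv1 ff subrr.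
by rewrite raddf0 mxtrace0.
Qed.
Lemma chiC' f : rank1_idem f -> chi f (idemC f) = 0.
Proof. by move=> hf; rewrite chiB (chi1 hf) (chi_id hf) subrr. Qed.

Lemma chi_decomp f v : rank1_idem f -> v = chi f v *: f + chi (idemC f) v *: idemC f.
Proof.
move=> hf; rewrite -(chiE v hf) -(chiE v (idemC_rank1 hf)) -tmulDr /idemC addrC subrK.
by rewrite tmulv1.
Qed.

Lemma qp_int_chi f v : ivec f -> ivec v -> qp_int (chi f v).
Proof.
move=> hf hv; rewrite /chi -iota_tmulv mxtrace2.
by apply: qp_intD; apply: (imx_iota hw hspan (ivec_tmul hw hspan hv hf)).
Qed.
Lemma qdvd_chi f v : ivec f -> lvec v -> qdvd (chi f v).
Proof.
move=> hf /lvecP[u iu ->]; rewrite chiZ; apply: qdvdMl; first exact: qdvd_p.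
exact: qp_int_chi.
Qed.
Lemma lvec_chi f v : rank1_idem f -> ivec f -> ivec (idemC f) ->
  qdvd (chi f v) -> qdvd (chi (idemC f) v) -> lvec v.
Proof.
move=> hf i1 i2 d1 d2; rewrite (chi_decomp v hf); apply: lvecD => i; rewrite mxE;
by apply: qdvdMl.
Qed.

(** The columns f and 1 - f of k diagonalize E (x) Q_l. The coordinates of v in this basis are its
    two characters, which are integral on O_l; hence the inverse of k is integral. *)
Lemma idem_diagonal f (k : 'M[Qp l]_2) : rank1_idem f -> ivec f -> ivec (idemC f) ->
  k = row_mx f (idemC f) :> 'M[Qp l]_(2, 1 + 1) ->
  [/\ k \in unitmx, imx k, imx (invmx k),
      forall v, invmx k *m v = \col_i (if i == 0 then chi f v else chi (idemC f) v) &
      forall v, iota w v = k *m mx22 (chi f v) 0 0 (chi (idemC f) v) *m invmx k].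
Proof.
move=> hf i1 i2 kE; have hf' := idemC_rank1 hf.
have k0 (i : 'I_2) : k i 0 = f i 0.
  have -> : (0 : 'I_2) = lshift 1 (0 : 'I_1) by exact/val_inj.
  by rewrite kE; exact: (row_mxEl f (idemC f) i 0).
have k1 (i : 'I_2) : k i 1 = idemC f i 0.
  have -> : (1 : 'I_2) = rshift 1 (0 : 'I_1) by exact/val_inj.
  by rewrite kE; exact: (row_mxEr f (idemC f) i 0).
pose c v : 'cV[Qp l]_2 := \col_i (if i == 0 then chi f v else chi (idemC f) v).
have kc v : k *m c v = v.
  apply: cv2P; rewrite mulmx2E [c v 0 0]mxE [c v 1 0]mxE /= k0 k1 {3}(chi_decomp v hf) !mxE;
  by rewrite mulrC [X in _ + X]mulrC.
pose k' : 'M[Qp l]_2 := \matrix_(i, j) c (vE w`_j) i 0.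
have kk' : k *m k' = 1%:M.
  apply/matrixP => i j.
  have -> : (k *m k') i j = (k *m c (vE w`_j)) i 0.
    by rewrite !mulmx2E [k' 0 j]mxE [k' 1 j]mxE.
  rewrite kc mxE coord_w // [RHS]mxE.
  exact: (rmorph_nat (qratr_of hT)).
have [uk _] := mulmx1_unit kk'.
have ik' : invmx k = k' by rewrite -[RHS]mul1mx -(mulVmx uk) -mulmxA kk' mulmx1.
have ic v : ivec v -> ivec (c v).
  by move=> iv i; rewrite mxE; case: eqP => _; exact: qp_int_chi.
have invc v : invmx k *m v = c v by rewrite -{1}(kc v) mulKmx.
split=> //.
- by move=> i j; case: (ord2P j) => ->; rewrite ?k0 ?k1; [exact: i1|exact: i2].
- by move=> i j; rewrite ik' mxE; exact/ic/ivec_w.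
move=> v; have e : iota w v *m k = k *m mx22 (chi f v) 0 0 (chi (idemC f) v).
  have c1 := chiE v hf; have c2 := chiE v hf'.
  apply/matrixP => i j; rewrite [RHS]mulmx2E !mxE.
  case: (ord2P j) => -> /=; rewrite ?mulr0 ?addr0 ?add0r ?k0 ?k1.
    have := congr1 (fun u : 'cV_2 => u i 0) c1; rewrite tmulE !mxE mulrC => <-.
    by apply: eq_bigr => m _; rewrite k0.
  have := congr1 (fun u : 'cV_2 => u i 0) c2; rewrite tmulE [RHS]mxE mxE mulrC => <-.
  by apply: eq_bigr => m _; rewrite k1.
by rewrite -e mulmxK.
Qed.
End Characters.

(** * Elements of O_E that separate the primes above a split l *)

Section Split.
Context (E : fieldExtType rat) (w : 2.-tuple E) (hw : basis_of {: E} w).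
Context (b : 2.-tuple E) (hb : integral_basis b) (l : place) (d : int).
Hypothesis hspan : Zp_span w l [set x | x \in (w : seq E)] = O_at w l.
Hypotheses (hd : d%:~R = \det (\matrix_(i < 2, j < 2) \tr (mulE b (b`_i * b`_j)))) (ld : ~~ (l %| d)%Z).
Hypothesis hni : ~ inert E l.
Local Notation O_E := (int_closure E).
Local Notation vE := (vecE w (Qp l)).
Local Notation lO := (@lO E l).
Let hT := qp_qalg l.
Implicit Types (x y z : E) (u v : 'cV[Qp l]_2) (P : set E).

(** Otherwise every x outside l O_E would have norm prime to l and, multiplying by its conjugate,
    could be cancelled modulo l; then l O_E would be prime. *)
Lemma split_zero_divisor : exists x (m : int),
  [/\ O_E x, ~ lO x, nmE w x = m%:~R & (l %| `|m|)%N].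
Proof.
apply: contrapT => h; apply: hni; have [lO1 lO2 lO3 lO4] := lO_ideal E l.
split; split => //; first exact: (not_lO1 hw hb).
move=> x y Ox Oy lxy; have [lx|nlx] := pselect (lO x); first by left.
have [m mE] := nmE_int hw hb Ox; right.
have [lm|nlm] := boolP (l %| `|m|)%N; first by case: h; exists x, m.
have cml : coprime `|m| l by rewrite coprime_sym prime_coprime // place_prime.
apply: (ideal_unscale cml lO3 lO4 (lO_l E l) Oy).
have : lO (m%:~R * y).
  rewrite -(mul_conj_int hw mE) [x * _]mulrC -mulrA; apply: lO4 => //.
  exact: (OE_conj hw hb Ox).
case: (m) => k //; rewrite NegzE mulrNz mulNr => hk.
by rewrite -[_ * y]opprK; apply: (ideal_opp (lO_ideal E l)).
Qed.

(** This is where l is used to be unramified. If l divided both norm and trace, x^2 would lie in l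
    O_E, the square of tr(x y) would be divisible by l for every y in O_E, and [disc_nondegenerate]
    would put x in l O_E. *)
Lemma split_trace x (m t : int) : O_E x -> ~ lO x -> nmE w x = m%:~R -> (l %| `|m|)%N ->
  trE w x = t%:~R -> ~ (l %| `|t|)%N.
Proof.
move=> Ox nlx mE lm tE lt; apply: nlx.
have [z Oz ->] : exists2 z, O_E z & x = (l : nat)%:R * z; last by exists z.
apply: (disc_nondegenerate hw hb hd ld Ox) => y Oy.
have Oxy := OE_mul Ox Oy; have [s sE] := trE_int hw hb Oxy.
suff /dvdzP[q qE] : (l%:Z %| s)%Z by exists q; rewrite sE qE mulrC.
suff h : (l%:Z %| s ^+ 2)%Z.
  by move: h; rewrite !dvdzE abszX absz_nat Euclid_dvdX ?place_prime // => /andP[].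
have lx2 : lO (x * x).
  have -> : x * x = t%:~R * x - m%:~R.
    rewrite -(mul_conj_int hw mE) /conjE tE mulrBr -[in x * _%:A]mulrC.
    by rewrite scaler_int opprB addrC subrK.
  have [lO1 lO2 lO3 lO4] := lO_ideal E l.
  apply: (ideal_sub (lO_ideal E l)).
    by rewrite mulrC; apply: lO4 => //; exact: (ideal_int (lO_ideal E l) (lO_l E l) lt).
  exact: (ideal_int (lO_ideal E l) (lO_l E l) lm).
have [z Oz zE] : lO (x * y * (x * y)).
  have [_ _ _ lO4] := lO_ideal E l; rewrite mulrACA mulrC; apply: lO4 => //.
  exact: OE_mul.
have [tz tzE] := trE_int hw hb Oz; have [ny nyE] := nmE_int hw hb Oy.
have := trE_sqr hw (x * y); rewrite sE [(x * y) ^+ 2]expr2 -zE trE_mulnat tzE nmEM // mE nyE => e.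
have {}e : s ^+ 2 = l%:Z * tz + m * ny *+ 2.
  by apply/eqP; rewrite -(eqr_int rat) rmorphXn /= e rmorphD rmorphMn !rmorphM.
rewrite e rpredD // ?dvdz_mulr // rpredMn // dvdz_mulr //.
Qed.

Context (P : set E) (hP : prime_ideal_above l P).

(** The product of x and its conjugate lies in P but their sum, an integer prime to l, does not. So
    exactly one of the two is in P, and x is exchanged with its conjugate if necessary. *)
Lemma split_element : exists x (m t : int),
  [/\ O_E x, P (conjE w x), ~ P x & [/\ nmE w x = m%:~R, trE w x = t%:~R, (l %| `|m|)%N & ~ (l %| `|t|)%N]].
Proof.
have [x [m [Ox nlx mE lm]]] := split_zero_divisor.
have [t tE] := trE_int hw hb Ox; have nlt := split_trace Ox nlx mE lm tE.
have [Pp Pl] := hP; have Pi := prime_ideal_ideal Pp; have [_ [_ P1 PP]] := Pp.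
have [PO P0 PD PM] := Pi; have Oc := OE_conj hw hb Ox.
have nP : ~ (P x /\ P (conjE w x)).
  move=> [Px Pc]; apply: nlt; apply: (prime_above_int hP).
  by rewrite -scaler_int -tE -(subrK x (_%:A)) addrC; exact: PD.
have : P (x * conjE w x) by rewrite (mul_conj_int hw mE); exact: (ideal_int Pi Pl lm).
case/(PP _ _ Ox Oc) => [Px|Pc]; last first.
  by exists x, m, t; split=> // Px; exact: nP.
exists (conjE w x), m, t; split=> //; first by rewrite conjEK.
  by move=> Pc; exact: nP.
split=> //; last by rewrite trE_conj.
have := mul_conjE hw (conjE w x); rewrite conjEK // mulrC mul_conjE // mE.
by move/(fmorph_inj (in_alg E)).
Qed.

(** Modulo l the polynomial X^2 - t X + m has the root 0. With a = l a' and m = l m0 the equation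
    becomes l a'^2 - t a' + m0 = 0, to which Hensel's lemma applies since t is invertible modulo
    l. *)
Lemma split_root (m t : int) : (l %| `|m|)%N -> ~ (l %| `|t|)%N ->
  exists a : Qp l, qdvd a /\ a ^+ 2 - t%:~R * a + m%:~R = 0.
Proof.
move=> lm nlt; have /dvdzP[m0 m0E] : (l%:Z %| m)%Z by [].
have [u [v uv]] := Bezoutz t l.
have {}uv : u * t + v * l%:Z = 1.
  rewrite uv /gcdz absz_nat; congr Posz; apply/eqP; rewrite -/(coprime _ _) coprime_sym.
  by rewrite prime_coprime ?place_prime //; exact/negP.
have hA : pdvd ((l : nat)%:R : Zp l) by exact: pdvd_p.
have hB : pdvd (1 - (- u%:~R) * (- t%:~R) : Zp l).
  have e : u%:~R * t%:~R + v%:~R * (l : nat)%:R = 1 :> Zp l.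
    by have := congr1 (fun k : int => k%:~R : Zp l) uv; rewrite rmorphD !rmorphM.
  rewrite mulrNN -[X in X - _]e addrAC subrr add0r; exact/pdvdMr/pdvd_p.
have [a' a'E] := zp_hensel m0%:~R hA hB.
exists (qp_of_zp ((l : nat)%:R * a')); split; first exact/qdvd_zp/pdvdMl.
have := congr1 (fun c => (l : nat)%:R * qp_of_zp c) a'E.
rewrite /= rmorph0 mulr0 => <-; rewrite m0E !rmorphD !rmorphM !rmorphN !rmorph_int rmorph_nat /=.
by ring.
Qed.
End Split.

Section SplitIdempotent.
Context (E : fieldExtType rat) (w : 2.-tuple E) (hw : basis_of {: E} w).
Context (b : 2.-tuple E) (hb : integral_basis b) (l : place).
Hypothesis hspan : Zp_span w l [set x | x \in (w : seq E)] = O_at w l.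
Local Notation O_E := (int_closure E).
Local Notation vE := (vecE w (Qp l)).
Let hT := qp_qalg l.
Context (P : set E) (hP : prime_ideal_above l P).
Context (x : E) (m t : int) (Ox : O_E x) (Pcx : P (conjE w x)) (nPx : ~ P x).
Hypotheses (mE : nmE w x = m%:~R) (tE : trE w x = t%:~R).
Hypotheses (lm : (l %| `|m|)%N) (nlt : ~ (l %| `|t|)%N).
Context (a : Qp l) (la : qdvd a) (aE : a ^+ 2 - t%:~R * a + m%:~R = 0).
Implicit Types (y z : E) (u v : 'cV[Qp l]_2).

(** The difference of the two roots t - a and a of the characteristic polynomial of x, a unit of
    Z_l. *)
Let de : Qp l := t%:~R - a *+ 2.

Let nlde : ~ qdvd de.
Proof.
move=> h; apply: nlt; apply/qdvd_intr; rewrite -(subrK (a *+ 2) (t%:~R)).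
by apply: qdvdD => //; rewrite mulr2n; exact: qdvdD.
Qed.
Let ide : qp_int de.
Proof. by apply: qp_intB; [exact: qp_int_int|rewrite mulr2n; apply: qp_intD; exact: qdvd_int]. Qed.
Let de0 : de != 0. Proof. by case: (qp_int_inv ide nlde). Qed.
Let ideV : qp_int de^-1. Proof. by case: (qp_int_inv ide nlde). Qed.

(** Lagrange interpolation at the two roots: the value is 1 where x acts by t - a and 0 where x acts
    by a. *)
Definition split_idem : 'cV[Qp l]_2 := de^-1 *: (vE x - a *: vE 1).
Let e := split_idem.
Let e' := idemC w e.

Let xE : vE x = de *: e + a *: vE 1.
Proof. by rewrite /e /split_idem scalerA mulfV // scale1r subrK. Qed.

Let vE_int (k : int) : vE k%:~R = k%:~R *: vE 1.
Proof. by rewrite -[in LHS](mulr1 k%:~R); exact: (vecE_int w hT). Qed.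

Let x2 : tmul w (vE x) (vE x) = t%:~R *: vE x - m%:~R *: vE 1.
Proof.
rewrite tmul_vE //; have -> : x * x = t%:~R * x - m%:~R.
  rewrite -(mul_conj_int hw mE) /conjE tE mulrBr -[in x * _%:A]mulrC.
  by rewrite scaler_int opprB addrC subrK.
by rewrite vEB vE_int; congr (_ - _); exact: (vecE_int w hT).
Qed.

Let Ie : rank1_idem w e.
Proof.
split.
  rewrite /e /split_idem tmulZl tmulZr scalerA.
  have -> : tmul w (vE x - a *: vE 1) (vE x - a *: vE 1) = de *: (vE x - a *: vE 1).
    rewrite tmulBl !tmulBr x2 !tmulZl !tmulZr (tmulv1 hw) !(tmul1v' hw) scalerA.
    have -> : m%:~R = t%:~R * a - a * a :> Qp l.
      by apply/eqP; rewrite -subr_eq0 -aE expr2; apply/eqP; ring.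
    rewrite /de; move: (vE x) (vE 1) => X Y; apply: cv2P; rewrite !mxE; ring.
  by rewrite scalerA mulfVK.
rewrite /e /split_idem iotaZ mxtraceZ raddfB raddfB /= iotaZ mxtraceZ (iotav1 hw) mxtrace1.
have -> : \tr (iota w (vE x)) = t%:~R.
  rewrite (iota_vecE hw hT) trace_map_mx -/(trE w x) tE; exact: (rmorph_int (qratr_of hT)).
by rewrite mulr_natr mulVf.
Qed.

Let Ie' : rank1_idem w e'. Proof. exact: idemC_rank1. Qed.
Let ie : ivec e.
Proof.
apply: ivecZ => //; apply: ivecB; first exact: (ivec_OE hw hspan).
by apply: ivecZ; [exact: qdvd_int|apply/(ivec_OE hw hspan)/OE1].
Qed.
Let ie' : ivec e'. Proof. by apply: ivecB => //; apply/(ivec_OE hw hspan)/OE1. Qed.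

Let chi_x f : chi w f (vE x) = de * chi w f e + a * chi w f (vE 1).
Proof. by rewrite {1}xE chiD (chiZ _ _ de) (chiZ _ _ a). Qed.
Let c1x : chi w e (vE x) = t%:~R - a.
Proof. by rewrite chi_x (chi_id hw Ie) (chi1 hw Ie) /de; ring. Qed.
Let c2x : chi w e' (vE x) = a.
Proof. by rewrite chi_x (chiC hw Ie) (chi1 hw Ie') mulr0 add0r mulr1. Qed.

Let vEcx : vE (conjE w x) = t%:~R *: vE 1 - vE x.
Proof. by rewrite /conjE tE scaler_int vEB vE_int. Qed.
Let c1cx : chi w e (vE (conjE w x)) = a.
Proof. by rewrite vEcx chiB chiZ c1x (chi1 hw Ie); ring. Qed.
Let c2cx : chi w e' (vE (conjE w x)) = t%:~R - a.
Proof. by rewrite vEcx chiB chiZ c2x (chi1 hw Ie') mulr1. Qed.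

Let tV : exists c : nat, qdvd (c%:R * t%:~R - 1 : Qp l).
Proof.
have [t0 itV] : (t%:~R : Qp l) != 0 /\ qp_int (t%:~R^-1 : Qp l).
  by apply: qp_int_inv; [exact: qp_int_int|move/qdvd_intr].
have [c [y [iy cE]]] := qp_approx itV; exists c.
have -> : c%:R = t%:~R^-1 - (l : nat)%:R * y by rewrite cE addrK.
rewrite mulrBl mulVf // addrAC subrr add0r; apply: qdvdN.
by apply: qdvdMl; [apply: qdvdMl => //; exact: qdvd_p|exact: qp_int_int].
Qed.

Definition char_ideal f : set E := [set z | O_E z /\ qdvd (chi w f (vE z))].

Let char_ideal_ideal f : rank1_idem w f -> ivec f -> is_ideal (char_ideal f).
Proof.
move=> hf iF; split.
- by move=> z [].
- by split; [exact: OE0|rewrite vE0 /chi raddf0 mul0mx mxtrace0; exact: qdvd0].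
- move=> y z [Oy hy] [Oz hz]; split; first exact: OE_add.
  by rewrite vED chiD; exact: (qdvdD hy hz).
- move=> y z Oy [Oz hz]; split; first exact: OE_mul.
  rewrite -(tmul_vE hw) (chiM hw _ _ hf).
  exact: (qdvdMr (qp_int_chi hw hspan iF (ivec_OE hw hspan Oy)) hz).
Qed.

Let char_ideal_l f : rank1_idem w f -> char_ideal f (l : nat)%:R.
Proof.
move=> hf; split; first exact: OE_nat.
by rewrite -[_%:R]mulr1 vE_nat chiZ (chi1 hw hf) mulr1; exact: qdvd_p.
Qed.

Let char_ideal_prime f : rank1_idem w f -> ivec f -> prime_ideal_above l (char_ideal f).
Proof.
move=> hf iF; have [I1 I2 I3 I4] := char_ideal_ideal hf iF.
split; last exact: char_ideal_l; split; split=> //.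
  by move=> [_]; rewrite (chi1 hw hf); exact: qdvd1.
move=> y z Oy Oz [_]; rewrite -(tmul_vE hw) (chiM hw _ _ hf) => h.
have iy := qp_int_chi hw hspan iF (ivec_OE hw hspan Oy).
have iz := qp_int_chi hw hspan iF (ivec_OE hw hspan Oz).
by case: (qdvdM iy iz h) => h'; [left; exact: (conj Oy h')|right; exact: (conj Oz h')].
Qed.

Let span_char f v : rank1_idem w f -> ivec f ->
  Zp_span w l (char_ideal f) v <-> ivec v /\ qdvd (chi w f v).
Proof.
move=> hf iF; rewrite (span_ideal hw hspan _ (char_ideal_ideal hf iF) (char_ideal_l hf)).
split=> [[iv [z [Oz hz] hvz]]|[iv hv]]; (split; first exact: iv).
  have := qdvdD (qdvd_chi hw hspan iF hvz) hz; by rewrite -chiD subrK.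
have [z Oz hvz] := OE_approx hw hspan iv; exists z; last exact: hvz.
split; first exact: Oz.
have := qdvdB hv (qdvd_chi hw hspan iF hvz); by rewrite -chiB opprB addrC subrK.
Qed.

(* Every element of O_E is congruent to an integer modulo Q, so that Q is determined by its
   intersection with Z. *)
Let prime_char Q : prime_ideal_above l Q -> Q (conjE w x) -> Q = char_ideal e.
Proof.
move=> hQ Qcx; have [Qpr Ql] := hQ; have Qi := prime_ideal_ideal Qpr.
have [QO Q0 QD QM] := Qi.
have key z : O_E z -> exists k : nat, Q (z - k%:R) /\ qdvd (chi w e (vE z) - k%:R).
  move=> Oz; have iz := ivec_OE hw hspan Oz.
  have [k [y [iy kE]]] := qp_approx (qp_int_chi hw hspan ie iz).
  have [c cE] := tV.
  (* The conjugate of x is 0 modulo l under the character of e and t under that of e'. With k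
     congruent to z under the first one and r to (z - k) / t under the second one, z - k - r conj(x)
     is divisible by l. *)
  have [r [y' [iy' rE]]] := qp_approx (qp_intM (qp_int_nat l c)
    (qp_intB (qp_int_chi hw hspan ie' iz) (qp_int_nat l k))).
  have d1 : qdvd (chi w e (vE z) - k%:R).
    by rewrite kE addrAC subrr add0r; apply: qdvdMl => //; exact: qdvd_p.
  exists k; split; last exact: d1.
  have Ocx : O_E (conjE w x) := OE_conj hw hb Ox.
  have Or : O_E (r%:R * conjE w x) by apply: OE_mul => //; exact: OE_nat.
  have Oy : O_E (z - k%:R - r%:R * conjE w x).
    by apply: OE_sub => //; apply: OE_sub => //; exact: OE_nat.
  have vk : vE k%:R = k%:R *: vE 1 by rewrite -[in LHS](mulr1 k%:R) vE_nat.
  have lv : lvec (vE (z - k%:R - r%:R * conjE w x)).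
    apply: (lvec_chi hw Ie ie ie'); rewrite !vEB vE_nat vk !chiB !chiZ.
      rewrite (chi1 hw Ie) mulr1 c1cx.
      exact: (qdvdB d1 (qdvdMr (qp_int_nat l r) la)).
    rewrite (chi1 hw Ie') mulr1 c2cx.
    set s := chi w e' (vE z) - k%:R in rE *.
    have is' : qp_int s.
      by apply: qp_intB; [exact: (qp_int_chi hw hspan ie' iz)|exact: qp_int_nat].
    have -> : r%:R = c%:R * s - (l : nat)%:R * y' by rewrite rE addrK.
    have -> : s - (c%:R * s - (l : nat)%:R * y') * (t%:~R - a) =
        (l : nat)%:R * (y' * (t%:~R - a)) + (c%:R * s) * a - (c%:R * t%:~R - 1) * s by ring.
    have ita : qp_int (t%:~R - a) by apply: qp_intB; [exact: qp_int_int|exact: qdvd_int].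
    apply: qdvdB; last exact: (qdvdMl cE is').
    apply: qdvdD; first exact: (qdvdMl (qdvd_p l) (qp_intM iy' ita)).
    exact: (qdvdMr (qp_intM (qp_int_nat l c) is') la).
  have Qy : Q (z - k%:R - r%:R * conjE w x).
    by have [z' Oz' <-] := (lO_lvec hw hb hspan Oy).2 lv; exact: lE_ideal.
  rewrite -(subrK (r%:R * conjE w x) (z - k%:R)); apply: QD; first exact: Qy.
  by apply: QM; [exact: OE_nat|exact: Qcx].
apply/seteqP; split=> z.
  move=> Qz; have Oz := QO _ Qz; have [k [Qk hk]] := key _ Oz; split; first exact: Oz.
  have Qk' : Q k%:R by have := ideal_sub Qi Qz Qk; rewrite opprB addrC subrK.
  have lk : (l %| k)%N := prime_above_int (m := k) hQ Qk'.
  by rewrite -(subrK k%:R (chi w e (vE z))); apply: (qdvdD hk); exact/qdvd_nat.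
move=> [Oz hz]; have [k [Qk hk]] := key _ Oz.
rewrite -(subrK k%:R z); apply: QD; first exact: Qk.
apply: (ideal_int (m := k) Qi Ql).
by apply/qdvd_nat; have := qdvdB hz hk; rewrite opprB addrC subrK.
Qed.

Let PE : P = char_ideal e. Proof. exact: prime_char. Qed.

(** Both characters take the value 0 or 1 at an idempotent f. Not lying in P forces 1 at e, and
    lying in the other prime [char_ideal e'] forces 0 at e'. *)
Lemma split_idempotent : Defs.idempotent w l P = e.
Proof.
pose S := [set f : 'cV[Qp l]_2 | [/\ O_at w l f, tmul w f f = f, ~ Zp_span w l P f &
     forall Q, prime_ideal_above l Q -> Q <> P -> Zp_span w l Q f]].
have Se : S e.
  split; [exact/(O_atE hw hspan)|by case: Ie| |].
    by rewrite PE => /(span_char _ Ie ie)[_]; rewrite (chi_id hw Ie); exact: qdvd1.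
  move=> Q hQ QP; have [Qpr Ql] := hQ; have Qi := prime_ideal_ideal Qpr.
  have [_ [_ _ QQ]] := Qpr; have [QO Q0 QD QM] := Qi.
  have Qxx : Q (x * conjE w x) by rewrite (mul_conj_int hw mE); exact: (ideal_int Qi Ql lm).
  (* A prime Q above l contains x or its conjugate, and the second case would give Q = P. *)
  have Qx : Q x.
    case: (QQ _ _ Ox (OE_conj hw hb Ox) Qxx) => // Qc.
    by case: QP; rewrite PE; exact: prime_char.
  apply/(span_ideal hw hspan _ Qi Ql); split; first exact: ie.
  have [c cE] := tV; exists (c%:R * x); first by apply: QM; [exact: OE_nat|exact: Qx].
  have ic : qp_int (c%:R : Qp l) := qp_int_nat l c.
  apply: (lvec_chi hw Ie ie ie'); rewrite vE_nat (chiB _ _ e) (chiZ _ _ c%:R) ?c1x ?c2x.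
    rewrite (chi_id hw Ie); have -> : 1 - c%:R * (t%:~R - a) = c%:R * a - (c%:R * t%:~R - 1) by ring.
    exact: (qdvdB (qdvdMr ic la) cE).
  by rewrite (chiC hw Ie) sub0r; apply: qdvdN; exact: (qdvdMr ic la).
have -> : Defs.idempotent w l P = xget 0 S by [].
case: xgetP => [f _ [/(O_atE hw hspan) iF ff nPf Qf]|/(_ e)]; last by case.
have idem s : s * s = s -> s = 0 \/ s = 1 :> Qp l.
  by move=> /eqP; rewrite -subr_eq0 -{3}(mulr1 s) -mulrBr mulf_eq0 subr_eq0 => /orP[]/eqP; [left|right].
have f1 : chi w e f = 1.
  have [f0|//] : chi w e f = 0 \/ chi w e f = 1 by apply: idem; rewrite -(chiM hw _ _ Ie) ff.
  by case: nPf; rewrite PE; apply/(span_char _ Ie ie); rewrite f0; split; [exact: iF|exact: qdvd0].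
have f2 : chi w e' f = 0.
  have [//|f1'] : chi w e' f = 0 \/ chi w e' f = 1 by apply: idem; rewrite -(chiM hw _ _ Ie') ff.
  have Qne : char_ideal e' <> P.
    move=> QP; apply: nPx; rewrite -QP; split; [exact: Ox|by rewrite c2x].
  have /(span_char _ Ie' ie')[_] := Qf _ (char_ideal_prime Ie' ie') Qne.
  by rewrite f1' => /qdvd1.
by rewrite (chi_decomp hw f Ie) f1 f2 scale1r scale0r addr0.
Qed.

Lemma split_uniformizer v : uniformizer w l P v -> exists r : Qp l,
  [/\ qp_int r, qp_int r^-1, r != 0, chi w e v = (l : nat)%:R * r & chi w e' v = 1].
Proof.
rewrite /uniformizer split_idempotent -/(idemC w e) -/e' => -[/(O_atE hw hspan) iv vP ve'].
have c2 : chi w e' v = 1.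
  by have := congr1 (chi w e') ve'; rewrite (chiM hw _ _ Ie') (chi_id hw Ie') mul1r.
have i1 : ivec (vE 1) by apply/(ivec_OE hw hspan)/OE1.
have : Zp_span w l P v by rewrite -vP; exists (vE 1); [exact/(O_atE hw hspan)|exact: tmulv1].
rewrite PE => /(span_char _ Ie ie)[_ [r ir rE]]; exists r.
(* The element l e + e' of P is a multiple of v by the definition of a uniformizer, so r divides
   1. *)
have : Zp_span w l P ((l : nat)%:R *: e + e').
  rewrite PE; apply/(span_char _ Ie ie); split.
    by apply: ivecD => //; apply: ivecZ => //; exact: qp_int_nat.
  rewrite chiD chiZ (chi_id hw Ie) (chiC' hw Ie) mulr1 addr0; exact: qdvd_p.
rewrite -vP => -[u /(O_atE hw hspan) iu uE].
have := congr1 (chi w e) uE; rewrite (chiM hw _ _ Ie) rE chiD chiZ (chi_id hw Ie) (chiC' hw Ie).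
rewrite mulr1 addr0 -{2}(mulr1 (l : nat)%:R) -mulrA => /(mulfI (qp_p_neq0 l)) ru.
have r0 : r != 0 by apply: contra_eqN ru => /eqP ->; rewrite mul0r eq_sym oner_eq0.
split=> //; have -> : r^-1 = chi w e u by apply: (mulfI r0); rewrite ru divff.
exact: (qp_int_chi hw hspan ie iu).
Qed.

Lemma split_data : [/\ rank1_idem w e, ivec e & ivec e'].
Proof. by []. Qed.
End SplitIdempotent.

Lemma split_structure (E : fieldExtType rat) (w : 2.-tuple E) (l : place) (P : set E) :
  basis_of {: E} w -> ~~ (l %| disc E)%Z ->
  Zp_span w l [set x | x \in (w : seq E)] = O_at w l -> ~ inert E l -> prime_ideal_above l P ->
  let f := Defs.idempotent w l P in
  [/\ rank1_idem w f, ivec f, ivec (idemC w f) &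
    forall v, uniformizer w l P v -> exists r : Qp l,
      [/\ qp_int r, qp_int r^-1, r != 0, chi w f v = (l : nat)%:R * r & chi w (idemC w f) v = 1]].
Proof.
move=> hw ld hspan hni hP /=; have [b hb hd] := disc_integral_basis ld.
have [x [m [t [Ox Pc nPx [mE tE lm nlt]]]]] := split_element hw hb hd ld hni hP.
have [a [la aE]] := split_root lm nlt.
rewrite (split_idempotent hw hb hspan hP Ox Pc nPx mE tE lm nlt la aE).
have [h1 h2 h3] := split_data hw hspan Ox mE tE nlt la aE.
split; [exact: h1|exact: h2|exact: h3|].
exact: (split_uniformizer hw hb hspan hP Ox Pc nPx mE tE lm nlt la aE).
Qed.

(** * Unramified subgroups and their local components *)

Lemma gl_at_gat (p : place) (g : GL2 (Qp p)) : gl_at g = gat g.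
Proof. by rewrite gat.unlock. Qed.
Lemma gl_comp_cmp (p : place) (g : GL2 Af) : gl_comp p g = cmp p g.
Proof. by rewrite cmp.unlock. Qed.
Lemma away_part_awy S (g : GL2 Af) : away_part S g = awy S g.
Proof. by rewrite awy.unlock. Qed.

Lemma unramified_cmp (p : place) (D : set (GL2 (Qp p))) (V : set (GL2 Af)) g :
  unramified_at D V -> V g -> D (cmp p g).
Proof.
move=> hV; rewrite {1}hV => -[_ [d Dd <-] [g' [_ tg'] <-]].
rewrite (gl_at_gat d) cmpM cmp_at.
have -> : cmp p g' = 1%g by rewrite -gl_comp_cmp; exact: tg'.
by rewrite mulg1.
Qed.

Lemma unramified_gat (p : place) (D : set (GL2 (Qp p))) (V : set (GL2 Af)) d :
  unramified_at D V -> V 1%g -> D d -> V (gat d).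
Proof.
move=> hV V1 Dd; rewrite hV; exists (gat d); first by exists d => //; exact: gl_at_gat.
exists 1%g; rewrite ?mulg1 //; split=> // q _; rewrite gl_comp_cmp; exact: cmp1.
Qed.

Lemma cmp_prod (s : seq place) (f : forall q : place, GL2 (Qp q)) p : uniq s ->
  cmp p (\big[*%g/1%g]_(q <- s) gat (f q))%g = if p \in s then f p else 1%g.
Proof.
elim: s => [|q s IH] /=; first by rewrite big_nil cmp1.
move=> /andP[qs us]; rewrite big_cons cmpM IH // inE; case: eqVneq => [->|pq] /=.
  by rewrite cmp_at (negPf qs) mulg1.
by rewrite cmp_at_neq // mul1g.
Qed.

Lemma places_uniq n : uniq (places n).
Proof. by rewrite /places; apply: (pmap_uniq (@insubK _ _ _)); exact: primes_uniq. Qed.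

Lemma mem_places_dvd (p : place) n : (0 < n)%N -> (p \in places n) = (p %| n)%N.
Proof. by move=> n0; rewrite mem_places mem_primes place_prime n0. Qed.

Lemma adele_eq_natmul (x : Af) n : (0 < n)%N -> (forall p : place, (p %| n)%N -> afc p x = 0) ->
  (forall p, qp_int (afc p x)) -> exists2 a, af_int a & x = n%:R * a.
Proof.
move=> n0 x0 xi; have un : (n%:R : Af) \is a GRing.unit by case: n n0 {x0} => // n _; exact: af_qalg.
exists (n%:R^-1 * x); last by rewrite mulVKr.
move=> p; rewrite -/(afc p _) rmorphM rmorphV // rmorph_nat.
have [pn|npn] := boolP (p %| n)%N; first by rewrite [X in _ * X]x0 // mulr0; exact: qp_int0.
apply: qp_intM (xi p); apply: (qp_int_inv (qp_int_nat _ _) _).2.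
by move/qdvd_nat; exact/negP.
Qed.

(* V is the trace on H of an open subgroup, hence contains the elements of H which are
   trivial modulo a suitable integer; this reduces to finitely many places. *)
Lemma open_restricted_product (H V : set (GL2 Af)) (S : set place)
    (D : forall p, set (GL2 (Qp p))) x :
  is_subgroup H -> is_subgroup V -> (exists2 O, open O & V = O `&` H) ->
  (forall p d, S p -> D p d -> V (gat d) /\ GL2_Z p d) ->
  H x -> (forall p, S p -> D p (cmp p x)) -> (forall p, ~ S p -> cmp p x = 1%g) -> V x.
Proof.
move=> [H1 HM HV] [V1 VM VV] [O openO VE] hD Hx xD x1.
have VH g : V g -> H g by rewrite VE => -[].
have [N N0 hN] : exists2 N, (0 < N)%N & lcos (congruence_subgroup N) 1%g `<=` O.
  by apply: openO; have := V1; rewrite VE => -[].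
pose s := [seq p <- places N | `[< S p >]].
pose y : GL2 Af := (\big[*%g/1%g]_(q <- s) gat (cmp q x))%g.
have us : uniq s by rewrite filter_uniq // places_uniq.
have Vy : V y.
  rewrite /y big_seq; apply: (@big_ind _ V) => // q; rewrite mem_filter => /andP[/asboolP Sq _].
  by have [] := hD q _ Sq (xD q Sq).
pose z := (y^-1 * x)%g.
have Hz : H z by apply/HM/Hx/HV/VH.
have xyz : x = (y * z)%g by rewrite /z mulVKg.
have zc p : cmp p z = if p \in s then 1%g else cmp p x.
  rewrite /z cmpM cmpV cmp_prod //; case: ifP => _; first by rewrite mulVg.
  by rewrite invg1 mul1g.
have zZ p : GL2_Z p (cmp p z).
  rewrite zc; case: ifP => _; first exact: GL2_Z1.
  have [Sp|nSp] := pselect (S p); first by have [] := hD p _ Sp (xD p Sp).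
  by rewrite x1 //; exact: GL2_Z1.
have z1 (p : place) : (p %| N)%N -> cmp p z = 1%g.
  move=> pN; rewrite zc mem_filter mem_places_dvd // pN andbT.
  by case: asboolP => // nSp; exact: x1.
rewrite xyz; apply: VM => //; rewrite VE; split=> //.
apply: hN; exists z; last by rewrite mul1g.
split=> [i j|i j].
  split=> p; have [h1 h2] := zZ p i j.
    by move: h1; rewrite cmpE mxE.
  by move: h2; rewrite -cmpV cmpE mxE.
apply: adele_eq_natmul => // p; rewrite rmorphB /=.
  move=> /z1 e; have := congr1 (fun g : GL2 (Qp p) => (g : 'M_2) i j) e.
  rewrite cmpE mxE => ->; rewrite !gl_oneE !mxE rmorph_nat subrr //.
apply: qp_intB; first by have [h1 _] := zZ p i j; move: h1; rewrite cmpE mxE.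
by rewrite mxE rmorph_nat; exact: qp_int_nat.
Qed.

(** * CM divisors *)

Section LinearExtension.
Context (T : choiceType) (V : zmodType).

Lemma fct_ev_sum (W : zmodType) (X : Type) (I : Type) (s : seq I) (f : I -> X -> W) (c : I -> int) x :
  (\sum_(i <- s) f i *~ c i) x = \sum_(i <- s) f i x *~ c i.
Proof.
pose ev (g : X -> W) := g x.
have evz : zmod_morphism ev by [].
pose evA : {additive (X -> W) -> W} := HB.pack ev (GRing.isZmodMorphism.Build _ _ ev evz).
rewrite -[LHS]/(evA _) raddf_sum; apply: eq_bigr => i _; exact: raddfMz.
Qed.

(** The points t i may coincide: the sum is first regrouped over the distinct values, then the two
    summations are exchanged. *)
Lemma lin_ext_sum (F : T -> V) (I : eqType) (s : seq I) (t : I -> T) (c : I -> int) :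
  lin_ext F (\sum_(i <- s) ch (t i) *~ c i) = \sum_(i <- s) F (t i) *~ c i.
Proof.
rewrite /lin_ext; pose r := undup (map t s).
have evE x : (\sum_(i <- s) ch (t i) *~ c i) x = \sum_(i <- s) (if x == t i then c i else 0).
  rewrite fct_ev_sum; apply: eq_bigr => i _; rewrite /ch.
  by case: eqVneq => [->|/eqP ne]; [rewrite asboolT // intz|rewrite asboolF // mul0rz].
rewrite (@fsbigE _ _ _ _ _ r) ?undup_uniq //; last first.
  move=> x _; rewrite mem_undup => nx; rewrite evE big1_seq ?mulr0z // => i /= is_.
  by case: eqP => // xt; case/negP: nx; rewrite xt; exact: map_f.
rewrite (eq_bigl xpredT) => [|x]; last exact: in_setT.
transitivity (\sum_(x <- r) \sum_(i <- s) (if x == t i then F (t i) *~ c i else 0)).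
  apply: eq_bigr => x _; rewrite evE (big_morph (fun m => F x *~ m) (id1 := 0) (op1 := +%R)) //.
    by apply: eq_bigr => i _; case: eqP => [->|_]; rewrite ?mulr0z.
  by move=> m n; rewrite mulrzDr.
rewrite exchange_big /= big_seq [RHS]big_seq; apply: eq_bigr => i is_.
have tr : t i \in r by rewrite mem_undup map_f.
rewrite (bigD1_seq (t i)) ?undup_uniq //= eqxx big1 ?addr0 // => x /negPf xt.
by rewrite xt.
Qed.
End LinearExtension.

Lemma invmx_eq (A : comUnitRingType) n (M N : 'M[A]_n) : M *m N = 1%:M -> invmx M = N.
Proof. by move=> e; have [uM _] := mulmx1_unit e; rewrite -[RHS](mulKmx uM) e mulmx1. Qed.

Lemma invmx_mul2 (A : comUnitRingType) n (M N : 'M[A]_n) : M \in unitmx -> N \in unitmx ->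
  invmx (M *m N) = invmx N *m invmx M.
Proof. by move=> uM uN; apply: invmx_eq; rewrite mulmxA mulmxK // mulmxV. Qed.

Section TorusGroup.
Context (E : fieldExtType rat) (w : 2.-tuple E) (hw : basis_of {: E} w).
Let hA := af_qalg.

Lemma H_Af_subgroup : is_subgroup (H_Af w).
Proof.
split.
- by exists (vecE w Af 1); rewrite (iota1 hw hA).
- move=> g h [u gE] [v hE]; exists (tmul w u v).
  by rewrite gl_mulE gE hE (iota_tmul hw hA).
- move=> g [u gE]; exists (invmx (iota w u) *m vecE w Af 1).
  by rewrite gl_invE gE -(iota_inv hw hA) // -gE gl_unit.
Qed.

Lemma H_Af_comm g h : H_Af w g -> H_Af w h -> (g * h = h * g)%g.
Proof. by move=> [u gE] [v hE]; apply: gl_inj; rewrite !gl_mulE gE hE (iota_comm hw hA). Qed.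

Lemma H_Q_sub : H_Q w `<=` H_Af w.
Proof. by move=> g [x _ gE]; exists (vecE w Af x). Qed.

Lemma H_QP g : H_Q w g <-> exists2 x, x != 0 & (g : 'M_2) = map_mx (qratr_of hA) (mulE w x).
Proof. by split=> -[x x0 gE]; exists x => //; rewrite gE (iota_vecE hw hA). Qed.

Lemma H_Q_subgroup : is_subgroup (H_Q w).
Proof.
split.
- by apply/H_QP; exists 1; rewrite ?oner_neq0 // mulE1 // map_mx1.
- move=> g h /H_QP[x x0 gE] /H_QP[y y0 hE]; apply/H_QP; exists (x * y); first exact: mulf_neq0.
  by rewrite gl_mulE gE hE mulEM // map_mxM.
- move=> g /H_QP[x x0 gE]; apply/H_QP; exists x^-1; first by rewrite invr_eq0.
  have e : (g : 'M_2) *m map_mx (qratr_of hA) (mulE w x^-1) = 1%:M.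
    by rewrite gE -map_mxM -mulEM // divff // mulE1 // map_mx1.
  by rewrite gl_invE -[RHS](mulKmx (gl_unit g)) e mulmx1.
Qed.

Lemma map_iota p v : map_mx (afc p) (iota w v) = iota w (map_mx (afc p) v).
Proof.
rewrite /Defs.iota map_mx_sum; apply: eq_bigr => k _; apply/matrixP => i j.
by rewrite !mxE -[LHS]/(afc p (v k 0) * afc p (ratr _)) afc_ratr.
Qed.

Lemma H_Af_gat p (g : GL2 (Qp p)) u : (g : 'M_2) = iota w u -> H_Af w (gat g).
Proof.
move=> gE; exists (\col_i adele_at (u i 0) (vecE w Af 1 i 0)); apply: afmx_eqP => q.
rewrite -cmpE map_iota; case: (eqVneq q p) => [->|qp].
  rewrite cmp_at gE; congr (iota w _); apply/matrixP => i j.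
  by rewrite (ord1 j) !mxE afc_at.
rewrite cmp_at_neq // -[LHS](iota1 hw (qp_qalg q)); congr (iota w _); apply/matrixP => i j.
by rewrite !mxE afc_at_neq // afc_ratr.
Qed.

Lemma H_Af_awy S g : H_Af w g -> H_Af w (awy S g).
Proof.
move=> [v gE]; exists (\col_i adele_glue S (vecE w Af 1 i 0) (v i 0)); apply: afmx_eqP => q.
rewrite -cmpE map_iota cmp_awy.
have -> : map_mx (afc q) (\col_i adele_glue S (vecE w Af 1 i 0) (v i 0)) =
    if q \in S then vecE w (Qp q) 1 else map_mx (afc q) v.
  apply/matrixP => i j; rewrite (ord1 j) !mxE /afc /=.
  case: ifP => _; rewrite !mxE //; exact: afc_ratr.
case: ifP => _; first by rewrite (iota1 hw (qp_qalg q)).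
by rewrite cmpE gE map_iota.
Qed.
End TorusGroup.

(** * CM points and the stabilizer of h_0 *)

Section Points.
Context (R : realType) (E : fieldExtType rat) (emb : {rmorphism E -> R[i]}).
Context (w : 2.-tuple E) (hw : basis_of {: E} w) (hE : imaginary_quadratic emb).
Context (K : set (GL2 Af)) (hK : is_subgroup K).
Local Notation h0 := (h_0 emb w).

Lemma real_qalg : qalg R.
Proof. by move=> n; rewrite unitfE pnatr_eq0. Qed.
Let hR := real_qalg.

(** The matrix of the identification of E (x) R with C, in the bases w and (1, i); h_0 is then
    multiplication by [invmx B *m cz z]. *)
Let B : 'M[R]_2 := \matrix_(i, j) if i == 0 then complex.Re (emb w`_j) else complex.Im (emb w`_j).
Let cz (z : R[i]) : 'cV[R]_2 := \col_i if i == 0 then complex.Re z else complex.Im z.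

Let cz_inj z z' : cz z = cz z' -> z = z'.
Proof.
move=> e; case: z z' e => [a b] [c d] e.
have /matrixP/(_ 0 0) := e; rewrite !mxE /= => ->.
by have /matrixP/(_ 1 0) := e; rewrite !mxE /= => ->.
Qed.

Let B_cz v : B *m v = cz (\sum_k (v k 0)%:C%C * emb w`_k).
Proof.
rewrite big_ord_recl big_ord1 /=.
have -> : lift ord0 ord0 = 1 :> 'I_2 by exact/val_inj.
apply: cv2P; rewrite mulmx2E !mxE /=; case: (emb _) => a b; case: (emb _) => c d /=; ring.
Qed.

Let emb_ratr (a : rat) x : emb (a *: x) = (ratr a : R)%:C%C * emb x.
Proof.
rewrite rmorphZ_num; congr (_ * _); exact: (esym (fmorph_rat (real_complex R) a)).
Qed.

Let B_vecE x : B *m vecE w R x = cz (emb x).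
Proof.
rewrite B_cz; congr cz; rewrite [in RHS](coordK hw x) rmorph_sum; apply: eq_bigr => k _.
by rewrite mxE /= emb_ratr.
Qed.

Let B_unit : B \in unitmx.
Proof.
have [_ [x ix]] := hE; rewrite unitmxE unitfE; apply/eqP => d0.
(* The columns of Q are the coordinates of 1 and x, so B Q has determinant the imaginary part of
   x. *)
pose Q : 'M[R]_2 := \matrix_(i, j) if j == 0 then vecE w R 1 i 0 else vecE w R x i 0.
have : \det (B *m Q) = complex.Im (emb x).
  rewrite det2.
  have e0 i : (B *m Q) i 0 = cz (emb 1) i 0.
    by rewrite -B_vecE !mulmx2E ![Q _ 0]mxE.
  have e1 i : (B *m Q) i 1 = cz (emb x) i 0.
    by rewrite -B_vecE !mulmx2E ![Q _ 1]mxE.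
  by rewrite !e0 !e1 !mxE /= rmorph1 /= mul1r mulr0 subr0.
by rewrite det_mulmx d0 mul0r => e; rewrite -e eqxx in ix.
Qed.

Let h0E z : h0 z = iota w (invmx B *m cz z).
Proof.
rewrite /h_0; congr (iota w _); case: xgetP => [v _ -> /=|/(_ (invmx B *m cz z))].
  by rewrite -B_cz mulKmx // B_unit.
by case; apply: cz_inj; rewrite -B_cz mulKVmx // B_unit.
Qed.

Let h0_emb x : h0 (emb x) = map_mx (qratr_of hR) (mulE w x).
Proof. by rewrite h0E -B_vecE mulKmx ?B_unit // (iota_vecE hw hR). Qed.

Lemma h0_X_std : X_std h0.
Proof.
(* Multiplication by a + bi on real and imaginary parts is the transpose of [h_std]; the reflection
   J conjugates one into the other. *)
pose J : 'M[R]_2 := mx22 1 0 0 (-1).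
have JJ : J *m J = 1%:M.
  by apply: mx2P; rewrite mulmx2E !mxE /=; ring.
have uJ : J \in unitmx by have [] := mulmx1_unit JJ.
have ug : invmx B *m J \in unitmx by rewrite unitmx_mul unitmx_inv B_unit.
exists (MkGL2 ug) => //=; apply: funext => z; rewrite h0E; set v := _ *m cz z.
have key : B *m iota w v = J *m h_std z *m J *m B.
  apply/matrixP => i j.
  have -> : (B *m iota w v) i j = (B *m tmul w v (vecE w R w`_j)) i 0.
    by rewrite tmulE (vecE_w hw hR) mulmxA -colE [RHS]mxE.
  have zE : z = \sum_k (v k 0)%:C%C * emb w`_k.
    by apply: cz_inj; rewrite -B_cz /v mulKVmx // B_unit.
  have -> : B *m tmul w v (vecE w R w`_j) = cz (z * emb w`_j).
    rewrite {1}(cv_decomp hw hR v) tmulE iota_sum mulmx_suml mulmx_sumr.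
    have -> : z * emb w`_j = \sum_k ((v k 0)%:C%C * emb (w`_k * w`_j)).
      by rewrite {1}zE mulr_suml; apply: eq_bigr => k _; rewrite rmorphM mulrA.
    have czs : forall f : 'I_2 -> R[i], cz (\sum_k f k) = \sum_k cz (f k).
      move=> f; rewrite !big_ord_recl !big_ord0 !addr0.
      by case: (f _) => a b; case: (f _) => c d; apply: cv2P; rewrite !mxE.
    rewrite czs; apply: eq_bigr => k _.
    rewrite iotaZ -scalemxAl -scalemxAr -tmulE (tmul_vecE hw hR) B_vecE.
    by case: (emb _) => a b; apply: cv2P; rewrite !mxE /=; ring.
  rewrite !mulmx2E ![B _ j]mxE /= ![J _ _]mxE ![h_std _ _ _]mxE [cz _ _ _]mxE.
  case: (z) => a b; case: (emb _) => c d; case: (ord2P i) => -> /=; ring.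
rewrite invmx_mul2 ?unitmx_inv ?B_unit // invmxK (invmx_eq JJ).
by rewrite -[RHS](mulKmx B_unit) key !mulmxA.
Qed.

Let pt_sub g g' c k : H_Q w c -> K k -> g' = (c * g * k)%g -> pt K h0 g' `<=` pt K h0 g.
Proof.
move=> /(H_QP hw)[x x0 cE] Kk g'E [y1 y2] [c' [k' Kk' [/= y1E y2E]]].
have [_ KM _] := hK; have um := mulE_unit hw x0.
have uc : (c' : 'M_2) *m mulE w x \in unitmx by rewrite unitmx_mul gl_unit.
exists (MkGL2 uc), (k * k')%g; first exact: KM.
split=> /=; last first.
  rewrite y2E g'E !gl_mulE cE -[map_mx ratr c']/(map_mx (qratr_of af_qalg) c').
  by rewrite -[map_mx ratr _ in RHS]/(map_mx (qratr_of af_qalg) (c' *m mulE w x)) map_mxM !mulmxA.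
rewrite y1E; apply: funext => z.
rewrite -![map_mx ratr _]/(map_mx (qratr_of hR) _) map_mxM.
have uC : map_mx (qratr_of hR) c' \in unitmx.
  by rewrite unitmxE det_map_mx rmorph_unit // -unitmxE gl_unit.
have uX : map_mx (qratr_of hR) (mulE w x) \in unitmx.
  by rewrite unitmxE det_map_mx rmorph_unit // -unitmxE.
rewrite invmx_mul2 // !mulmxA; congr (_ *m _); rewrite -!mulmxA; congr (_ *m _).
by rewrite mulmxA -(iota_vecE hw hR) h0E (iota_comm hw hR) -h0E (iota_vecE hw hR) mulmxK.
Qed.

Definition pt_rel (g g' : GL2 Af) : Prop := exists c k, [/\ H_Q w c, K k & g' = (c * g * k)%g].

Lemma pt_rel_sym g g' : pt_rel g g' -> pt_rel g' g.
Proof.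
have [_ _ QV] := H_Q_subgroup hw; have [_ _ KV] := hK.
move=> [c [k [Qc Kk ->]]]; exists (c^-1)%g, (k^-1)%g; split; [exact: QV|exact: KV|].
by rewrite -mulgA mulgK mulKg.
Qed.

(** A rational matrix fixing h_0 commutes with h_0(E^* ), which generates E inside M_2(Q), so
    [mulE_centralizer] makes it an element of E^*. The identification of [h_0, g] and [h_0, g'] is
    therefore only by E^* and K. *)
Lemma pt_eqP g g' : pt K h0 g = pt K h0 g' <-> pt_rel g g'.
Proof.
have [K1 KM KV] := hK; split=> [e|h]; last first.
  apply/seteqP; split.
    by have [c [k [Qc Kk gE]]] := pt_rel_sym h; exact: (pt_sub Qc Kk gE).
  by have [c [k [Qc Kk gE]]] := h; exact: (pt_sub Qc Kk gE).
have : pt K h0 g' (h0, g').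
  have r1 (T : comUnitRingType) (hT : qalg T) : map_mx (@ratr T) (1%:M : 'M_2) = 1%:M.
    exact: (map_mx1 (qratr_of hT)).
  exists 1%g; exists 1%g; first exact: K1.
  split => /=; first by rewrite (r1 _ hR); apply: funext => z; rewrite mul1mx invmx1 mulmx1.
  by rewrite (r1 _ af_qalg) mul1mx mulmx1.
rewrite -e => -[c [k Kk [/= h0c g'E]]].
have uC : map_mx (qratr_of hR) c \in unitmx.
  by rewrite unitmxE det_map_mx rmorph_unit // -unitmxE gl_unit.
have [j|x cE] := @mulE_centralizer _ _ hw (c : 'M_2).
  have := congr1 (fun f => f (emb w`_j) *m map_mx (qratr_of hR) c) h0c.
  rewrite /= mulmxKV // h0_emb -!map_mxM => ec.
  apply/matrixP => i i'; have /matrixP/(_ i i') := ec.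
  by rewrite [LHS]mxE [RHS]mxE => /(fmorph_inj (qratr_of hR)) ->.
have x0 : x != 0.
  apply/eqP => x0; have := gl_unit c; rewrite cE x0 raddf0 unitmxE det0 unitr0 //.
have uc : map_mx (qratr_of af_qalg) c \in unitmx.
  by rewrite unitmxE det_map_mx rmorph_unit // -unitmxE gl_unit.
exists (MkGL2 uc), k; split=> //; last by apply: gl_inj; rewrite g'E.
by apply/(H_QP hw); exists x => //=; rewrite cE.
Qed.
End Points.

HB.lock Definition cmdiv (R : realType) (E : fieldExtType rat) (emb : {rmorphism E -> R[i]})
  (w : 2.-tuple E) (K : set (GL2 Af)) (g : GL2 Af) := ch (pt K (h_0 emb w) g).

Lemma lcos_eqP (G : groupType) (K : set G) (g h : G) : is_subgroup K ->
  lcos K g = lcos K h <-> K (g^-1 * h)%g.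
Proof.
move=> [K1 KM KV]; split=> [e|Kgh].
  have : lcos K h h by exists 1%g; rewrite ?mulg1.
  by rewrite -e => -[k Kk <-]; rewrite mulKg.
apply/seteqP; split=> _ [k Kk <-].
  exists ((g^-1 * h)^-1 * k)%g; first exact/KM/Kk/KV.
  by rewrite invgM invgK !mulgA mulgV mul1g.
by exists (g^-1 * h * k)%g; [exact: KM|rewrite !mulgA mulgV mul1g].
Qed.

Lemma xget_lcos (G : groupType) (K : set G) (g : G) : is_subgroup K ->
  exists2 k, K k & xget 1%g (lcos K g) = (g * k)%g.
Proof.
move=> [K1 _ _]; case: xgetP => [x _ [k Kk <-]|/(_ g)]; first by exists k.
by case; exists 1%g; rewrite ?mulg1.
Qed.

Lemma fct_mulrn_inj (X : Type) (f g : X -> int) n : (0 < n)%N -> f *+ n = g *+ n -> f = g.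
Proof.
move=> n0 e; apply: funext => x; have ev (h : X -> int) : (h *+ n) x = h x *+ n.
  by elim: n {n0 e} => // n IH; rewrite !mulrS -IH.
by have := congr1 (fun h => h x) e; rewrite !ev => /eqP; rewrite eqrMn2r; case: n n0 {e ev} => //= n _ /eqP.
Qed.

(** * Translations and Hecke operators on sums of CM points *)

Section DivisorSums.
Context (R : realType) (E : fieldExtType rat) (emb : {rmorphism E -> R[i]}).
Context (w : 2.-tuple E) (hw : basis_of {: E} w) (hE : imaginary_quadratic emb).
Context (K : set (GL2 Af)) (hK : is_subgroup K).
Local Notation h0 := (h_0 emb w).
Local Notation D := (cmdiv emb w K).
Implicit Types (I : eqType).

Lemma cmdiv_eq g g' : pt_rel w K g g' -> D g = D g'.
Proof. by move=> /(pt_eqP hw hE hK) e; rewrite cmdiv.unlock e. Qed.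

Lemma cmdivMr g k : K k -> D (g * k)%g = D g.
Proof.
move=> Kk; apply/esym/cmdiv_eq; exists 1%g, k; split=> //; last by rewrite mul1g.
by case: (H_Q_subgroup hw).
Qed.
Lemma cmdivMl g c : H_Q w c -> D (c * g)%g = D g.
Proof.
move=> Qc; apply/esym/cmdiv_eq; exists c, 1%g; split=> //; last by rewrite mulg1.
by case: hK.
Qed.

Lemma rep_pt g : exists c k, [/\ H_Q w c, K k & rep emb w K (pt K h0 g) = (c * g * k)%g].
Proof.
rewrite /rep; case: xgetP => [g' _ /= e|/(_ g)]; last by case.
by have /(pt_eqP hw hE hK) := esym e.
Qed.

(** The representative picked by [rep] differs from t i by E^* on the left and K on the right; the
    first factor commutes with h. *)
Lemma act_sum I (s : seq I) (t : I -> GL2 Af) (c : I -> int) h : H_Af w h ->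
  act emb w K h (\sum_(i <- s) D (t i) *~ c i) = \sum_(i <- s) D (h * t i)%g *~ c i.
Proof.
move=> Hh; rewrite [in LHS]cmdiv.unlock /act lin_ext_sum; apply: eq_bigr => i _; congr (_ *~ _).
have [q [k [Qq Kk ->]]] := rep_pt (t i).
have -> : (h * (q * t i * k) = q * (h * t i) * k)%g.
  by rewrite !mulgA (H_Af_comm hw Hh (H_Q_sub Qq)).
rewrite -[ch _]/(ch (pt K h0 (q * (h * t i) * k)%g)).
have -> : ch (pt K h0 (q * (h * t i) * k)%g) = D (q * (h * t i) * k)%g by rewrite cmdiv.unlock.
by rewrite cmdivMr // cmdivMl.
Qed.

Lemma psi_cls_sum I (s : seq I) (t : I -> GL2 Af) (c : I -> int) (m : nat) :
  psi emb w K (cls w (\sum_(i <- s) ch (lcos K (t i)) *~ c i) *~ m%:Z) =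
  \sum_(i <- s) D (t i) *~ (c i * m%:Z).
Proof.
rewrite /cls lin_ext_sum (big_morph (fun f => f *~ m%:Z) (id1 := 0) (op1 := +%R)) ?mul0rz //; last first.
  by move=> f f'; rewrite mulrzDl.
under eq_bigr do rewrite -mulrzA.
rewrite /psi lin_ext_sum; apply: eq_bigr => i _; congr (_ *~ _).
have [q [k [Qq Kk ->]]] : exists q k, [/\ H_Q w q, K k &
    xget 1%g (setmulg (H_Q w) (lcos K (t i))) = (q * t i * k)%g].
  case: xgetP => [x _ [q Qq [_ [k Kk <-] <-]]|/(_ (t i))].
    by exists q, k; split=> //; rewrite mulgA.
  have [Q1 _ _] := H_Q_subgroup hw; have [K1 _ _] := hK.
  by case; exists 1%g => //; exists (t i); [exists 1%g; rewrite ?mulg1|rewrite mul1g].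
have -> : ch (pt K h0 (q * t i * k)%g) = D (q * t i * k)%g by rewrite cmdiv.unlock.
by rewrite cmdivMr // cmdivMl.
Qed.

Section Hecke.
Context (x : GL2 Af) (r : nat) (gam : 'I_r -> GL2 Af).
Hypotheses (gam_dbl : forall j, dbl K x (gam j))
  (gam_ex : forall y, dbl K x y -> exists j, K ((gam j)^-1 * y)%g)
  (gam_inj : forall i j, K ((gam i)^-1 * gam j)%g -> i = j).

Lemma dbl_mull k y : K k -> dbl K x y -> dbl K x (k * y)%g.
Proof.
have [K1 KM KV] := hK => Kk [_ [a Ka [_ -> <-]] [b Kb <-]].
exists (k * a * x)%g; last by exists b; rewrite ?mulgA.
by exists (k * a)%g; [exact: KM|exists x].
Qed.

(** Left multiplication by k permutes the left cosets of K in the double coset. So the Hecke sum is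
    unchanged when the representative g is replaced by g k. *)
Lemma Hecke_rep_sum g k : K k -> \sum_j D (g * k * gam j)%g = \sum_j D (g * gam j)%g.
Proof.
move=> Kk; have [K1 KM KV] := hK.
have h j : exists j', K ((gam j')^-1 * (k * gam j))%g by apply/gam_ex/dbl_mull/gam_dbl.
have [f fE] := choice h.
have f_inj : injective f.
  move=> i j e; apply: gam_inj; have := KM _ _ (KV _ (fE i)) (fE j).
  by rewrite e !invgM invgK -!mulgA mulKVg mulKg.
rewrite [RHS](reindex_inj f_inj) /=; apply: eq_bigr => j _.
have -> : (g * k * gam j = g * gam (f j) * ((gam (f j))^-1 * (k * gam j)))%g.
  by rewrite -!mulgA mulKVg.
by rewrite cmdivMr.
Qed.

Lemma Hecke_sum I (s : seq I) (t : I -> GL2 Af) (c : I -> int) :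
  Hecke emb w K x (\sum_(i <- s) D (t i) *~ c i) =
  \sum_(i <- s) (\sum_j D (t i * gam j)%g) *~ c i.
Proof.
rewrite [in LHS]cmdiv.unlock /Hecke lin_ext_sum; apply: eq_bigr => i _; congr (_ *~ _).
have [q [k [Qq Kk ->]]] := rep_pt (t i).
rewrite (reindex_fsbig (fun j => lcos K (gam j)) [set: 'I_r]); last first.
  split.
  - by move=> j _ /=; exists (gam j).
  - by move=> j j' _ _ /(lcos_eqP _ _ hK)/gam_inj.
  - move=> _ [y dy <-]; have [j hj] := gam_ex dy; exists j => //.
    exact/(lcos_eqP _ _ hK).
rewrite -(Hecke_rep_sum (t i) Kk).
have e j : ch (pt K h0 (q * t i * k * xget 1%g (lcos K (gam j)))%g) = D (t i * k * gam j)%g.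
  have [k' Kk' ->] := xget_lcos (gam j) hK.
  have -> : (q * t i * k * (gam j * k') = q * (t i * k * gam j) * k')%g by rewrite !mulgA.
  rewrite -(cmdivMl (t i * k * gam j)%g Qq) -(cmdivMr (q * (t i * k * gam j))%g Kk').
  by rewrite cmdiv.unlock.
rewrite (@fsbigE _ _ _ _ _ (index_enum 'I_r)) ?index_enum_uniq //; last first.
  by move=> j _; rewrite mem_index_enum.
by apply: eq_big => j; [exact: in_setT|move=> _; exact: e].
Qed.
End Hecke.

Lemma Div_sum I (s : seq I) (t : I -> GL2 Af) (c : I -> int) :
  Div emb w K (\sum_(i <- s) D (t i) *~ c i).
Proof.
have supp x : (\sum_(i <- s) D (t i) *~ c i) x != 0 -> exists i, i \in s /\ x = pt K h0 (t i).
  rewrite fct_ev_sum => nz; apply: contrapT => h; case/negP: nz.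
  rewrite big1_seq // => i /= is_; rewrite cmdiv.unlock /ch asboolF ?mul0rz // => xE.
  by apply: h; exists i.
split.
  apply: (@sub_finite_set _ _ [set` [seq pt K h0 (t i) | i <- s]]) => // x /supp[i [is_ ->]] /=.
  exact: map_f.
move=> x /supp[i [_ ->]]; split; last by exists (t i).
by exists h0, (t i); split=> //; exact: h0_X_std.
Qed.

Section GaloisAction.
Context (art : GL2 Af -> R[i] -> R[i]).
Hypotheses (artM : forall g h, H_Af w g -> H_Af w h -> art (g * h)%g = art g \o art h)
  (artK : forall h, H_Af w h -> (art h = id <-> H_Q w h)).

Lemma gal_act_sum I (s : seq I) (t : I -> GL2 Af) (c : I -> int) h : H_Af w h ->
  gal_act emb w K art (art h) (\sum_(i <- s) D (t i) *~ c i) =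
  \sum_(i <- s) D (h * t i)%g *~ c i.
Proof.
move=> Hh; rewrite /gal_act; have [A1 AM AV] := H_Af_subgroup hw.
case: xgetP => [h' _ [Hh' e]|/(_ h)]; last by case.
rewrite act_sum //; apply: eq_bigr => i _; congr (_ *~ _).
have Qh : H_Q w (h' * h^-1)%g.
  apply/artK; first exact/AM/AV.
  have art1 : art 1%g = id by apply/(artK A1); case: (H_Q_subgroup hw).
  by rewrite artM // ?e -?artM ?mulgV //; exact: AV.
by rewrite -(cmdivMl (h * t i)%g Qh) -mulgA mulKg.
Qed.
End GaloisAction.
End DivisorSums.

Lemma fsbig_mulD1 (T : choiceType) (A : set T) (l : T) (F : T -> int) : A l ->
  finite_set [set p | A p /\ F p != 1] ->
  \big[*%R/1]_(p \in A) F p = F l * \big[*%R/1]_(p \in A `\ l) F p.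
Proof.
move=> Al finF; pose B := [set p | A p /\ F p != 1] `|` [set l].
have finB : finite_set B by rewrite finite_setU.
have BA : B `<=` A by move=> p [[]|->].
rewrite -(@fsbig_widen _ _ _ _ B A) //; last first.
  by move=> p [Ap nBp] /=; apply/eqP; apply: contrapT => /negP Fp; apply: nBp; left.
rewrite (@fsbigD1 _ _ _ _ l) //; last by right.
congr (_ * _); apply: fsbig_widen => [p [Bp pl]|p [[Ap pl] nB]].
  by split=> //; exact: BA.
apply/eqP; apply: contrapT => /negP Fp; apply: nB; split=> //; by left.
Qed.

(** * Components away from a set of places *)

Lemma setI_subgroup (G : groupType) (A B : set G) : is_subgroup A -> is_subgroup B ->
  is_subgroup (A `&` B).
Proof.
move=> [A1 AM AV] [B1 BM BV]; split=> [|g h [? ?] [? ?]|g [? ?]]; split=> //.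
- exact: AM.
- exact: BM.
- exact: AV.
- exact: BV.
Qed.

Lemma trivial_at_subgroup S : is_subgroup (trivial_at S).
Proof.
split=> [l _|g h hg hh l Sl|g hg l Sl]; rewrite gl_comp_cmp.
- exact: cmp1.
- by rewrite cmpM -!gl_comp_cmp hg // hh // mulg1.
- by rewrite cmpV -gl_comp_cmp hg // invg1.
Qed.

Lemma awy_trivial S g : trivial_at S (awy S g).
Proof. by move=> l Sl; rewrite gl_comp_cmp cmp_awy mem_set. Qed.

Lemma awyM S g h : awy S (g * h)%g = (awy S g * awy S h)%g.
Proof.
by apply: gl_eqP => p; rewrite cmpM !cmp_awy; case: ifP => _; rewrite ?mulg1 ?cmpM.
Qed.
Lemma awy_eq S g h : (forall p, ~ S p -> cmp p g = cmp p h) -> awy S g = awy S h.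
Proof.
move=> e; apply: gl_eqP => p; rewrite !cmp_awy; case: ifP => // /negP nS.
by apply: e => Sp; apply: nS; exact: mem_set.
Qed.

(** The quotient of [awy S g] by g is supported at S with components in the [D p]. When S is
    infinite this is not a finite product of local elements, and the openness of V is needed. *)
Lemma unramified_awy (H V : set (GL2 Af)) (S : set place) (D : forall p, set (GL2 (Qp p))) g :
  is_subgroup H -> is_subgroup V -> (exists2 O, open O & V = O `&` H) ->
  (forall p, S p -> unramified_at (D p) V) -> (forall p d, S p -> D p d -> GL2_Z p d) ->
  (forall p, S p -> is_subgroup (D p)) ->
  H (awy S g) -> V g -> V (awy S g).
Proof.
move=> hH hV hO unr DZ hD Ha Vg; have [H1 HM HV] := hH; have [V1 VM VV] := hV.
have VH x : V x -> H x by have [O _ VE] := hO; rewrite VE => -[].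
suff Vx : V (awy S g * g^-1)%g by rewrite -(mulgVK g (awy S g)); exact: VM.
apply: (open_restricted_product (D := D) (S := S) hH hV hO).
- by move=> p d Sp Dd; split; [exact: unramified_gat (unr p Sp) V1 Dd|exact: DZ].
- exact/HM/HV/VH.
- move=> p Sp; rewrite cmpM cmpV cmp_awy mem_set // mul1g.
  by have [_ _ DV] := hD p Sp; apply: DV; exact: unramified_cmp (unr p Sp) Vg.
- move=> p nSp; rewrite cmpM cmpV cmp_awy ifF ?mulgV //.
  by apply: negbTE; apply/negP => /set_mem.
Qed.

(** * The functions zeta_n *)

Section Zeta.
Context (E : fieldExtType rat) (w : 2.-tuple E) (K : set (GL2 Af)).
Hypotheses (hK : is_subgroup K) (oK : exists2 O, open O & K = O `&` setT).
Context (lam : place -> set E) (zetaR : set (GL2 Af) -> int).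
Local Notation SR := (in_R w K).
Local Notation gl := (g_loc w lam).
Local Notation zeta n := (zeta_ w K lam zetaR n).
Local Notation KR := (away SR K).
Implicit Types (p q l : place) (g h : GL2 Af).

Lemma in_R_unr p : SR p -> unramified_at (GL2_Z p) K.
Proof. by move=> [_ _ h _]; exact: h. Qed.

Let KR_subgroup : is_subgroup KR.
Proof. exact: (setI_subgroup hK (trivial_at_subgroup _)). Qed.

Let K_cmp p k : SR p -> K k -> GL2_Z p (cmp p k).
Proof. by move=> Sp Kk; exact: (unramified_cmp (in_R_unr Sp) Kk). Qed.

Lemma K_gat p d : SR p -> GL2_Z p d -> K (gat d).
Proof. by move=> Sp Dd; have [K1 _ _] := hK; exact: (unramified_gat (in_R_unr Sp) K1 Dd). Qed.

Let setT_subgroup : is_subgroup [set: GL2 Af]. Proof. by split. Qed.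

Let KR_awy k : K k -> KR (awy SR k).
Proof.
move=> Kk; split; last exact: awy_trivial.
apply: (unramified_awy (D := GL2_Z) setT_subgroup hK oK); last exact: Kk.
- exact: in_R_unr.
- by move=> p d _ Dd; exact: Dd.
- by move=> p _; exact: GL2_Z_subgroup.
- exact: I.
Qed.

Let zR g : int := zetaR (lcos KR (awy SR g)).
Let zl n p g : int := zeta_loc w lam n (lcos (GL2_Z p) (cmp p g)).

Let lcos_cmp p g k : SR p -> K k -> lcos (GL2_Z p) (cmp p (g * k)%g) = lcos (GL2_Z p) (cmp p g).
Proof.
move=> Sp Kk; apply/esym/(lcos_eqP _ _ (GL2_Z_subgroup p)).
by rewrite cmpM mulKg; exact: K_cmp.
Qed.

Lemma zeta_lcos n g : zeta n (lcos K g) = zR g * \big[*%R/1]_(p \in SR) zl n p g.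
Proof.
rewrite /zeta_ asboolT; last by exists g.
have [k Kk ->] := xget_lcos g hK; rewrite away_part_awy; congr (_ * _).
  congr zetaR; apply/esym/(lcos_eqP _ _ KR_subgroup).
  by rewrite awyM mulKg; exact: KR_awy.
apply: eq_fsbigr => p /set_mem Sp; rewrite gl_comp_cmp; congr zeta_loc.
exact: lcos_cmp.
Qed.

Lemma zeta_out n D : ~ lcosets setT K D -> zeta n D = 0.
Proof. by move=> nD; rewrite /zeta_ asboolF. Qed.

Let in_loc p (h : GL2 (Qp p)) : int := if `[< GL2_Z p h >] then 1 else 0.

Let ch_loc p (h h' : GL2 (Qp p)) : ch (lcos (GL2_Z p) h') (lcos (GL2_Z p) h) = in_loc (h'^-1 * h)%g.
Proof.
rewrite /ch /in_loc; congr (if _ then _ else _); apply/asboolP/asboolP.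
  by move/esym/(lcos_eqP _ _ (GL2_Z_subgroup p)).
by move=> e; apply/esym/(lcos_eqP _ _ (GL2_Z_subgroup p)).
Qed.

Let lcos1_loc p : GL2_Z p = lcos (GL2_Z p) 1%g.
Proof.
by apply/seteqP; split=> [h hZ|_ [h hZ <-]]; [exists h|]; rewrite ?mul1g.
Qed.

Lemma zl_in n p g : ~~ (p %| n)%N -> zl n p g = in_loc (cmp p g).
Proof.
move=> /negPf pn; rewrite /zl /zeta_loc pn.
have -> : ch (GL2_Z p) = ch (lcos (GL2_Z p) 1%g) by rewrite -lcos1_loc.
by rewrite ch_loc invg1 mul1g.
Qed.

Lemma zl_dvd n p g : (p %| n)%N -> zl n p g = in_loc (cmp p g) - in_loc ((gl p)^-1 * cmp p g)%g.
Proof.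
move=> pn; rewrite /zl /zeta_loc pn -[LHS]/(ch _ _ - ch _ _) ch_loc.
have -> : ch (GL2_Z p) = ch (lcos (GL2_Z p) 1%g) by rewrite -lcos1_loc.
by rewrite ch_loc invg1 mul1g.
Qed.

Let zl_finite n g : (0 < n)%N -> finite_set [set p | SR p /\ zl n p g != 1].
Proof.
move=> n0; apply: (@sub_finite_set _ _ ([set p | ~ GL2_Z p (cmp p g)] `|` [set p : place | (p %| n)%N])).
  move=> p [Sp]; have [pn|pn] := boolP (p %| n)%N; first by right.
  rewrite zl_in // /in_loc; case: asboolP => //; by left.
by rewrite finite_setU; split; [exact: gl_almost_int|exact: dvd_finite].
Qed.

Let W n l g : int := zR g * \big[*%R/1]_(p \in SR `\ l) zl n p g.

Lemma zeta_split n l g : (0 < n)%N -> SR l -> zeta n (lcos K g) = W n l g * zl n l g.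
Proof.
move=> n0 Sl; rewrite zeta_lcos (fsbig_mulD1 Sl (zl_finite g n0)).
by rewrite /W -mulrA [zl n l g * _]mulrC.
Qed.

Let W_away n l g g' : SR l -> (forall p, p != l -> cmp p g = cmp p g') -> W n l g = W n l g'.
Proof.
move=> Sl e; rewrite /W /zR (@awy_eq _ g g').
  by congr (_ * _); apply: eq_fsbigr => p /set_mem[Sp /eqP pl]; rewrite /zl e.
by move=> p nSp; apply: e; apply: contra_notN nSp => /eqP->.
Qed.

Let W_mul n l g : SR l -> W (n * l)%N l g = W n l g.
Proof.
move=> Sl; rewrite /W; congr (_ * _); apply: eq_fsbigr => p /set_mem[Sp /eqP pl].
rewrite /zl /zeta_loc Euclid_dvdM ?place_prime //.
suff -> : (p %| l)%N = false by rewrite orbF.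
by rewrite dvdn_prime2 ?place_prime //; apply/negbTE; rewrite -val_eqE in pl.
Qed.

Let ev_sum (I : eqType) (s : seq I) (t : I -> GL2 Af) (c : I -> int) g :
  (\sum_(i <- s) ch (lcos K (t i)) *~ c i) (lcos K g) =
  \sum_(i <- s) if `[< K ((t i)^-1 * g)%g >] then c i else 0.
Proof.
rewrite fct_ev_sum; apply: eq_bigr => i _; rewrite /ch.
rewrite (asbool_equiv_eq (Q := K ((t i)^-1 * g)%g)).
  by case: asboolP => _; rewrite ?intz ?mul0rz.
by rewrite -lcos_eqP //; split=> ->.
Qed.

Let ev_sum_out (I : eqType) (s : seq I) (t : I -> GL2 Af) (c : I -> int) D :
  ~ lcosets setT K D -> (\sum_(i <- s) ch (lcos K (t i)) *~ c i) D = 0.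
Proof.
move=> nD; rewrite fct_ev_sum big1_seq // => i _; rewrite /ch asboolF ?mul0rz // => DE.
by apply: nD; exists (t i).
Qed.

Lemma fct_lcosP (f f' : set (GL2 Af) -> int) : (forall D, ~ lcosets setT K D -> f D = 0) ->
  (forall D, ~ lcosets setT K D -> f' D = 0) -> (forall g, f (lcos K g) = f' (lcos K g)) -> f = f'.
Proof.
move=> h h' e; apply: funext => D; have [[g _ <-]|nD] := pselect (lcosets setT K D).
  exact: e.
by rewrite h // h'.
Qed.

Definition supp_finite n : Prop := finite_set [set D | zeta n D != 0].

Definition coset_sum (s : seq (GL2 Af * int)) : set (GL2 Af) -> int :=
  \sum_(p <- s) ch (lcos K p.1) *~ p.2.

Lemma coset_sum_supp s : finite_set [set D | coset_sum s D != 0].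
Proof.
apply: (@sub_finite_set _ _ ((fun p : GL2 Af * int => lcos K p.1) @` [set` s])); last first.
  exact/finite_image/finite_seq.
move=> D /=; rewrite /coset_sum fct_ev_sum => nz; apply: contrapT => nD; case/negP: nz.
rewrite big1_seq // => p /= ps; rewrite /ch asboolF ?mul0rz // => DE.
by apply: nD; exists p.
Qed.

Let in_loc1 p : in_loc (1%g : GL2 (Qp p)) = 1.
Proof. by rewrite /in_loc asboolT //; exact: GL2_Z1. Qed.

Lemma in_locM p (u h : GL2 (Qp p)) : GL2_Z p u -> in_loc (u * h)%g = in_loc h.
Proof.
move=> Zu.
have e : `[< GL2_Z p (u * h)%g >] = `[< GL2_Z p h >].
  apply: asbool_equiv_eq; split=> Zh; last exact: (GL2_ZM Zu Zh).
  have {}Zh := GL2_ZM (GL2_ZV Zu) Zh.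
  by rewrite mulKg in Zh.
exact: (congr1 (fun b : bool => if b then 1 else 0 : int) e).
Qed.

(** On the support of zeta_1 all the components at R are integral, so gK is recovered from the part
    of g away from R. *)
Lemma supp_finite1 : finite_set [set X | zetaR X != 0] -> supp_finite 1.
Proof.
move=> finR; apply: (@sub_finite_set _ _ ((fun X => setmulg X K) @` [set X | zetaR X != 0])); last first.
  exact: finite_image.
move=> D /= nz; have [[g _ DE]|nD] := pselect (lcosets setT K D); last first.
  by rewrite zeta_out ?eqxx // in nz.
rewrite -DE in nz *; have gZ p : SR p -> GL2_Z p (cmp p g).
  move=> Sp; move: nz; rewrite (zeta_split _ (isT : 0 < 1)%N Sp) zl_in.
    by rewrite /in_loc; case: asboolP => // _; rewrite mulr0 eqxx.
  by rewrite gtnNdvd // prime_gt1 // place_prime.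
exists (lcos KR (awy SR g)).
  by move: nz; rewrite zeta_lcos mulf_eq0 negb_or => /andP[].
have Kx : K (g^-1 * awy SR g)%g.
  apply: (open_restricted_product (D := GL2_Z) (S := SR) setT_subgroup hK oK).
  - by move=> p d Sp Zd; split; [exact: K_gat|exact: Zd].
  - exact: I.
  - by move=> p Sp; rewrite cmpM cmpV cmp_awy mem_set // mulg1; exact/GL2_ZV/gZ.
  - move=> p nSp; rewrite cmpM cmpV cmp_awy ifF ?mulVg //.
    by apply: negbTE; apply/negP => /set_mem.
have [K1 KM KV] := hK; rewrite ((lcos_eqP _ _ hK).2 Kx).
apply/seteqP; split=> [_ [_ [k [Kk _] <-] [k' Kk' <-]]|_ [k Kk <-]].
  by exists (k * k')%g; [exact: KM|rewrite mulgA].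
exists (awy SR g); last by exists k.
by exists 1%g; [case: KR_subgroup|rewrite mulg1].
Qed.

(** As l does not divide n, the cosets in the support of zeta_n have representatives trivial at l.
    From n to nl only the factor at l changes, and right translation of these representatives by g_l
    turns ch(K_l) into ch(g_l K_l). *)
Lemma zeta_step n l : (0 < n)%N -> SR l -> ~~ (l %| n)%N -> supp_finite n ->
  exists s : seq (GL2 Af * int), [/\ forall z, z \in s -> cmp l z.1 = 1%g, zeta n = coset_sum s &
    zeta (n * l)%N = coset_sum s - coset_sum [seq ((z.1 * gat (gl l))%g, z.2) | z <- s]].
Proof.
move=> n0 Sl ln finA; have [K1 KM KV] := hK.
pose A := fset_set [set D | zeta n D != 0].
(* The component at l is removed; on the support it belongs to GL_2(Z_l), so the coset does not
   change. *)
pose r (C : set (GL2 Af)) : GL2 Af := let g := xget 1%g C in (g * gat (cmp l g)^-1)%g.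
have rl C : cmp l (r C) = 1%g by rewrite /r cmpM cmp_at mulgV.
have rC C : zeta n C != 0 -> lcos K (r C) = C.
  move=> nz; have [[g _ CE]|nC] := pselect (lcosets setT K C); last first.
    by rewrite zeta_out ?eqxx // in nz.
  have [k Kk xE] := xget_lcos g hK; rewrite /r -CE xE.
  have eg : lcos K (g * k)%g = lcos K g.
    by apply/esym/(lcos_eqP _ _ hK); rewrite mulKg.
  rewrite -eg; apply/esym/(lcos_eqP _ _ hK); rewrite mulKg; apply: (K_gat Sl); apply: GL2_ZV.
  move: nz; rewrite -CE -eg (zeta_split _ n0 Sl) zl_in // /in_loc.
  by case: asboolP => // _; rewrite mulr0 eqxx.
pose s := [seq (r C, zeta n C) | C <- A].
have sumE h : \sum_(z <- s) (if `[< K ((z.1)^-1 * h)%g >] then z.2 else 0) = zeta n (lcos K h).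
  rewrite big_map /=; have inA C : (C \in A) = (zeta n C != 0).
    by rewrite in_fset_set //; apply/idP/idP => [/set_mem|?]; last exact/mem_set.
  transitivity (\sum_(C <- A) if C == lcos K h then zeta n C else 0).
    rewrite big_seq [RHS]big_seq; apply: eq_bigr => C; rewrite inA => nz.
    congr (if _ then _ else _); apply/asboolP/eqP => [/(lcos_eqP _ _ hK)|CE].
      by rewrite rC.
    by apply/(lcos_eqP _ _ hK); rewrite rC.
  have [nz|] := boolP (lcos K h \in A).
    rewrite (bigD1_seq (lcos K h)) ?fset_uniq //= eqxx big1 ?addr0 // => C /negPf ->.
    by [].
  rewrite inA negbK => /eqP zE; rewrite zE big1_seq // => C /= CA.
  by case: ifP => [/eqP->|_]; [exact: zE|exact: erefl].
exists s; split.
- by move=> p /mapP[C _ ->] /=; exact: rl.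
- apply: fct_lcosP => [D nD|D nD|g].
  + exact: zeta_out.
  + exact: ev_sum_out.
  + by rewrite /coset_sum ev_sum sumE.
- apply: fct_lcosP => [D nD|D nD|g].
  + exact: zeta_out.
  + by rewrite -[LHS]/(coset_sum _ D - coset_sum _ D) /coset_sum !ev_sum_out // subrr.
  have nl0 : (0 < n * l)%N by rewrite muln_gt0 n0 prime_gt0 // place_prime.
  rewrite -[RHS]/(coset_sum _ _ - coset_sum _ _) /coset_sum !ev_sum sumE.
  rewrite (zeta_split _ nl0 Sl) (W_mul _ _ Sl) zl_dvd ?dvdn_mull // mulrBr.
  rewrite (zeta_split _ n0 Sl) zl_in //; congr (_ - _).
  rewrite big_map /=; rewrite {1}/in_loc; case: asboolP => Zk; last first.
    rewrite mulr0 big1_seq // => p /= ps; rewrite asboolF // => Kp; apply: Zk.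
    have := K_cmp Sl Kp; rewrite cmpM cmpV cmpM cmp_at.
    have -> : cmp l p.1 = 1%g by move: ps => /mapP[C _ ->]; exact: rl.
    by rewrite mul1g.
  (* Here g lies in g_l K_l at l. Replacing its component at l by 1 leaves the other factors
     unchanged and brings back zeta_n. *)
  pose g' := (g * (gat (cmp l g))^-1)%g.
  have g'l : cmp l g' = 1%g by rewrite /g' cmpM cmpV cmp_at mulgV.
  have gE : g = (g' * (gat (gl l) * gat ((gl l)^-1 * cmp l g)))%g.
    by rewrite -gatM mulVKg /g' mulgVK.
  rewrite mulr1 (W_away n Sl (g' := g')); last first.
    by move=> p pl; rewrite /g' cmpM cmpV cmp_at_neq // invg1 mulg1.
  have e1 : in_loc (cmp l g') = 1 by rewrite g'l in_loc1.
  rewrite -[LHS]mulr1 -e1 -(zl_in _ ln) -(zeta_split _ n0 Sl) -sumE.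
  rewrite big_seq [RHS]big_seq; apply: eq_bigr => p ps.
  have pl1 : cmp l p.1 = 1%g by move: ps => /mapP[C _ ->]; exact: rl.
  congr (if _ then _ else _).
  have cl : (cmp l ((p.1)^-1 * g') = 1)%g by rewrite cmpM cmpV pl1 g'l invg1 mul1g.
  have -> : ((p.1 * gat (gl l))^-1 * g = ((p.1)^-1 * g') * gat ((gl l)^-1 * cmp l g))%g.
    rewrite {1}gE invgM.
    transitivity ((gat (gl l))^-1 * ((p.1^-1 * g') * gat (gl l)) * gat ((gl l)^-1 * cmp l g))%g.
      by rewrite !mulgA.
    by rewrite -(gat_commute (gl l) cl) mulKg.
  have Kk : K (gat ((gl l)^-1 * cmp l g))%g by exact: (K_gat Sl).
  apply/asboolP/asboolP => h; first exact: KM.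
  by rewrite -(mulgK (gat ((gl l)^-1 * cmp l g)) ((p.1)^-1 * g'))%g; apply: KM => //; exact: KV.
Qed.

Lemma in_N_supp_finite n : finite_set [set X | zetaR X != 0] -> in_N w K n -> supp_finite n /\ (0 < n)%N.
Proof.
move=> finR [s [us sR ->]]; elim: s us sR => [|l s IH].
  by rewrite big_nil => _ _; split=> //; exact: supp_finite1.
rewrite /= => /andP[ls us] sR; rewrite big_cons mulnC.
have [|fin n0] := IH us; first by move=> q qs; apply: sR; rewrite inE qs orbT.
have Sl : SR l by apply: sR; rewrite mem_head.
have nl : ~~ (l %| \prod_(q <- s) q)%N.
  elim: s us ls {IH sR fin n0} => [|q s IH].
    by rewrite big_nil dvdn1 => _ _; apply/eqP => l1; have := place_prime l; rewrite l1.
  rewrite /= inE negb_or => /andP[_ us] /andP[lq ls]; rewrite big_cons Euclid_dvdM ?place_prime //.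
  rewrite negb_or IH // andbT dvdn_prime2 ?place_prime //.
split; last by rewrite muln_gt0 n0 prime_gt0 // place_prime.
have [t [_ _ zE]] := zeta_step n0 Sl nl fin; rewrite /supp_finite zE.
apply: (@sub_finite_set _ _ ([set D | coset_sum t D != 0] `|`
  [set D | coset_sum [seq ((z.1 * gat (gl l))%g, z.2) | z <- t] D != 0])).
  move=> D /=; rewrite -[X in X != 0]/(coset_sum _ D - coset_sum _ D) => nz.
  have [e|e] := eqVneq (coset_sum t D) 0; last by left.
  by right; move: nz; rewrite e sub0r oppr_eq0.
by rewrite finite_setU; split; exact: coset_sum_supp.
Qed.

(** At p dividing n, u fixes both cosets K_p and g_p K_p; at the other primes of R it fixes K_p;
    away from R the invariance is that of [zetaR]. *)
Lemma zeta_invariant n u s : zeta n = coset_sum s -> 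
  (forall g, trivial_at SR g -> zetaR (lcos KR (awy SR u * g)%g) = zetaR (lcos KR g)) ->
  (forall p, SR p -> GL2_Z p (cmp p u)) ->
  (forall p, SR p -> (p %| n)%N -> GL2_Z p ((gl p)^-1 * cmp p u * gl p)%g) ->
  coset_sum [seq ((u * z.1)%g, z.2) | z <- s] = zeta n.
Proof.
move=> zE uR uZ un; apply: fct_lcosP => [D nD|D nD|g].
- exact: ev_sum_out.
- exact: zeta_out.
have inv h : zeta n (lcos K (u * h)%g) = zeta n (lcos K h).
  rewrite !zeta_lcos /zR awyM uR; last exact: awy_trivial.
  congr (_ * _); apply: eq_fsbigr => p /set_mem Sp.
  have e : in_loc (cmp p (u * h)%g) = in_loc (cmp p h).
    exact: (eq_trans (congr1 (@in_loc p) (cmpM p u h)) (in_locM (cmp p h) (uZ p Sp))).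
  have [pn|pn] := boolP (p %| n)%N; last first.
    exact: (eq_trans (zl_in (u * h)%g pn) (eq_trans e (esym (zl_in h pn)))).
  have e' := in_locM ((gl p)^-1 * cmp p h)%g (un p Sp pn).
  have e2 : ((gl p)^-1 * cmp p (u * h) = (gl p)^-1 * cmp p u * gl p * ((gl p)^-1 * cmp p h))%g.
    by rewrite cmpM -!mulgA mulVKg.
  have e3 := eq_trans (congr1 (@in_loc p) e2) e'.
  apply: (eq_trans (zl_dvd (u * h)%g pn)); apply: (eq_trans _ (esym (zl_dvd h pn))).
  exact: (congr2 (fun a b : int => a - b) e e3).
rewrite -(mulVKg u g) inv zE /coset_sum !ev_sum big_map /=; apply: eq_bigr => p _.
by rewrite invgM -!mulgA mulKg.
Qed.
End Zeta.

(** * Local cosets *)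

Section Matrix22.
Context (F : fieldType).
Implicit Types (a b c d t : F).

Lemma mx22M a b c d a' b' c' d' : mx22 a b c d *m mx22 a' b' c' d' =
  mx22 (a * a' + b * c') (a * b' + b * d') (c * a' + d * c') (c * b' + d * d').
Proof. by apply: mx2P; rewrite !mulmx2E !mxE. Qed.
Lemma mx22_1 : mx22 1 0 0 1 = 1%:M :> 'M[F]_2.
Proof. by apply: mx2P; rewrite !mxE. Qed.
Lemma mx22_det a b c d : \det (mx22 a b c d) = a * d - b * c.
Proof. by rewrite det2 !mxE. Qed.
Lemma mx22P (M : 'M[F]_2) : M = mx22 (M 0 0) (M 0 1) (M 1 0) (M 1 1).
Proof. by apply: mx2P; rewrite !mxE. Qed.
Lemma mx22_eq a b c d a' b' c' d' : a = a' -> b = b' -> c = c' -> d = d' ->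
  mx22 a b c d = mx22 a' b' c' d'.
Proof. by move=> -> -> -> ->. Qed.

Context (t : F) (t0 : t != 0).

Lemma lowerK c : mx22 t^-1 0 (t^-1 * c) 1 *m mx22 t 0 (- c) 1 = 1%:M.
Proof. by rewrite mx22M -mx22_1; apply: mx22_eq; field. Qed.
Lemma diag1K : mx22 1 0 0 t^-1 *m mx22 1 0 0 t = 1%:M.
Proof. by rewrite mx22M -mx22_1; apply: mx22_eq; field. Qed.
Lemma diag2K : mx22 t 0 0 1 *m mx22 t^-1 0 0 1 = 1%:M.
Proof. by rewrite mx22M -mx22_1; apply: mx22_eq; field. Qed.
Lemma diag1_mul y b c d : mx22 1 0 0 t *m (mx22 (t * y) b c d *m mx22 t^-1 0 0 1) =
  mx22 y b c (t * d).
Proof. by rewrite !mx22M; apply: mx22_eq; field. Qed.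
Lemma lower_mul j z a b c d : c = a * (j + t * z) ->
  mx22 t 0 (- j) 1 *m (mx22 a b c d *m mx22 t^-1 0 0 1) = mx22 a (t * b) (a * z) (d - j * b).
Proof. by move=> ->; rewrite !mx22M; apply: mx22_eq; field. Qed.
Lemma lower_det j z a b c d : c = a * (j + t * z) ->
  a * (d - j * b) - t * b * (a * z) = a * d - b * c.
Proof. by move=> ->; ring. Qed.
Lemma lower_dbl j : mx22 t^-1 0 (t^-1 * j) 1 = mx22 1 0 j 1 *m mx22 t^-1 0 0 1.
Proof. by rewrite !mx22M; apply: mx22_eq; ring. Qed.
Lemma diag1_dbl : mx22 1 0 0 t^-1 = mx22 0 1 1 0 *m mx22 t^-1 0 0 1 *m mx22 0 1 1 0.
Proof. by rewrite !mx22M; apply: mx22_eq; ring. Qed.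
Lemma diag2_conj q s : mx22 t 0 0 1 *m mx22 1 q 0 s *m mx22 t^-1 0 0 1 = mx22 1 (t * q) 0 s.
Proof. by rewrite !mx22M; apply: mx22_eq; field. Qed.
Lemma lower1K : (mx22 1 0 t^-1 1 : 'M[F]_2) *m mx22 1 0 (- t^-1) 1 = 1%:M :> 'M[F]_2.
Proof. by rewrite mx22M -mx22_1; apply: mx22_eq; field. Qed.
Lemma diagK r s : r != 0 -> s != 0 -> mx22 r 0 0 s *m mx22 r^-1 0 0 s^-1 = 1%:M :> 'M[F]_2.
Proof. by move=> r0 s0; rewrite mx22M -mx22_1; apply: mx22_eq; field. Qed.
Lemma lower1_conj r s a b : r != 0 -> s != 0 ->
  (mx22 1 0 (- t^-1) 1 : 'M[F]_2) *m (mx22 r^-1 0 0 s^-1 *m mx22 a 0 0 b) *m mx22 1 0 t^-1 1 =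
  mx22 (a / r) 0 (t^-1 * (b / s - a / r)) (b / s).
Proof. by move=> r0 s0; rewrite !mx22M; apply: mx22_eq; field; rewrite ?t0 ?r0 ?s0 ?andbT. Qed.
Lemma diag_lower r j : mx22 (t * r) 0 0 1 *m mx22 t^-1 0 (t^-1 * j) 1 *m mx22 1 0 0 j =
  mx22 r 0 0 j *m mx22 1 0 t^-1 1.
Proof. by rewrite !mx22M; apply: mx22_eq; field. Qed.
Lemma diag_lower0 r : mx22 (t * r) 0 0 1 *m mx22 t^-1 0 (t^-1 * 0) 1 = mx22 r 0 0 1.
Proof. by rewrite !mx22M; apply: mx22_eq; field. Qed.
Lemma diag_last r : mx22 (t * r) 0 0 1 *m mx22 1 0 0 t^-1 *m mx22 r 0 0 1 *m mx22 t 0 0 t =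
  mx22 (t * r) 0 0 1 *m mx22 (t * r) 0 0 1.
Proof. by rewrite !mx22M; apply: mx22_eq; field. Qed.
Lemma split_ratio r a b q y : r != 0 -> a != 0 -> q != 0 -> r * b / a = q + t * y ->
  b / q - a / r = t * (y * a / (r * q)).
Proof.
move=> r0 a0 q0 e; have -> : b / q - a / r = (r * b / a - q) * (a / (r * q)).
  by field; rewrite ?r0 ?q0 ?a0.
by rewrite e; field; rewrite ?r0 ?q0 ?a0.
Qed.
Lemma divfBl (i j : F) : i != 0 -> j - i = (j / i - 1) * i.
Proof. by move=> i0; field. Qed.
Lemma mulf_div_unit a b r q : r != 0 -> q != 0 -> a * b = (a / r * (b / q)) * (r * q).
Proof. by move=> r0 q0; rewrite mulrACA divfK // divfK. Qed.
Lemma divf_natD (r b a m k y j : F) : r * b / a = m + t * y -> m = k * t + j ->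
  r * b / a = j + t * (y + k).
Proof. by move=> -> ->; ring. Qed.
Lemma divf_nat a c m q r y : a != 0 -> c / a = m + t * y -> m = q * t + r ->
  c = a * (r + t * (y + q)).
Proof. by move=> a0 e me; have -> : c = a * (c / a); [field|rewrite e me; ring]. Qed.
Lemma lowerB i j : t^-1 * (j - i) = - i * t^-1 + 1 * (t^-1 * j).
Proof. by ring. Qed.
End Matrix22.

Lemma gl_mulP (A : comUnitRingType) (g h : GL2 A) (M N : 'M[A]_2) :
  (g : 'M_2) = M -> (h : 'M_2) = N -> ((g * h)%g : 'M_2) = M *m N.
Proof. by move=> <- <-; exact: gl_mulE. Qed.
Lemma gl_invP (A : comUnitRingType) (g : GL2 A) (M N : 'M[A]_2) :
  (g : 'M_2) = M -> M *m N = 1%:M -> ((g^-1)%g : 'M_2) = N.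
Proof. by move=> <- e; rewrite gl_invE; exact: invmx_eq. Qed.
Lemma gl_ofP (A : comUnitRingType) (M N : 'M[A]_2) : M *m N = 1%:M -> (gl_of M : 'M_2) = M.
Proof. by move=> e; apply: gl_ofE; have [] := mulmx1_unit e. Qed.

Section LocalCosets.
Context (l : place).
Local Notation Q := (Qp l).
Local Notation lam := ((l : nat)%:R : Q).
Implicit Types (g h : GL2 Q) (i j : nat).

Let lam0 : lam != 0. Proof. exact: qp_p_neq0. Qed.

Lemma GL2_Z_mx g (a b c d : Q) : (g : 'M_2) = mx22 a b c d ->
  qp_int a -> qp_int b -> qp_int c -> qp_int d -> ~ qdvd (a * d - b * c) -> GL2_Z l g.
Proof.
move=> gE ia ib ic id_ nd.
have ig : imx (g : 'M_2).
  by rewrite gE => i j; rewrite !mxE; case: (_ == _); case: (_ == _).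
have [|_ iu] := imx_inv ig; first by rewrite gE mx22_det.
by move=> i j; split; [exact: ig|rewrite gl_invE; exact: iu].
Qed.

Lemma GL2_Z_det g : GL2_Z l g -> ~ qdvd (\det (g : 'M_2)).
Proof.
move=> gZ; have ig : imx (g : 'M_2) by move=> i j; case: (gZ i j).
have iV : imx (invmx (g : 'M_2)) by move=> i j; case: (gZ i j) => _; rewrite gl_invE.
have dV : \det (g : 'M_2) * \det (invmx (g : 'M_2)) = 1.
  by rewrite -det_mulmx mulmxV ?gl_unit // det1.
move=> dg; apply: (@qdvd1 l); rewrite -dV; apply: qdvdMl dg _; exact: imx_det.
Qed.

Lemma lam_inv_int (x : Q) : qp_int (lam^-1 * x) <-> qdvd x.
Proof.
split=> [h|[y iy ->]]; last by rewrite mulKf.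
by exists (lam^-1 * x) => //; rewrite mulVKf.
Qed.
Lemma not_int_lamV : ~ qp_int lam^-1.
Proof.
have e : lam^-1 * 1 = lam^-1 by rewrite mulr1.
by move=> h; apply: (@qdvd1 l); apply/lam_inv_int; rewrite e.
Qed.

(* The matrices in the decomposition of GL2(Z_l) diag(1/l, 1) GL2(Z_l) into left cosets;
   the indices are the points j <= l of the projective line over Z/l. *)
Definition hmx j : 'M[Q]_2 :=
  if (j < l)%N then mx22 lam^-1 0 (lam^-1 * j%:R) 1 else mx22 1 0 0 lam^-1.
Definition hmxV j : 'M[Q]_2 :=
  if (j < l)%N then mx22 lam 0 (- j%:R) 1 else mx22 1 0 0 lam.

Lemma hmxK j : hmx j *m hmxV j = 1%:M.
Proof.
by rewrite /hmx /hmxV; case: ifP => _; [exact: lowerK|exact: diag1K].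
Qed.
Definition hgl j : GL2 Q := gl_of (hmx j).
Lemma hglE j : (hgl j : 'M_2) = hmx j.
Proof. exact: (gl_ofP (hmxK j)). Qed.
Lemma hglVE j : ((hgl j)^-1%g : 'M_2) = hmxV j.
Proof. exact: (gl_invP (hglE j) (hmxK j)). Qed.

Lemma hglV_lt j : (j < l)%N -> ((hgl j)^-1%g : 'M_2) = mx22 lam 0 (- j%:R) 1.
Proof. by move=> jl; rewrite hglVE /hmxV jl. Qed.
Lemma hglV_last : ((hgl l)^-1%g : 'M_2) = mx22 1 0 0 lam.
Proof. by rewrite hglVE /hmxV ltnn. Qed.

Definition sgl : GL2 Q := gl_of (mx22 lam 0 0 1).
Lemma sglE : (sgl : 'M_2) = mx22 lam 0 0 1.
Proof. exact: (gl_ofP (diag2K lam0)). Qed.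
Lemma sglVE : ((sgl^-1)%g : 'M_2) = mx22 lam^-1 0 0 1.
Proof.
exact: (gl_invP sglE (diag2K lam0)).
Qed.

(** The coset depends only on the first column (a, c) of g modulo l, a point of the projective line:
    j = c / a, or the last index when l divides a. *)
Lemma hgl_ex g : GL2_Z l g -> exists j : 'I_l.+1, GL2_Z l ((hgl j)^-1 * (g * sgl^-1))%g.
Proof.
move=> gZ; have ig r s : qp_int (g r s) by case: (gZ r s).
have nd := GL2_Z_det gZ; have := mx22P (g : 'M_2); move: (ig 0 0) (ig 0 1) (ig 1 0) (ig 1 1).
move: (g 0 0) (g 0 1) (g 1 0) (g 1 1) => a b c d ia ib ic id_ gE.
rewrite gE mx22_det in nd; have ilam := @qp_int_nat l l.
have [[y iy aE]|na] := pselect (qdvd a).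
  exists ord_max; apply: (@GL2_Z_mx _ y b c (lam * d) _ iy ib ic _ _).
  - rewrite aE in gE; have h := gl_mulP gE sglVE.
    have h2 := gl_mulP hglV_last h; rewrite (diag1_mul lam0) in h2.
    exact: h2.
  - exact: qp_intM ilam id_.
  - by have <- : a * d = y * (lam * d) by rewrite aE -mulrA mulrCA.
have [a0 iaV] := qp_int_inv ia na.
have ica : qp_int (c / a) by exact: qp_intM.
have [m [y [iy cE]]] := qp_approx ica.
have lj : (m %% l < l)%N by rewrite ltn_mod prime_gt0 // place_prime.
pose z := y + (m %/ l)%:R; have iz : qp_int z by apply: qp_intD => //; exact: qp_int_nat.
have mE : (m%:R : Q) = (m %/ l)%:R * lam + (m %% l)%:R by rewrite -natrM -natrD -divn_eq.
have {}cE := divf_nat a0 cE mE; rewrite -/z in cE.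
have ij := @qp_int_nat l (m %% l).
exists (Ordinal (ltnW lj : (m %% l < l.+1)%N)).
apply: (@GL2_Z_mx _ a (lam * b) (a * z) (d - (m %% l)%:R * b) _ ia _ _ _ _).
- have h := gl_mulP gE sglVE.
  have h2 := gl_mulP (hglV_lt lj) h; rewrite (lower_mul lam0 b d cE) in h2.
  exact: h2.
- exact: qp_intM ilam ib.
- exact: qp_intM ia iz.
- exact: qp_intB id_ (qp_intM ij ib).
- by rewrite (lower_det b d cE).
Qed.

Lemma qdvd_natB i j : qdvd (j%:R - i%:R : Q) -> (i < l)%N -> (j < l)%N -> i = j.
Proof.
move=> d il jl; wlog ij : i j d il jl / (i <= j)%N => [h|].
  have [ij|/ltnW ji] := leqP i j; first exact: h.
  by apply/esym/h => //; rewrite -opprB; exact: qdvdN.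
move: d; rewrite -natrB // => /qdvd_nat ld; apply/eqP; rewrite eqn_leq ij -subn_eq0 /=.
case: posnP => // /dvdn_leq/(_ ld).
by rewrite leqNgt (leq_ltn_trans (leq_subr i j) jl).
Qed.

Lemma hgl_inj (i j : 'I_l.+1) : GL2_Z l ((hgl i)^-1 * hgl j)%g -> i = j.
Proof.
move=> hZ; have ih r s : qp_int ((hmxV i *m hmx j) r s).
  by rewrite -hglVE -hglE -gl_mulE; case: (hZ r s).
apply: val_inj => /=; have := ltn_ord i; have := ltn_ord j; rewrite !ltnS => jl il.
move: (ih 0 0) (ih 1 0) (ih 1 1) => {ih}; rewrite /hmx /hmxV.
have [li|li] := ltnP i l; have [lj|lj] := ltnP j l; rewrite mx22M !mxE /=.
- move=> _ h _; apply: (@qdvd_natB i j) => //; apply/lam_inv_int.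
  by rewrite lowerB.
- by move=> _ _; rewrite mulr0 add0r mul1r => /not_int_lamV.
- by rewrite mul0r addr0 mul1r => /not_int_lamV.
- by move=> _ _ _; apply/eqP; rewrite eqn_leq; rewrite (leq_trans il lj) (leq_trans jl li).
Qed.

(** Its first column (1, j), or (0, 1) for the last index, is the point of the projective line
    attached to the coset [hgl j]. *)
Definition hleft j : 'M[Q]_2 := if (j < l)%N then mx22 1 0 j%:R 1 else mx22 0 1 1 0.
Lemma hgl_dbl j : exists a b : GL2 Q, [/\ GL2_Z l a, GL2_Z l b, (a : 'M_2) = hleft j &
  hgl j = (a * sgl^-1 * b)%g].
Proof.
have i0 := qp_int0 l; have i1 := qp_int1 l; have ij := @qp_int_nat l j.
have nN1 : ~ qdvd (-1 : Q) by move=> /qdvdN; rewrite opprK; exact: qdvd1.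
rewrite /hgl /hmx /hleft; case: ifP => jl.
  have e : mx22 1 0 j%:R 1 *m mx22 1 0 (- j%:R) 1 = 1%:M :> 'M[Q]_2.
    by rewrite mx22M -mx22_1; apply: mx22_eq; rewrite ?(mulr0, mul0r, mulr1, mul1r, addr0, add0r, subrr).
  have aE := gl_ofP e.
  exists (gl_of (mx22 1 0 j%:R 1)), 1%g; split=> [||//|].
  - apply: (GL2_Z_mx aE i1 i0 ij i1); rewrite mulr1 mul0r subr0; exact: qdvd1.
  - exact: GL2_Z1.
  rewrite mulg1; apply: gl_inj; rewrite (gl_mulP aE sglVE) -lower_dbl.
  exact: gl_ofP (lowerK lam0 _).
have e : mx22 0 1 1 0 *m mx22 0 1 1 0 = 1%:M :> 'M[Q]_2.
  by rewrite mx22M -mx22_1; apply: mx22_eq; rewrite ?(mulr0, mul0r, mulr1, addr0, add0r).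
have sE := gl_ofP e; have sZ : GL2_Z l (gl_of (mx22 0 1 1 0)).
  by apply: (GL2_Z_mx sE i0 i1 i1 i0); rewrite mulr1 mul0r sub0r.
exists (gl_of (mx22 0 1 1 0)), (gl_of (mx22 0 1 1 0)); split=> [||//|].
- exact: sZ.
- exact: sZ.
apply: gl_inj; rewrite (gl_mulP (gl_mulP sE sglVE) sE) -diag1_dbl.
exact: gl_ofP (diag1K lam0).
Qed.
End LocalCosets.

(** * Units of the local order as coset representatives *)

Section LocalUnits.
Context (E : fieldExtType rat) (w : 2.-tuple E) (hw : basis_of {: E} w) (l : place).
Hypothesis hspan : Zp_span w l [set x | x \in (w : seq E)] = O_at w l.
Local Notation vE := (vecE w (Qp l)).
Local Notation OU := (O_at_units w l).
Implicit Types (u v : 'cV[Qp l]_2) (g h : GL2 (Qp l)).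

Lemma O_unitsP g : OU g <->
  exists u v, [/\ ivec u, ivec v, tmul w u v = vE 1 & (g : 'M_2) = iota w u].
Proof.
by split=> -[u [v [/(O_atE hw hspan) iu /(O_atE hw hspan) iv uv gE]]]; exists u, v; split.
Qed.

Lemma O_units_subgroup : is_subgroup OU.
Proof.
have i1 : ivec (vE 1) by apply/(ivec_OE hw hspan)/OE1.
split.
- apply/O_unitsP; exists (vE 1), (vE 1); split=> //; first by rewrite tmulv1.
  by rewrite gl_oneE iotav1.
- move=> g h /O_unitsP[u [v [iu iv uv gE]]] /O_unitsP[u' [v' [iu' iv' uv' hE]]].
  apply/O_unitsP; exists (tmul w u u'), (tmul w v' v); split.
  + exact: (ivec_tmul hw hspan).
  + exact: (ivec_tmul hw hspan).
  + by rewrite -tmulAv // (tmulAv hw u') // uv' tmul1v'.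
  + by rewrite (gl_mulP gE hE) iota_tmulv.
- move=> g /O_unitsP[u [v [iu iv uv gE]]]; apply/O_unitsP; exists v, u; split=> //.
    by rewrite tmulCv.
  by apply: (gl_invP gE); rewrite -iota_tmulv // uv iotav1.
Qed.

Lemma O_units_GL2_Z g : OU g -> GL2_Z l g.
Proof.
move=> gU; have [_ _ uV] := O_units_subgroup.
have [u [_ [iu _ _ gE]]] := (O_unitsP g).1 gU.
have [v [_ [iv _ _ gVE]]] := (O_unitsP _).1 (uV g gU).
by move=> i j; rewrite gE gVE; split; apply: (imx_iota hw hspan).
Qed.

Lemma O_units_of u : ivec u -> ~ qdvd (\det (iota w u)) ->
  (gl_of (iota w u) : 'M_2) = iota w u /\ OU (gl_of (iota w u)).
Proof.
move=> iu nd; have iM := imx_iota hw hspan iu; have [Mu MVi] := imx_inv iM nd.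
have gE := gl_ofE Mu; split=> //; apply/O_unitsP.
pose v := invmx (iota w u) *m vE 1; exists u, v; split=> //.
  move=> i; rewrite /v mulmx2E; have i1 : ivec (vE 1) by apply/(ivec_OE hw hspan)/OE1.
  by apply: qp_intD; apply: qp_intM; [exact: MVi|exact: i1|exact: MVi|exact: i1].
by rewrite /tmul /v mulKVmx.
Qed.
End LocalUnits.

(** This identity and the next one carry [hgl_ex] and [hgl_inj] over to the representatives of O_l^*
    once these are matched with the [hgl j]. *)
Lemma conj_coset (G : groupType) (s a h u : G) :
  ((s^-1)^-1 * (a^-1 * u) * s^-1 = ((a * s^-1)^-1 * h) * (h^-1 * (u * s^-1)))%g.
Proof. by rewrite -[in RHS]mulgA mulKVg invgM !mulgA. Qed.
Lemma coset_conj (G : groupType) (s a b h k : G) :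
  (h^-1 * k = ((a * s^-1)^-1 * h)^-1 * ((s^-1)^-1 * (a^-1 * b) * s^-1) * ((b * s^-1)^-1 * k))%g.
Proof. by rewrite !invgM !invgK -!mulgA !(mulKg, mulKVg). Qed.

Section InertReps.
Context (E : fieldExtType rat) (w : 2.-tuple E) (hw : basis_of {: E} w) (l : place).
Hypothesis hspan : Zp_span w l [set x | x \in (w : seq E)] = O_at w l.
Hypotheses (ld : ~~ (l %| disc E)%Z) (hin : inert E l).
Local Notation vE := (vecE w (Qp l)).
Local Notation OU := (O_at_units w l).
Local Notation lam := ((l : nat)%:R : Qp l).
Local Notation hgl := (@hgl l).
Local Notation sgl := (sgl l).

Let c0 : 'cV[Qp l]_2 := delta_mx 0 0.
Let xc j : 'cV[Qp l]_2 := hleft l j *m c0.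

Let primitive_unit u : ivec u -> ~ lvec u ->
  (gl_of (iota w u) : 'M_2) = iota w u /\ OU (gl_of (iota w u)).
Proof.
move=> iu pu; have [b hb _] := disc_integral_basis ld.
exact: (O_units_of hw hspan iu (inert_det hw hb hspan hin iu pu)).
Qed.

Let ic0 : ivec c0.
Proof. by move=> i; rewrite mxE; case: (_ && _); [exact: qp_int1|exact: qp_int0]. Qed.
Let pc0 : ~ lvec c0. Proof. by move/(_ 0); rewrite mxE; exact: qdvd1. Qed.
Let ix j : ivec (xc j).
Proof.
have [a [_ [aZ _ aE _]]] := hgl_dbl l j.
by apply: imx_mulv ic0; rewrite -aE => r s; case: (aZ r s).
Qed.
Let px j : ~ lvec (xc j).
Proof.
rewrite /xc /hleft; case: ifP => _ h; [have := h 0|have := h 1];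
  rewrite mulmx2E !mxE /= mulr0 addr0 mulr1; exact: qdvd1.
Qed.

Let ae := gl_of (iota w c0).
Let ax j := gl_of (iota w (xc j)).
(** A quotient of two elements of O_l, both units because their coordinates are not all divisible by
    the inert prime l. It maps the first basis vector to the first column of [hleft j], hence moves
    one point of the projective line to any other. *)
Definition inert_rep j : GL2 (Qp l) := (ax j * ae^-1)%g.

Lemma inert_rep_unit j : OU (inert_rep j).
Proof.
have [_ OM OV] := O_units_subgroup hw hspan.
apply: OM; first exact: (primitive_unit (@ix j) (@px j)).2.
exact/OV/(primitive_unit ic0 pc0).2.
Qed.

Let rep_c0 j : (inert_rep j : 'M_2) *m c0 = xc j.
Proof.
have [aeE _] := primitive_unit ic0 pc0; have [axE _] := primitive_unit (@ix j) (@px j).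
have e : iota w c0 *m vE 1 = c0 by exact: tmulv1.
have u : iota w c0 \in unitmx by rewrite -aeE gl_unit.
have eV : invmx (iota w c0) *m c0 = vE 1 by rewrite -{2}e mulKmx.
rewrite (gl_mulP axE (gl_invE ae)) aeE -mulmxA eV.
exact: (tmulv1 hw).
Qed.

(** [inert_rep j] and the left factor of [hgl j] have the same effect on the first basis vector.
    Their quotient therefore has first column (1, 0), and stays integral after conjugation by
    diag(l, 1). *)
Lemma inert_rep_coset j : GL2_Z l ((inert_rep j * sgl^-1)^-1 * hgl j)%g.
Proof.
have [a [b [aZ bZ aE ->]]] := hgl_dbl l j.
pose c := ((inert_rep j)^-1 * a)%g.
have cZ : GL2_Z l c by apply: GL2_ZM aZ; apply/GL2_ZV/(O_units_GL2_Z hw hspan)/inert_rep_unit.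
have cc : (c : 'M_2) *m c0 = c0.
  rewrite (gl_mulP (gl_invE _) aE) -mulmxA -/(xc j) -rep_c0 mulKmx //; exact: gl_unit.
have -> : ((inert_rep j * sgl^-1)^-1 * (a * sgl^-1 * b) = (sgl * c * sgl^-1) * b)%g.
  by rewrite invgM invgK /c !mulgA.
apply: GL2_ZM _ bZ; move: c cZ cc => c cZ cc; have nd := GL2_Z_det cZ.
have ic r s : qp_int (c r s) by case: (cZ r s).
have := mx22P (c : 'M_2); move: (ic 0 1) (ic 1 1) (congr1 (fun M : 'cV_2 => M 0 0) cc) (congr1 (fun M : 'cV_2 => M 1 0) cc).
rewrite !mulmx2E !mxE /= !mulr0 !mulr1 !addr0.
move: (c 0 0) (c 0 1) (c 1 0) (c 1 1) => p q r s iq is_ -> -> cE.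
rewrite cE mx22_det mul1r mulr0 subr0 in nd.
have h := gl_mulP (gl_mulP (sglE l) cE) (sglVE l).
rewrite diag2_conj in h; last exact: qp_p_neq0.
apply: (GL2_Z_mx h (qp_int1 l) (qp_intM (qp_int_nat l l) iq) (qp_int0 l) is_).
by rewrite mul1r mulr0 subr0.
Qed.

Lemma inert_rep_ex u : OU u -> exists j : 'I_l.+1,
  GL2_Z l ((sgl^-1)^-1 * ((inert_rep j)^-1 * u) * sgl^-1)%g.
Proof.
move=> uU; have [j hj] := hgl_ex (O_units_GL2_Z hw hspan uU); exists j.
rewrite (conj_coset sgl (inert_rep j) (hgl j) u).
exact: GL2_ZM (inert_rep_coset j) hj.
Qed.

Lemma inert_rep_inj (i j : 'I_l.+1) :
  GL2_Z l ((sgl^-1)^-1 * ((inert_rep i)^-1 * inert_rep j) * sgl^-1)%g -> i = j.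
Proof.
move=> h; apply: hgl_inj.
rewrite (coset_conj sgl (inert_rep i) (inert_rep j) (hgl i) (hgl j)).
exact: GL2_ZM (GL2_ZM (GL2_ZV (inert_rep_coset i)) h) (inert_rep_coset j).
Qed.
End InertReps.

Lemma conj_conj (G : groupType) (k n a d : G) :
  ((k * n * k^-1)^-1 * ((k * a * k^-1)^-1 * (k * d * k^-1)) * (k * n * k^-1) =
   k * (n^-1 * (a^-1 * d) * n) * k^-1)%g.
Proof. by rewrite !invgM !invgK -!mulgA !(mulKg, mulKVg). Qed.
Lemma conj_cancel (G : groupType) (k x : G) : (k^-1 * (k * x * k^-1) * k = x)%g.
Proof. by rewrite -!mulgA mulKg mulVg mulg1. Qed.

Section SplitReps.
Context (E : fieldExtType rat) (w : 2.-tuple E) (hw : basis_of {: E} w) (l : place).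
Hypothesis hspan : Zp_span w l [set x | x \in (w : seq E)] = O_at w l.
Context (f : 'cV[Qp l]_2).
Hypotheses (If : rank1_idem w f) (if1 : ivec f) (if2 : ivec (idemC w f)).
Local Notation vE := (vecE w (Qp l)).
Local Notation OU := (O_at_units w l).
Local Notation lam := ((l : nat)%:R : Qp l).
Local Notation hgl := (@hgl l).

Definition split_basis : GL2 (Qp l) := gl_of (row_mx f (idemC w f) : 'M_2).
Definition dgl (s t : Qp l) : GL2 (Qp l) := gl_of (mx22 s 0 0 t).
Definition ngl : GL2 (Qp l) := gl_of (mx22 1 0 lam^-1 1).
Local Notation k := split_basis.

Let lam0 : lam != 0. Proof. exact: qp_p_neq0. Qed.

Lemma split_basisP : [/\ GL2_Z l k & forall (g : GL2 (Qp l)) v, (g : 'M_2) = iota w v ->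
  g = (k * dgl (chi w f v) (chi w (idemC w f) v) * k^-1)%g].
Proof.
have [uk ik ikV _ kE] := idem_diagonal hw hspan If if1 if2 (erefl _).
have kM := gl_ofE uk; split.
  by move=> i j; rewrite gl_invE kM; split; [exact: ik|exact: ikV].
move=> g v gE; have gE' := etrans gE (kE v).
have dE : mx22 (chi w f v) 0 0 (chi w (idemC w f) v) = invmx k *m g *m k.
  by rewrite gE' kM -!mulmxA mulVmx // mulmx1 mulKmx.
have ud : mx22 (chi w f v) 0 0 (chi w (idemC w f) v) \in unitmx.
  by rewrite dE !unitmx_mul unitmx_inv !gl_unit.
have kVM : ((k^-1)%g : 'M_2) = invmx (row_mx f (idemC w f) : 'M_2).
  by rewrite gl_invE kM.
apply: gl_inj; rewrite gE'.
exact: esym (gl_mulP (gl_mulP kM (gl_ofE ud)) kVM).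
Qed.

Lemma dglE s t : s != 0 -> t != 0 -> (dgl s t : 'M_2) = mx22 s 0 0 t.
Proof. by move=> s0 t0; exact: gl_ofP (diagK s0 t0). Qed.
Lemma dglVE s t : s != 0 -> t != 0 -> ((dgl s t)^-1%g : 'M_2) = mx22 s^-1 0 0 t^-1.
Proof. by move=> s0 t0; exact: gl_invP (dglE s0 t0) (diagK s0 t0). Qed.
Lemma dgl_Z s t : qp_int s -> qp_int t -> ~ qdvd s -> ~ qdvd t -> GL2_Z l (dgl s t).
Proof.
move=> is_ it ns nt; have [s0 _] := qp_int_inv is_ ns; have [t0 _] := qp_int_inv it nt.
apply: (GL2_Z_mx (dglE s0 t0) is_ (qp_int0 l) (qp_int0 l) it).
by rewrite mul0r subr0 => /(qdvdM is_ it)[].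
Qed.
Lemma nglE : (ngl : 'M_2) = mx22 1 0 lam^-1 1.
Proof. exact: gl_ofP (lower1K lam0). Qed.
Lemma nglVE : ((ngl^-1)%g : 'M_2) = mx22 1 0 (- lam^-1) 1.
Proof. exact: gl_invP nglE (lower1K lam0). Qed.

Lemma unit_not_qdvd (x y : Qp l) : qp_int y -> x * y = 1 -> ~ qdvd x.
Proof. by move=> iy xy dx; apply: (@qdvd1 l); rewrite -xy; exact: qdvdMl. Qed.

Lemma O_units_diag u : OU u -> exists a b, [/\ qp_int a, qp_int b, ~ qdvd a, ~ qdvd b &
  u = (k * dgl a b * k^-1)%g].
Proof.
move=> /(O_unitsP hw hspan)[v [v' [iv iv' vv uE]]].
have If' := idemC_rank1 hw If.
exists (chi w f v), (chi w (idemC w f) v); split; last exact: split_basisP.2.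
- exact: (qp_int_chi hw hspan).
- exact: (qp_int_chi hw hspan).
- apply: (@unit_not_qdvd _ (chi w f v')); first exact: (qp_int_chi hw hspan).
  by rewrite -(chiM hw _ _ If) vv (chi1 hw If).
- apply: (@unit_not_qdvd _ (chi w (idemC w f) v')); first exact: (qp_int_chi hw hspan).
  by rewrite -(chiM hw _ _ If') vv (chi1 hw If').
Qed.

Lemma diag_O_units a b : qp_int a -> qp_int b -> ~ qdvd a -> ~ qdvd b ->
  OU (k * dgl a b * k^-1)%g.
Proof.
move=> ia ib na nb; have If' := idemC_rank1 hw If.
pose v := a *: f + b *: idemC w f.
have iv : ivec v by apply: ivecD; exact: ivecZ.
have c1 : chi w f v = a by rewrite chiD !chiZ (chi_id hw If) (chiC' hw If) mulr1 mulr0 addr0.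
have c2 : chi w (idemC w f) v = b.
  by rewrite chiD !chiZ (chi_id hw If') (chiC hw If) mulr1 mulr0 add0r.
have nd : ~ qdvd (\det (iota w v)).
  have [uk _ _ _ kE] := idem_diagonal hw hspan If if1 if2 (erefl _).
  rewrite kE c1 c2 !det_mulmx mulrAC -det_mulmx mulmxV // det1 mul1r mx22_det mul0r subr0.
  by move=> /(qdvdM ia ib)[].
have [gE gU] := O_units_of hw hspan iv nd.
by have := split_basisP.2 _ _ gE; rewrite c1 c2 => <-.
Qed.

Context (r : Qp l) (ir : qp_int r) (irV : qp_int r^-1) (r0 : r != 0).
Let nr : ~ qdvd r. Proof. exact: qp_inv_int. Qed.

(** The first entry is r, the unit in the uniformizer (l r, 1), so that the representatives match
    the Hecke cosets translated by Frobenius; the entries j + 1 run over the nonzero residues modulo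
    l. *)
Definition split_rep (j : nat) : GL2 (Qp l) := (k * dgl r j.+1%:R * k^-1)%g.

Let nj (j : 'I_l.-1) : ~ qdvd (j.+1%:R : Qp l).
Proof.
move=> /qdvd_nat; apply/negP; rewrite gtnNdvd //.
by rewrite -[X in (_ < X)%N](prednK (prime_gt0 (place_prime l))) ltnS.
Qed.
Let j0 (j : nat) : (j.+1%:R : Qp l) != 0. Proof. by rewrite qp_natr_eq0. Qed.

Lemma split_rep_unit (j : 'I_l.-1) : OU (split_rep j).
Proof. exact: diag_O_units ir (qp_int_nat l _) nr (@nj j). Qed.

Let g := (k * ngl * k^-1)%g.

Let conj_split (a : GL2 (Qp l)) (d : GL2 (Qp l)) : 
  GL2_Z l (g^-1 * ((k * a * k^-1)^-1 * (k * d * k^-1)) * g)%g <->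
  GL2_Z l (ngl^-1 * (a^-1 * d) * ngl)%g.
Proof.
have [kZ _] := split_basisP; rewrite (conj_conj k ngl a d).
split=> h; last exact: GL2_ZM (GL2_ZM kZ h) (GL2_ZV kZ).
have := GL2_ZM (GL2_ZM (GL2_ZV kZ) h) kZ; rewrite conj_cancel; exact.
Qed.

(** The lower left entry is integral only if the two diagonal entries are congruent modulo l: the
    stabilizer of g_l K_l has index l - 1 in the pairs of units. *)
Let ratio_matrix (j : nat) a b : a != 0 -> b != 0 ->
  ((ngl^-1 * ((dgl r j.+1%:R)^-1 * dgl a b) * ngl)%g : 'M_2) =
  mx22 (a / r) 0 (lam^-1 * (b / j.+1%:R - a / r)) (b / j.+1%:R).
Proof.
move=> a0 b0; have h := gl_mulP (gl_mulP nglVE (gl_mulP (dglVE r0 (j0 j)) (dglE a0 b0))) nglE.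
rewrite (lower1_conj lam0 a b r0 (j0 j)) in h; exact: h.
Qed.

Lemma split_rep_ex u : OU u -> exists j : 'I_l.-1,
  GL2_Z l (g^-1 * ((split_rep j)^-1 * u) * g)%g.
Proof.
move=> /O_units_diag[a [b [ia ib na nb ->]]].
have [a0 iaV] := qp_int_inv ia na; have [b0 _] := qp_int_inv ib nb.
(* The index is prescribed by j + 1 = r b / a modulo l, a nonzero residue as r, a and b are
   units. *)
have iq : qp_int (r * b / a) by exact: qp_intM (qp_intM ir ib) iaV.
have [m [y [iy qE]]] := qp_approx iq.
have mE : (m%:R : Qp l) = (m %/ l)%:R * lam + (m %% l)%:R by rewrite -natrM -natrD -divn_eq.
have {}qE := divf_natD qE mE.
have l0 := prime_gt0 (place_prime l).
have ml : (m %% l < l)%N by rewrite ltn_mod.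
have m0 : (0 < m %% l)%N.
  rewrite lt0n; apply/eqP => m0; rewrite m0 add0r in qE.
  have dq : qdvd (r * b / a).
    by exists (y + (m %/ l)%:R) => //; apply: qp_intD => //; exact: qp_int_nat.
  have : qdvd (r * b) by rewrite -(divfK a0 (r * b)); exact: qdvdMl.
  by move=> /(qdvdM ir ib)[].
have jl : ((m %% l).-1 < l.-1)%N by rewrite -ltnS !prednK.
exists (Ordinal jl); apply/conj_split.
have jE : ((m %% l).-1.+1 = m %% l)%N by rewrite prednK.
have h := ratio_matrix (m %% l).-1 a0 b0.
have nm := @nj (Ordinal jl); rewrite /= in nm.
have [m0' imV] := qp_int_inv (qp_int_nat l _) nm.
rewrite -jE in qE; have e := split_ratio r0 a0 m0' qE.
apply: (GL2_Z_mx h (qp_intM ia irV) (qp_int0 l) _ (qp_intM ib imV)).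
  apply/lam_inv_int; exists ((y + (m %/ l)%:R) * a / (r * (m %% l).-1.+1%:R)); last exact: e.
  apply: qp_intM; last by rewrite invfM; exact: qp_intM.
  by apply: qp_intM => //; apply: qp_intD => //; exact: qp_int_nat.
rewrite mul0r subr0 => d; have : qdvd (a * b).
  rewrite (mulf_div_unit a b r0 m0').
  by apply: qdvdMl d _; apply: qp_intM => //; exact: qp_int_nat.
by move=> /(qdvdM ia ib)[].
Qed.

Lemma split_rep_inj (i j : 'I_l.-1) :
  GL2_Z l (g^-1 * ((split_rep i)^-1 * split_rep j) * g)%g -> i = j.
Proof.
move=> /conj_split h; have hE := ratio_matrix i r0 (j0 j).
have : qp_int (((ngl^-1 * ((dgl r i.+1%:R)^-1 * dgl r j.+1%:R) * ngl)%g : 'M_2) 1 0).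
  by case: (h 1 0).
rewrite hE !mxE /= divff // => /lam_inv_int d.
have lE := prednK (prime_gt0 (place_prime l)).
suff : i.+1 = j.+1 by move=> [] /val_inj.
have bd (x : 'I_l.-1) : (x.+1 < l)%N by move: (ltn_ord x); rewrite -ltnS lE.
apply: (@qdvd_natB l); [|exact: bd|exact: bd].
by rewrite (divfBl _ (j0 i)); apply: qdvdMl d _; exact: qp_int_nat.
Qed.
End SplitReps.

(** * The Euler factor at l *)

Section HeckeReps.
Context (R : realType) (E : fieldExtType rat) (emb : {rmorphism E -> R[i]}).
Context (w : 2.-tuple E) (hw : basis_of {: E} w) (hE : imaginary_quadratic emb).
Context (K : set (GL2 Af)) (hK : is_subgroup K) (l : place) (hl : in_R w K l).
Local Notation D := (cmdiv emb w K).
Local Notation lam := ((l : nat)%:R : Qp l).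
Local Notation hgl := (@hgl l).
Local Notation sgl := (sgl l).
Implicit Types (x y g : GL2 Af) (d k : GL2 (Qp l)).

Definition tgl : GL2 (Qp l) := gl_of (mx22 lam 0 0 lam).
Lemma tglE : (tgl : 'M_2) = lam%:M.
Proof.
have e : mx22 lam 0 0 lam = lam%:M by apply: mx2P; rewrite !mxE.
rewrite /tgl e; apply: gl_ofE; rewrite unitmxE det_scalar unitfE expf_eq0.
by rewrite negb_and qp_p_neq0 orbT.
Qed.
Lemma tgl_central g : (gat tgl * g = g * gat tgl)%g.
Proof.
apply: gl_eqP => p; rewrite !cmpM; have [->|pl] := eqVneq p l.
  rewrite cmp_at; apply: gl_inj.
  rewrite (gl_mulP tglE (erefl _)) (gl_mulP (erefl _) tglE); exact: esym (scalar_mxC _ _).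
by rewrite cmp_at_neq // mulg1 mul1g.
Qed.

Lemma K_gat_l d : GL2_Z l d -> K (gat d).
Proof. exact: (K_gat hK hl). Qed.

Lemma cmdiv_gat x d : GL2_Z l d -> D (x * gat d)%g = D x.
Proof. by move=> dZ; exact: (cmdivMr hw hE hK _ (K_gat_l dZ)). Qed.
Lemma cmdiv_gat_eq x d d' : GL2_Z l (d^-1 * d')%g -> D (x * gat d)%g = D (x * gat d')%g.
Proof.
move=> h; have := cmdiv_gat (x * gat d)%g h.
by rewrite -mulgA -gatM mulKVg.
Qed.

Section Reps.
Context (k : GL2 (Qp l)) (kZ : GL2_Z l k).
(** A left factor k in GL_2(Z_l) does not change the double coset. It is 1 at an inert prime and the
    basis of idempotents at a split one. *)
Definition hecke_rep (j : 'I_l.+1) : GL2 Af := gat (k * hgl j)%g.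

Lemma hecke_rep_dbl j : dbl K ((gat sgl)^-1)%g (hecke_rep j).
Proof.
have [a [b [aZ bZ _ e]]] := hgl_dbl l j.
exists (gat (k * a)%g * (gat sgl)^-1)%g.
  by exists (gat (k * a)%g); [exact: (K_gat_l (GL2_ZM kZ aZ))|exists (gat sgl)^-1%g].
exists (gat b); first exact: K_gat_l.
by rewrite /hecke_rep e -gatV -!gatM -!mulgA.
Qed.

Lemma hecke_rep_ex y : dbl K ((gat sgl)^-1)%g y -> exists j, K ((hecke_rep j)^-1 * y)%g.
Proof.
move=> [_ [a Ka [_ -> <-]] [b Kb <-]]; have [K1 KM KV] := hK.
(* The left factor a is separated into its component at l, treated by [hgl_ex], and an element a' of
   K trivial at l, which commutes with sigma_l. *)
pose c := (k^-1 * cmp l a)%g; pose a' := ((gat (cmp l a))^-1 * a)%g.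
have aZ : GL2_Z l (cmp l a) by exact: (unramified_cmp (in_R_unr hl) Ka).
have cZ : GL2_Z l c by exact: (GL2_ZM (GL2_ZV kZ) aZ).
have Ka' : K a' by apply: KM Ka; exact/KV/K_gat_l.
have a'1 : cmp l a' = 1%g by rewrite /a' cmpM cmpV cmp_at mulVg.
have [j hj] := hgl_ex cZ; exists j; have Kj := K_gat_l hj.
have -> : ((hecke_rep j)^-1 * (a * (gat sgl)^-1 * b) =
    gat ((hgl j)^-1 * (c * sgl^-1)) * (a' * b))%g.
  have e : (a * (gat sgl)^-1 * b = gat (cmp l a * sgl^-1) * (a' * b))%g.
    rewrite (gatM (cmp l a)) gatV -(mulgA (gat (cmp l a))) (mulgA _ a' b) -gatV.
    by rewrite (gat_commute _ a'1) /a' !mulgA mulgV mul1g gatV.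
  rewrite e /hecke_rep -gatV mulgA -gatM; congr (gat _ * _)%g.
  by rewrite invgM /c !mulgA.
exact/KM/KM.
Qed.

Lemma hecke_rep_inj i j : K ((hecke_rep i)^-1 * hecke_rep j)%g -> i = j.
Proof.
rewrite /hecke_rep -gatV -gatM => h; apply: hgl_inj.
have := unramified_cmp (in_R_unr hl) h; rewrite cmp_at invgM -!mulgA mulKg; exact.
Qed.
End Reps.

Lemma central_dbl c y : (forall g, c * g = g * c)%g -> dbl K c y -> K (c^-1 * y)%g.
Proof.
move=> cC [_ [a Ka [_ -> <-]] [b Kb <-]]; have [_ KM _] := hK.
by rewrite -cC -mulgA mulKg; exact: KM.
Qed.

(** Serves both for the identity and for tau_l^-1: the double coset of a central element is a single
    coset. *)
Lemma Hecke_central c (I : eqType) (s : seq I) (t : I -> GL2 Af) (n : I -> int) :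
  (forall g, c * g = g * c)%g ->
  Hecke emb w K c (\sum_(i <- s) D (t i) *~ n i) = \sum_(i <- s) D (t i * c)%g *~ n i.
Proof.
move=> cC; have [K1 KM KV] := hK.
rewrite (Hecke_sum hw hE hK (gam := fun _ : 'I_1 => c)).
- by apply: eq_bigr => i _; rewrite big_ord1.
- by move=> _; exists c; [exists 1%g; [|exists c]|exists 1%g]; rewrite ?mul1g ?mulg1.
- by move=> y /(central_dbl cC) h; exists ord0.
- by move=> i j _; rewrite !ord1.
Qed.

Section HeckePolynomial.
Context (art : GL2 Af -> R[i] -> R[i]).
Hypotheses (artM : forall g h, H_Af w g -> H_Af w h -> art (g * h)%g = art g \o art h)
  (artK : forall h, H_Af w h -> (art h = id <-> H_Q w h)).

Lemma Hecke_polyE (h : GL2 Af) z : H_Af w h -> Hecke_poly emb w K art l (art h) z =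
  Hecke emb w K 1%g z *~ (l : nat) - Hecke emb w K (gat sgl)^-1%g (gal_act emb w K art (art h) z)
  + Hecke emb w K (gat tgl)^-1%g (gal_act emb w K art (art (h * h)%g) z).
Proof.
move=> Hh; have e := artM Hh Hh; rewrite e gat.unlock.
exact: erefl.
Qed.

Lemma Hecke_poly_sum (k : GL2 (Qp l)) (h : GL2 Af) (I : eqType) (s : seq I)
    (t : I -> GL2 Af) (n : I -> int) : GL2_Z l k -> H_Af w h ->
  Hecke_poly emb w K art l (art h) (\sum_(i <- s) D (t i) *~ n i) =
  \sum_(i <- s) (D (t i) *~ (l : nat) - \sum_j D (h * t i * hecke_rep k j)%g
    + D (h * h * t i * (gat tgl)^-1)%g) *~ n i.
Proof.
move=> kZ Hh; have [_ HM _] := H_Af_subgroup hw.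
have Hhh := HM h h Hh Hh.
have e1 := Hecke_central s t n (c := 1%g) (fun g => etrans (mul1g g) (esym (mulg1 g))).
have e2 := gal_act_sum hw hE hK artM artK s t n Hh.
have e3 := gal_act_sum hw hE hK artM artK s t n Hhh.
have {}e2 := eq_trans (congr1 (Hecke emb w K (gat sgl)^-1%g) e2)
  (Hecke_sum hw hE hK (hecke_rep_dbl kZ) (hecke_rep_ex kZ) (@hecke_rep_inj k) s _ n).
have tC g : ((gat tgl)^-1 * g = g * (gat tgl)^-1)%g.
  by apply: (mulgI (gat tgl)); rewrite mulKVg mulgA tgl_central mulgK.
have {}e3 := eq_trans (congr1 (Hecke emb w K (gat tgl)^-1%g) e3) (Hecke_central s _ n tC).
have comb (a b c a' b' c' : set ((R[i] -> 'M[R]_2) * GL2 Af) -> int) : a = a' -> b = b' -> c = c' ->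
  a *~ (l : nat) - b + c = a' *~ (l : nat) - b' + c' by move=> -> -> ->.
apply: (eq_trans (Hecke_polyE _ Hh)); apply: (eq_trans (comb _ _ _ _ _ _ e1 e2 e3)).
rewrite (big_morph (fun f => f *~ (l : nat)%:Z) (id1 := 0) (op1 := +%R)) ?mul0rz //; last first.
  by move=> f f'; rewrite mulrzDl.
rewrite -sumrB -big_split /=; apply: eq_bigr => i _.
by rewrite mulg1 -mulrzA mulrC mulrzA mulrzDl mulrzBl.
Qed.
End HeckePolynomial.
End HeckeReps.

Lemma big_ord_ends (V : nmodType) n (F : nat -> V) : (0 < n)%N ->
  \sum_(j < n.+1) F j = F 0%N + \sum_(j < n.-1) F j.+1 + F n.
Proof. by case: n => // n _; rewrite big_ord_recl big_ord_recr /= addrA. Qed.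

Lemma central_comm (G : groupType) (t u x : G) : (forall y, t * y = y * t)%g -> (u * x = x * u)%g ->
  (t * u * (t * u) * x * t^-1 = t * (x * (u * u)))%g.
Proof.
move=> tC ux; apply: (mulIg t); rewrite mulgKV -tC -!mulgA; congr (_ * _)%g.
by rewrite mulgA -(tC u) -mulgA; congr (_ * _)%g; rewrite ux mulgA ux mulgA.
Qed.

Lemma comm_mulA (G : groupType) (a x c : G) : (a * x = x * a)%g -> (a * (x * c) = x * (a * c))%g.
Proof. by move=> ax; rewrite mulgA ax mulgA. Qed.

Lemma conj_mulK (G : groupType) (k d y : G) : (k * d * k^-1 * (k * y) = k * (d * y))%g.
Proof. by rewrite -!mulgA mulKg. Qed.
Lemma conj_twist (G : groupType) (k d y r t : G) : (forall z, z * t^-1 = t^-1 * z)%g ->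
  (d * y * r * t = d * d)%g ->
  ((k * (d * y))^-1 * (k * d * k^-1 * (k * d * k^-1) * t^-1) = r * k^-1)%g.
Proof.
move=> tC e; apply: (mulgI (k * (d * y))%g); rewrite mulKVg -!mulgA mulKg (tC k^-1)%g.
by rewrite (mulgA d d) -e -!mulgA mulKVg.
Qed.
Lemma conj_ratio (G : groupType) (k d y e r n : G) : (d * y * e = r * n)%g ->
  ((k * (d * y))^-1 * (k * r * k^-1 * (k * n * k^-1)) = e * k^-1)%g.
Proof.
move=> eE; apply: (mulgI (k * (d * y))%g); rewrite mulKVg -!mulgA mulKg; congr (_ * _)%g.
by rewrite !mulgA eE.
Qed.

Lemma gat_comm_mul l (a b : GL2 (Qp l)) (x : GL2 Af) : cmp l x = 1%g ->
  (gat a * x * gat b = x * gat (a * b))%g.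
Proof. by move=> x1; rewrite (gat_commute a x1) -mulgA -gatM. Qed.
Lemma gat_comm_mulV l (a b c : GL2 (Qp l)) (x : GL2 Af) : cmp l x = 1%g ->
  (gat a * gat b * x * (gat c)^-1 = x * gat (a * b * c^-1))%g.
Proof. by move=> x1; rewrite -gatM -gatV gat_comm_mul. Qed.

Lemma sum_const_sub (V : zmodType) n (d : V) (F : 'I_n.+1 -> V) :
  d *~ n - \sum_j F j + d = \sum_j (d - F j).
Proof. by rewrite sumrB sumr_const card_ord mulrSr -pmulrn addrAC. Qed.

Arguments dgl {l} (s t)%_R.

(** * The identity on one coset, at inert and at split primes *)

Section LocalIdentity.
Context (R : realType) (E : fieldExtType rat) (emb : {rmorphism E -> R[i]}).
Context (w : 2.-tuple E) (hw : basis_of {: E} w) (hE : imaginary_quadratic emb).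
Context (K : set (GL2 Af)) (hK : is_subgroup K) (l : place) (hl : in_R w K l).
Context (lam_ : place -> set E) (hP : prime_ideal_above l (lam_ l)).
Local Notation D := (cmdiv emb w K).
Local Notation lam := ((l : nat)%:R : Qp l).
Local Notation hgl := (@hgl l).
Local Notation sgl := (sgl l).
Local Notation tgl := (tgl l).
Local Notation OU := (O_at_units w l).
Local Notation g := (g_loc w lam_ l).
Implicit Types (x y : GL2 Af) (d k : GL2 (Qp l)).

Let hspan : Zp_span w l [set x | x \in (w : seq E)] = O_at w l. Proof. by case: hl. Qed.
Let ld : ~~ (l %| disc E)%Z. Proof. by case: hl. Qed.
Let lam0 : lam != 0. Proof. exact: qp_p_neq0. Qed.

(* The Euler factor at l, computed on one coset: [a] represents O_l^* modulo the stabilizer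
   of the coset of [g_loc]. *)
Definition local_identity (h : GL2 Af) : Prop :=
  exists (m : nat) (a : 'I_m -> GL2 (Qp l)) (k : GL2 (Qp l)),
  [/\ GL2_Z l k,
    forall j, OU (a j),
    forall u, OU u -> exists j, GL2_Z l (g^-1 * ((a j)^-1 * u) * g)%g,
    forall i j, GL2_Z l (g^-1 * ((a i)^-1 * a j) * g)%g -> i = j &
    forall x, cmp l x = 1%g ->
      D x *~ (l : nat) - \sum_j D (h * x * hecke_rep k j)%g
        + D (h * h * x * (gat tgl)^-1)%g =
      \sum_j (D (gat (a j) * x)%g - D (gat (a j) * (x * gat g))%g)].

Let cmdivM d : GL2_Z l d -> forall x, D (x * gat d)%g = D x.
Proof. by move=> dZ x; exact: (cmdiv_gat hw hE hK hl x dZ). Qed.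

Section Inert.
Hypothesis hin : inert E l.

Let gE : g = sgl^-1%g.
Proof.
rewrite /g_loc asboolT //; apply: gl_inj; rewrite sglVE.
exact: gl_ofP (mulmx1C (diag2K lam0)).
Qed.

(* diag(l, l) at l differs from the global scalar l by an element of K. *)
Lemma tgl_shift x : D (gat tgl * x)%g = D x.
Proof.
have [_ _ _ hc] := hl; have [c [Kc c1] cE] := hc hin; move=> {hc}.
have ul : ((l : nat)%:R%:M : 'M[Af]_2) \in unitmx.
  rewrite unitmxE det_scalar unitrX //.
  by have := af_qalg (l : nat).-1; rewrite prednK // prime_gt0 // place_prime.
pose q : GL2 Af := gl_of (l : nat)%:R%:M.
have qM : (q : 'M_2) = (l : nat)%:R%:M by exact: gl_ofE.
have qE : q = (gat tgl * c)%g.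
  apply: gl_eqP => p; apply: gl_inj; rewrite cmpM.
  have [->|pl] := eqVneq p l.
    have -> : cmp l c = 1%g by rewrite -gl_comp_cmp; exact: c1.
    by rewrite mulg1 cmp_at tglE cmpE qM map_scalar_mx rmorph_nat.
  have e : afc p (adele_at (1 : Qp l) (l : nat)%:R) = (l : nat)%:R.
    by rewrite afc_at_neq // rmorph_nat.
  rewrite cmp_at_neq // mul1g !cmpE qM cE !map_scalar_mx.
  have e' : afc p ((l : nat)%:R : Af) = afc p (adele_at (1 : Qp l) (l : nat)%:R).
    by rewrite e rmorph_nat.
  exact: (congr1 (fun a : Qp p => (a%:M : 'M_2)) e').
have Qq : H_Q w q.
  exists (l : nat)%:R; first exact: (E_natr_neq0 _ (prime_gt0 (place_prime l))).
  have e : (l : nat)%:R = (l : nat)%:R * 1 :> E by rewrite mulr1.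
  by rewrite qM e (vecE_nat w af_qalg) iotaZ (iota1 hw af_qalg) scalemx1.
have cC : (x * c = c * x)%g.
  apply: gl_inj; rewrite (gl_mulP (erefl _) cE) (gl_mulP cE (erefl _)); exact: scalar_mxC.
rewrite -(cmdivMl hw hE hK x Qq) qE -mulgA -cC mulgA.
exact: (esym (cmdivMr hw hE hK _ Kc)).
Qed.

Lemma inert_identity v : uniformizer w l (lam_ l) v -> local_identity (gat (gl_of (iota w v))).
Proof.
move=> hv; have [b hb _] := disc_integral_basis ld.
have [u [iu pu vE]] := inert_uniformizer hw hb hspan hin hP hv.
have [iu' uE uU] : exists2 d : GL2 (Qp l), (d : 'M_2) = iota w u & OU d.
  have [uE uU] := O_units_of hw hspan iu (inert_det hw hb hspan hin iu pu).
  by exists (gl_of (iota w u)).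
have uZ := O_units_GL2_Z hw hspan uU.
have -> : gl_of (iota w v) = (tgl * iu')%g.
  by rewrite -[RHS]gl_ofK (gl_mulP (tglE l) uE) vE iotaZ mul_scalar_mx.
have hE' := gatM tgl iu'; move: (gat (tgl * iu')%g) hE' => h ->.
exists l.+1, (fun j => inert_rep w l j), 1%g; split.
- exact: GL2_Z1.
- by move=> j; exact: inert_rep_unit.
- rewrite gE => u' hu; exact: (inert_rep_ex hw hspan ld hin hu).
- rewrite gE => i j hij; exact: (inert_rep_inj hw hspan ld hin hij).
move=> x x1.
have t2 : \sum_j D (gat tgl * gat iu' * x * hecke_rep (1%g : GL2 (Qp l)) j)%g = \sum_j D (x * hecke_rep (1%g : GL2 (Qp l)) j)%g.
  have Z1 := GL2_Z1 l.
  apply: (eq_trans _ (Hecke_rep_sum hw hE hK (hecke_rep_dbl hK hl Z1)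
    (hecke_rep_ex hK hl Z1) (@hecke_rep_inj _ _ _ _ hl 1%g) x (K_gat_l hK hl uZ))).
  apply: eq_bigr => j _; have e := gat_commute iu' x1.
  have -> : (gat tgl * gat iu' * x * hecke_rep (1%g : GL2 (Qp l)) j = gat tgl * (x * gat iu' * hecke_rep (1%g : GL2 (Qp l)) j))%g.
    by rewrite -e !mulgA.
  exact: tgl_shift.
have t3 : D (gat tgl * gat iu' * (gat tgl * gat iu') * x * (gat tgl)^-1)%g = D x.
  have e := central_comm (@tgl_central l) (gat_commute iu' x1).
  apply: (eq_trans (congr1 D e)); apply: (eq_trans (tgl_shift _)).
  have e2 := cmdivM (GL2_ZM uZ uZ) x; rewrite gatM in e2; exact: e2.
have eA j : D (gat (inert_rep w l j) * x)%g = D x.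
  have aZ := O_units_GL2_Z hw hspan (inert_rep_unit hw hspan ld hin j).
  exact: (eq_trans (congr1 D (gat_commute _ x1)) (cmdivM aZ x)).
have eB (j : 'I_l.+1) : D (gat (inert_rep w l j) * (x * gat g))%g =
    D (x * hecke_rep (1%g : GL2 (Qp l)) j)%g.
  rewrite gE /hecke_rep mul1g; apply: (eq_trans (congr1 D (comm_mulA _ (gat_commute _ x1)))).
  apply: (eq_trans _ (cmdiv_gat_eq hw hE hK hl x (inert_rep_coset hw hspan ld hin j))).
  exact: (congr1 (fun z => D (x * z)%g) (esym (gatM (inert_rep w l j) sgl^-1%g))).
(* The term in Frob^-2 completes the l copies of D x to l + 1, one for each representative. *)
rewrite t2 t3 sum_const_sub; apply: eq_bigr => j _.
exact: (esym (congr2 (fun a b => a - b) (eA j) (eB j))).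
Qed.
End Inert.

Section Split.
Hypothesis hni : ~ inert E l.
Let f := Defs.idempotent w l (lam_ l).
Local Notation k := (split_basis w f).

Lemma split_identity v : uniformizer w l (lam_ l) v -> local_identity (gat (gl_of (iota w v))).
Proof.
move=> hv; have [If if1 if2 /(_ v hv)[r [ir irV r0 c1 c2]]] := split_structure hw ld hspan hni hP.
rewrite -/f in If if1 if2 c1 c2.
have [kZ kE] := split_basisP hw hspan If if1 if2.
have nr : ~ qdvd r by exact: qp_inv_int.
have l0 := prime_gt0 (place_prime l).
have gE : g = (k * ngl l * k^-1)%g by rewrite /g_loc asboolF.
have lr0 : lam * r != 0 by exact: (mulf_neq0 lam0 r0).
have dE := dglE lr0 (oner_neq0 (Qp l)).
have uv : iota w v \in unitmx.
  have [uk _ _ _ ->] := idem_diagonal hw hspan If if1 if2 (erefl _).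
  by rewrite !unitmx_mul uk unitmx_inv uk c1 c2 -dE gl_unit.
have -> : gl_of (iota w v) = (k * dgl (lam * r)%R 1 * k^-1)%g.
  by have := kE _ v (gl_ofE uv); rewrite c1 c2.
move: (dgl (lam * r) 1) dE => d dE.
exists (l.-1), (fun j => split_rep w f r j), k; split.
- exact: kZ.
- by move=> j; exact: split_rep_unit.
- rewrite gE => u hu; exact: (split_rep_ex hw hspan If if1 if2 ir irV r0 hu).
- rewrite gE => i j h'; exact: (split_rep_inj hw hspan If if1 if2 r0 h').
move=> x x1; pose T (j : nat) := D (x * gat (k * (d * hgl j)))%g.
have t2 : \sum_j D (gat (k * d * k^-1) * x * hecke_rep k j)%g = \sum_(j < l.+1) T j.
  apply: eq_bigr => j _; apply: (eq_trans (congr1 D (gat_comm_mul _ _ x1))).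
  exact: (congr1 (fun z => D (x * gat z)%g) (conj_mulK k d (hgl j))).
(* The product of diag(l r, 1) and [hgl 0] is diag(r, 1), which is integral. *)
have T0 : T 0%N = D x.
  apply: (cmdivM (GL2_ZM kZ _)).
  have e := gl_mulP dE (hglE l 0); rewrite /hmx l0 (diag_lower0 lam0) in e.
  apply: (GL2_Z_mx e ir (qp_int0 l) (qp_int0 l) (qp_int1 l)).
  by rewrite mulr1 mul0r subr0.
(* With d = diag(l r, 1), both d [hgl l] = diag(l r, 1/l) and d^2 / l = diag(l r^2, 1/l) define the
   same coset, since r is a unit. *)
have t3 : D (gat (k * d * k^-1) * gat (k * d * k^-1) * x * (gat tgl)^-1)%g = T l.
  apply: (eq_trans (congr1 D (gat_comm_mulV _ _ _ x1))).
  apply/esym/(cmdiv_gat_eq hw hE hK hl x).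
  have rZ : GL2_Z l (dgl r 1) by exact: dgl_Z ir (qp_int1 l) nr (@qdvd1 l).
  have e : (d * hgl l * dgl r 1 * tgl = d * d)%g.
    have hl' := hglE l l; rewrite /hmx ltnn in hl'.
    have tE : (tgl : 'M_2) = mx22 lam 0 0 lam.
      by rewrite tglE; apply: mx2P; rewrite !mxE.
    have e' := gl_mulP (gl_mulP (gl_mulP dE hl') (dglE r0 (oner_neq0 _))) tE.
    rewrite (diag_last lam0) in e'; apply: gl_inj; apply: (eq_trans e').
    exact: esym (gl_mulP dE dE).
  have tC (y : GL2 (Qp l)) : (y * tgl^-1 = tgl^-1 * y)%g.
    apply: (mulgI tgl); rewrite mulKVg mulgA; apply: (mulIg tgl); rewrite mulgKV.
    apply: gl_inj; apply: (eq_trans (gl_mulP (tglE l) (erefl _))).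
    by apply: esym; apply: (eq_trans (gl_mulP (erefl _) (tglE l))); exact: scalar_mxC.
  rewrite (conj_twist k tC e); exact: (GL2_ZM rZ (GL2_ZV kZ)).
(* T l cancels the Frob^-2 term, and T 0 = D x leaves l - 1 of the l copies of D x. *)
rewrite t2 t3 big_ord_ends // T0 opprD addrA subrK opprD addrA.
have -> : D x *~ (l : nat) - D x = \sum_(j < l.-1) D x.
  by rewrite sumr_const card_ord -pmulrn -{1}(prednK l0) mulrSr addrK.
rewrite -sumrB; apply: eq_bigr => j _.
have jZ' := O_units_GL2_Z hw hspan (split_rep_unit hw hspan If if1 if2 ir irV r0 j).
have eA : D (gat (split_rep w f r j) * x)%g = D x.
  exact: (eq_trans (congr1 D (gat_commute _ x1)) (cmdivM jZ' x)).
suff eB : D (gat (split_rep w f r j) * (x * gat g))%g = T j.+1.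
  exact: (esym (congr2 (fun a b => a - b) eA eB)).
rewrite gE; apply: (eq_trans (congr1 D (comm_mulA _ (gat_commute _ x1)))).
apply: (eq_trans (congr1 (fun z => D (x * z)%g) (esym (gatM _ _)))).
apply/esym/(cmdiv_gat_eq hw hE hK hl x).
have jl : (j.+1 < l)%N by move: (ltn_ord j); rewrite -ltnS prednK.
have nj : ~ qdvd (j.+1%:R : Qp l) by move=> /qdvd_nat; apply/negP; rewrite gtnNdvd.
have jZ : GL2_Z l (dgl 1 j.+1%:R) by exact: dgl_Z (qp_int1 l) (qp_int_nat l _) (@qdvd1 l) nj.
have j0 : (j.+1%:R : Qp l) != 0 by rewrite qp_natr_eq0.
(* Up to an integral diagonal factor on the right, the Hecke coset of index j + 1 translated by
   Frobenius is the translate of g_l by [split_rep j]. *)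
have e : (d * hgl j.+1 * dgl 1 j.+1%:R = dgl r j.+1%:R * ngl l)%g.
  have hl' := hglE l j.+1; rewrite /hmx jl in hl'.
  have e' := gl_mulP (gl_mulP dE hl') (dglE (oner_neq0 _) j0).
  rewrite (diag_lower lam0) in e'; apply: gl_inj; apply: (eq_trans e').
  exact: esym (gl_mulP (dglE r0 j0) (nglE l)).
rewrite /split_rep (conj_ratio k e); exact: (GL2_ZM jZ (GL2_ZV kZ)).
Qed.
End Split.

Lemma euler_identity v : uniformizer w l (lam_ l) v -> local_identity (gat (gl_of (iota w v))).
Proof.
by have [hin|hni] := pselect (inert E l); [exact: inert_identity|exact: split_identity].
Qed.
End LocalIdentity.

(** * The index set N and the level groups U_n *)

Lemma in_N_mul (E : fieldExtType rat) (w : 2.-tuple E) K (l : place) n :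
  in_N w K n -> in_R w K l -> ~~ (l %| n)%N -> in_N w K (n * l)%N.
Proof.
move=> [s [us sR ->]] hl ln; exists (l :: s); split.
- rewrite /= us andbT; apply: contra ln => ls; rewrite (big_rem l) //=; exact: dvdn_mulr.
- by move=> q; rewrite inE => /orP[/eqP->|/sR].
- by rewrite big_cons mulnC.
Qed.

Lemma in_N_dvd (E : fieldExtType rat) (w : 2.-tuple E) K (p : place) n :
  in_N w K n -> (p %| n)%N -> in_R w K p.
Proof.
move=> [s [_ sR ->]] ps; apply: sR; elim: s ps => [|q s IH].
  by rewrite big_nil dvdn1 => /eqP p1; have := place_prime p; rewrite p1.
rewrite big_cons Euclid_dvdM ?place_prime // inE => /orP[|/IH ->]; last by rewrite orbT.
by rewrite dvdn_prime2 ?place_prime // => /eqP pq; apply/orP; left; apply/eqP/val_inj.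
Qed.

Lemma in_N1 (E : fieldExtType rat) (w : 2.-tuple E) K : in_N w K 1.
Proof. by exists [::]; split=> //; rewrite big_nil. Qed.

Lemma in_N_gt0 (E : fieldExtType rat) (w : 2.-tuple E) K n : in_N w K n -> (0 < n)%N.
Proof.
move=> [s [_ _ ->]]; elim/big_ind: _ => //; first by move=> a b; rewrite muln_gt0 => ->.
by move=> q _; exact: prime_gt0 (place_prime q).
Qed.

(** Lagrange's theorem as the case Q = V = A of [fibre_count]: the number of cosets of B in a fibre,
    times the order of B, is the order of A. *)
Lemma finite_subgroup_dvdn (G : groupType) (A B : set G) : is_subgroup A -> is_subgroup B ->
  B `<=` A -> finite_set A -> (#|` fset_set B|%fset %| #|` fset_set A|%fset)%N.
Proof.
move=> hA hB BA finA; have [A1 AM AV] := hA; have [B1 BM BV] := hB.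
pose X : seq (set G) := undup [seq lcos B a | a <- fset_set A].
have XP C : C \in X <-> exists2 a, A a & C = lcos B a.
  rewrite /X mem_undup; split=> [/mapP[a aA ->]|[a Aa ->]].
    by exists a => //; move: aA; rewrite in_fset_set // => /set_mem.
  by apply: map_f; rewrite in_fset_set //; exact/mem_set.
pose r (j : 'I_(size X)) : G := xget 1%g (nth set0 X j).
have rP (j : 'I_(size X)) : exists a b, [/\ A a, B b, nth set0 X j = lcos B a & r j = (a * b)%g].
  have /XP[a Aa e] : nth set0 X j \in X by exact: mem_nth.
  by have [b Bb rE] := xget_lcos a hB; exists a, b; split=> //; rewrite /r e.
have rX (j : 'I_(size X)) : nth set0 X j = lcos B (r j).
  have [a [b [Aa Bb -> ->]]] := rP j; apply/(lcos_eqP _ _ hB).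
  by rewrite mulKg.
have rA j : A (r j) by have [a [b [Aa /BA Ab _ ->]]] := rP j; exact: AM.
have rex u : A u -> exists j, B ((r j)^-1 * u)%g.
  move=> Au; have uX : lcos B u \in X by apply/XP; exists u.
  have jl : (index (lcos B u) X < size X)%N by rewrite index_mem.
  exists (Ordinal jl); apply/(lcos_eqP _ _ hB); rewrite -rX /=; exact: nth_index.
have rinj i j : B ((r i)^-1 * r j)%g -> i = j.
  move=> /(lcos_eqP _ _ hB); rewrite -!rX => e; apply/val_inj/eqP.
  by rewrite -(nth_uniq set0 (ltn_ord i) (ltn_ord j) (undup_uniq _)); apply/eqP.
have [j0 _] := rex 1%g A1.
have := fibre_count hA hA hB BA rA rex rinj j0; rewrite setIid (setIidl BA) => /(_ finA) <-.
exact: dvdn_mull.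
Qed.

Lemma conj_mulM (G : groupType) (c a b : G) :
  (c^-1 * a * c * (c^-1 * b * c) = c^-1 * (a * b) * c)%g.
Proof. by rewrite -!mulgA mulVKg. Qed.
Lemma conj_mulV (G : groupType) (c a : G) : ((c^-1 * a * c)^-1 = c^-1 * a^-1 * c)%g.
Proof. by rewrite !invgM invgK mulgA. Qed.

Lemma cmp_conj p (g u : GL2 Af) : cmp p (g^-1 * u * g)%g = ((cmp p g)^-1 * cmp p u * cmp p g)%g.
Proof. by rewrite !cmpM cmpV. Qed.

Section LevelGroups.
Context (E : fieldExtType rat) (w : 2.-tuple E) (hw : basis_of {: E} w).
Context (K : set (GL2 Af)) (hK : is_subgroup K) (oK : exists2 O, open O & K = O `&` setT).
Context (lam : place -> set E).
Context (U : set (GL2 Af)) (hU : is_subgroup U) (UA : U `<=` H_Af w) (UK : U `<=` K).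
Local Notation SR := (in_R w K).
Local Notation gl := (g_loc w lam).
Local Notation U_ := (U_ w K lam U).

Lemma cmp_g_ n p : (0 < n)%N -> cmp p (g_ w lam n) = if (p %| n)%N then gl p else 1%g.
Proof.
move=> n0; have -> : g_ w lam n = (\big[*%g/1%g]_(q <- places n) gat (gl q))%g.
  by apply: eq_bigr => q _; rewrite gl_at_gat.
by rewrite (cmp_prod gl p (places_uniq n)) mem_places_dvd.
Qed.

(** g_n is trivial away from n, so g_n^-1 u g_n differs from u only at the primes dividing n; being
    open and unramified there, K contains it as soon as these components are integral. *)
Lemma U_P n u : in_N w K n -> U_ n u <-> U u /\
  forall p : place, (p %| n)%N -> GL2_Z p ((gl p)^-1 * cmp p u * gl p)%g.
Proof.
move=> nN; have n0 := in_N_gt0 nN; have [K1 KM KV] := hK.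
split=> [[Uu [k Kk ku]]|[Uu h]].
  split=> // p pn; have Sp := in_N_dvd nN pn.
  have kE : k = ((g_ w lam n)^-1 * u * g_ w lam n)%g.
    by rewrite -ku -!mulgA mulKg mulVg mulg1.
  have := unramified_cmp (in_R_unr Sp) Kk.
  rewrite kE cmp_conj (cmp_g_ p n0) pn; exact.
split=> //; exists ((g_ w lam n)^-1 * u * g_ w lam n)%g; last first.
  by rewrite -!mulgA mulVKg mulgV mulg1.
have Ku := UK Uu; have := fun p => cmp_conj p (g_ w lam n) u.
move: ((g_ w lam n)^-1 * u * g_ w lam n)%g => y cmpy.
suff Kx : K (u^-1 * y)%g by have := KM _ _ Ku Kx; rewrite mulKVg.
have setT_sub : is_subgroup [set: GL2 Af] by split.
apply: (open_restricted_product (D := GL2_Z) (S := [set p | SR p /\ (p %| n)%N]) setT_sub hK oK).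
- by move=> p d [Sp _] Zd; split; [exact: (K_gat hK Sp Zd)|exact: Zd].
- exact: I.
- move=> p [Sp pn]; rewrite cmpM cmpV cmpy (cmp_g_ p n0) pn.
  exact: GL2_ZM (GL2_ZV (unramified_cmp (in_R_unr Sp) Ku)) (h p pn).
- move=> p np; have pn : (p %| n)%N = false.
    by apply/negP => pn; apply: np; split=> //; exact: in_N_dvd pn.
  by rewrite cmpM cmpV cmpy (cmp_g_ p n0) pn invg1 mul1g mulg1 mulVg.
Qed.

Lemma U_1 : U_ 1 = U.
Proof.
apply/seteqP; split=> u; first by case/(U_P _ (in_N1 w K)).
move=> Uu; apply/(U_P _ (in_N1 w K)); split=> // p.
by rewrite dvdn1 => /eqP p1; have := place_prime p; rewrite p1.
Qed.

Lemma U_subgroup n : in_N w K n -> is_subgroup (U_ n).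
Proof.
move=> nN; have [U1 UM UV] := hU; split.
- apply/(U_P _ nN); split=> // p _; rewrite cmp1 mulg1 mulVg; exact: GL2_Z1.
- move=> g h /(U_P _ nN)[Ug hg] /(U_P _ nN)[Uh hh]; apply/(U_P _ nN); split; first exact: UM.
  move=> p pn; have := GL2_ZM (hg p pn) (hh p pn); rewrite conj_mulM -cmpM; exact.
- move=> g /(U_P _ nN)[Ug hg]; apply/(U_P _ nN); split; first exact: UV.
  move=> p pn; have := GL2_ZV (hg p pn); rewrite conj_mulV -cmpV; exact.
Qed.

Lemma U_sub n : U_ n `<=` U. Proof. by move=> u []. Qed.

Context (hUR : forall l, SR l -> unramified_at (O_at_units w l) U).

Section Step.
Context (n : nat) (l : place) (nN : in_N w K n) (hl : SR l) (ln : ~~ (l %| n)%N).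

Lemma U_mulP u : U_ (n * l)%N u <-> U_ n u /\ GL2_Z l ((gl l)^-1 * cmp l u * gl l)%g.
Proof.
have nlN := in_N_mul nN hl ln; split.
  move=> /(U_P _ nlN)[Uu h]; split; last by apply: h; exact: dvdn_mull.
  by apply/(U_P _ nN); split=> // p pn; apply: h; exact: dvdn_mulr.
move=> [/(U_P _ nN)[Uu h] hu]; apply/(U_P _ nlN); split=> // p.
rewrite Euclid_dvdM ?place_prime // => /orP[/h //|].
rewrite dvdn_prime2 ?place_prime // => /eqP/val_inj ->; exact: hu.
Qed.

Lemma U_gat d : O_at_units w l d -> U_ n (gat d).
Proof.
move=> Od; apply/(U_P _ nN); split.
  by have [U1 _ _] := hU; exact: unramified_gat (hUR hl) U1 Od.
move=> p pn; have pl : p != l by apply: contraNneq ln => <-.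
rewrite (cmp_at_neq _ pl) mulg1 mulVg; exact: GL2_Z1.
Qed.

(** As l does not divide n, the level U_n is still the full O_l^* at l. The only new condition in
    U_(nl) is to stabilize g_l K_l, so the local representatives are also representatives of U_n /
    U_(nl). *)
Lemma U_coset_reps (m : nat) (a : 'I_m -> GL2 (Qp l)) :
  (forall j, O_at_units w l (a j)) ->
  (forall u, O_at_units w l u -> exists j, GL2_Z l ((gl l)^-1 * ((a j)^-1 * u) * gl l)%g) ->
  (forall i j, GL2_Z l ((gl l)^-1 * ((a i)^-1 * a j) * gl l)%g -> i = j) ->
  [/\ forall j, U_ n (gat (a j)),
    forall u, U_ n u -> exists j, U_ (n * l)%N ((gat (a j))^-1 * u)%g &
    forall i j, U_ (n * l)%N ((gat (a i))^-1 * gat (a j))%g -> i = j].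
Proof.
move=> aU aex ainj; have [_ VM VV] := U_subgroup nN.
have aV j : U_ n (gat (a j)) by exact: U_gat.
split=> //.
  move=> u Vu; have Ou : O_at_units w l (cmp l u) by exact: unramified_cmp (hUR hl) (U_sub Vu).
  have [j hj] := aex _ Ou; exists j; apply/U_mulP; split; first exact/VM/Vu/VV/aV.
  by rewrite cmpM cmpV cmp_at.
by move=> i j /U_mulP[_]; rewrite cmpM cmpV !cmp_at; exact: ainj.
Qed.
End Step.
End LevelGroups.

Lemma H_Af_gl_of (E : fieldExtType rat) (w : 2.-tuple E) (hw : basis_of {: E} w) (l : place)
  (v : 'cV[Qp l]_2) : H_Af w (gat (gl_of (iota w v))).
Proof.
have [uv|nuv] := boolP (iota w v \in unitmx).
  exact: (H_Af_gat hw (gl_ofE uv)).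
have -> : gl_of (iota w v) = 1%g by rewrite /gl_of /insubd insubN.
by rewrite gat1; have [] := H_Af_subgroup hw.
Qed.

Lemma act0 (R : realType) (E : fieldExtType rat) (emb : {rmorphism E -> R[i]}) w K h :
  act emb w K h 0 = 0.
Proof.
rewrite /act; have := lin_ext_sum (fun c => ch (pt K (h_0 emb w) (h * rep emb w K c)%g))
  ([::] : seq nat) (fun=> setT) (fun=> 0).
by rewrite !big_nil.
Qed.

Lemma sum_reps (V : nmodType) (G : groupType) (A B : set G) m (a : 'I_m -> G) (f : G -> V) u :
  is_subgroup A -> is_subgroup B -> (forall j, A (a j)) ->
  (forall x, A x -> exists j, B ((a j)^-1 * x)%g) ->
  (forall i j, B ((a i)^-1 * a j)%g -> i = j) ->
  (forall x b, A x -> B b -> f (x * b)%g = f x) -> A u ->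
  \sum_j f (u * a j)%g = \sum_j f (a j).
Proof.
move=> [_ AM AV] [_ BM BV] aA aex ainj fB Au.
have [s sE] := choice (fun j => aex _ (AM _ _ Au (aA j))).
have s_inj : injective s.
  move=> i j e; apply: ainj; have := BM _ _ (BV _ (sE i)) (sE j).
  by rewrite e !invgM invgK -!mulgA mulKVg mulKg.
rewrite [RHS](reindex_inj s_inj) /=; apply: eq_bigr => j _.
by rewrite -(fB _ _ (aA (s j)) (sE j)) mulKVg.
Qed.

(** * The norm relation *)

Section EulerSystem.
Context (R : realType) (E : fieldExtType rat) (emb : {rmorphism E -> R[i]}) (w : 2.-tuple E).
Hypotheses (hE : imaginary_quadratic emb) (hw : basis_of {: E} w).
Context (K : set (GL2 Af)) (hK : is_subgroup K) (oK : exists2 O, open O & K = O `&` setT).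
Context (art : GL2 Af -> R[i] -> R[i]).
Hypotheses (artM : forall g h, H_Af w g -> H_Af w h -> art (g * h)%g = art g \o art h)
  (artK : forall h, H_Af w h -> (art h = id <-> H_Q w h))
  (art_surj : art @` H_Af w = Gal (Eab emb) (range emb)).
Context (lam : place -> set E).
Context (U : set (GL2 Af)) (hU : is_subgroup U) (UA : U `<=` H_Af w) (UK : U `<=` K).
Hypothesis oU : exists2 O, open O & U = O `&` H_Af w.
Hypothesis hUR : forall l, in_R w K l -> unramified_at (O_at_units w l) U.
Context (zetaR : set (GL2 Af) -> int) (hzeta : tame_datum w K U zetaR).
Local Notation SR := (in_R w K).
Local Notation D := (cmdiv emb w K).
Local Notation gl := (g_loc w lam).
Local Notation V := (U_ w K lam U).
Local Notation vol := (v_ w K lam U).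
Local Notation y := (y_ emb w K lam U zetaR).
Local Notation zeta := (zeta_ w K lam zetaR).

Lemma U_awy u : U u -> U (awy SR u).
Proof.
move=> Uu; apply: (unramified_awy (D := fun p => O_at_units w p) (H_Af_subgroup hw) hU oU hUR _ _ _ Uu).
- by move=> p d [_ hspan _ _] Od; exact: (O_units_GL2_Z hw hspan Od).
- by move=> p [_ hspan _ _]; exact: (O_units_subgroup hw hspan).
- exact: (H_Af_awy hw SR (UA Uu)).
Qed.

Definition divisor_sum (s : seq (GL2 Af * int)) (m : nat) (h : GL2 Af) :=
  \sum_(z <- s) D (h * z.1)%g *~ (z.2 * m%:Z).

Lemma y_sum n s : zeta n = coset_sum K s -> y n = divisor_sum s (vol 1 %/ vol n)%N 1%g.
Proof.
move=> zE; rewrite /y_ zE; apply: (eq_trans (psi_cls_sum hw hE hK s _ _ _)).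
by apply: eq_bigr => z _; rewrite mul1g.
Qed.

Lemma act_divisor_sum s m h g : H_Af w h ->
  act emb w K h (divisor_sum s m g) = divisor_sum s m (h * g)%g.
Proof.
move=> Hh; apply: (eq_trans (act_sum hw hE hK s _ _ Hh)).
by apply: eq_bigr => z _; rewrite mulgA.
Qed.

(** The list s is not determined by the function that it represents; its translated divisors are. *)
Lemma divisor_sum_coset s s' m h : H_Af w h -> coset_sum K s = coset_sum K s' ->
  divisor_sum s m h = divisor_sum s' m h.
Proof.
move=> Hh e; have pE t : psi emb w K (cls w (coset_sum K t) *~ m%:Z) = divisor_sum t m 1%g.
  apply: (eq_trans (psi_cls_sum hw hE hK t _ _ _)).
  by apply: eq_bigr => z _; rewrite mul1g.
have e1 : divisor_sum s m 1%g = divisor_sum s' m 1%g by rewrite -!pE e.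
have := congr1 (act emb w K h) e1; rewrite !act_divisor_sum // mulg1; exact.
Qed.

Lemma divisor_sum_inv n s m h v : in_N w K n -> zeta n = coset_sum K s ->
  H_Af w h -> V n v -> divisor_sum s m (h * v)%g = divisor_sum s m h.
Proof.
move=> nN zE Hh Vv; have [Uv vn] := (U_P hK oK lam UK v nN).1 Vv.
have inv : coset_sum K [seq ((v * z.1)%g, z.2) | z <- s] = coset_sum K s.
  apply: (eq_trans (zeta_invariant hK oK zE _ _ _) zE).
  - move=> g hg; exact: (hzeta.2 _ _ (conj (U_awy Uv) (@awy_trivial SR v)) hg).
  - by move=> p Sp; exact: (unramified_cmp (in_R_unr Sp) (UK Uv)).
  - by move=> p _; exact: vn.
rewrite -(divisor_sum_coset m Hh inv) /divisor_sum big_map; apply: eq_bigr => z _ /=.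
by rewrite mulgA.
Qed.

Lemma divisor_sum_Q s m h q : H_Af w h -> H_Q w q -> divisor_sum s m (h * q)%g = divisor_sum s m h.
Proof.
move=> Hh Qq; apply: eq_bigr => z _; congr (_ *~ _).
by rewrite (H_Af_comm hw Hh (H_Q_sub Qq)) -mulgA (cmdivMl hw hE hK _ Qq).
Qed.

Lemma gal_act_divisor_sum s m h g : H_Af w h ->
  gal_act emb w K art (art h) (divisor_sum s m g) = divisor_sum s m (h * g)%g.
Proof.
move=> Hh; apply: (eq_trans (gal_act_sum hw hE hK artM artK s _ _ Hh)).
by apply: eq_bigr => z _; rewrite mulgA.
Qed.

Section Step.
Context (n : nat) (l : place) (nN : in_N w K n) (hl : SR l) (ln : ~~ (l %| n)%N).
Context (k L : set R[i]).
Hypotheses (hk : class_field emb w art (V n) k) (hL : class_field emb w art (V (n * l)%N) L).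
Context (v : 'cV[Qp l]_2) (hP : prime_ideal_above l (lam l)) (hv : uniformizer w l (lam l) v).
Local Notation phi := (art (gat (gl_of (iota w v)))).

Let nlN : in_N w K (n * l)%N. Proof. exact: in_N_mul. Qed.
Let VnS : is_subgroup (V n). Proof. exact: U_subgroup. Qed.
Let VlS : is_subgroup (V (n * l)%N). Proof. exact: U_subgroup. Qed.
Let VlV : V (n * l)%N `<=` V n.
Proof. by move=> u /(U_mulP hK oK lam UK nN hl ln)[]. Qed.
Let VA : V n `<=` H_Af w. Proof. by move=> u /(@U_sub _ _ _ _ _ n)/UA. Qed.
Let VU m : V m `<=` U. Proof. exact: U_sub. Qed.

(** The list s comes from zeta_(nl), but the normalization is still v_1 / v_n: the change to v_1 /
    v_(nl) is left to the count of fibres in the trace. *)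
Lemma Hecke_poly_y : exists (s : seq (GL2 Af * int)) (m : nat) (a : 'I_m -> GL2 Af),
  [/\ zeta (n * l)%N = coset_sum K s,
    [/\ forall j, V n (a j), forall u, V n u -> exists j, V (n * l)%N ((a j)^-1 * u)%g &
      forall i j, V (n * l)%N ((a i)^-1 * a j)%g -> i = j] &
    Hecke_poly emb w K art l phi (y n) = \sum_j divisor_sum s (vol 1 %/ vol n)%N (a j)].
Proof.
have finR : finite_set [set X | zetaR X != 0] by case: hzeta => -[].
have [fin n0] := in_N_supp_finite hK oK lam finR nN.
have [s [s1 sE slE]] := zeta_step hK oK n0 hl ln fin.
have [m [a [b [bZ aU aex ainj id_]]]] := euler_identity hw hE hK hl hP hv.
pose s' := s ++ [seq ((z.1 * gat (gl l))%g, - z.2) | z <- s].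
exists s', m, (fun j => gat (a j)); split.
- rewrite slE /s' /coset_sum big_cat !big_map /= -sumrN; congr (_ + _).
  by apply: eq_bigr => z _; rewrite mulrNz.
- exact: (U_coset_reps hK oK hU UK hUR nN hl ln aU aex ainj).
rewrite (y_sum sE); set c := (vol 1 %/ vol n)%N.
have -> : divisor_sum s c 1%g = \sum_(z <- s) D z.1 *~ (z.2 * c%:Z).
  by apply: eq_bigr => z _; rewrite mul1g.
apply: (eq_trans (Hecke_poly_sum hw hE hK hl artM artK s _ _ bZ (H_Af_gl_of hw v))).
rewrite big_seq; under eq_bigr => z zs do rewrite (id_ _ (s1 z zs)) mulrz_suml.
rewrite -big_seq exchange_big /=; apply: eq_bigr => j _.
rewrite /divisor_sum /s' big_cat big_map /= -big_split /=; apply: eq_bigr => z _.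
by rewrite mulNr mulrNz mulrzBl.
Qed.

Lemma trace_y s m (a : 'I_m -> GL2 Af) c d : zeta (n * l)%N = coset_sum K s ->
  (forall j, V n (a j)) -> (forall u, V n u -> exists j, V (n * l)%N ((a j)^-1 * u)%g) ->
  (forall i j, V (n * l)%N ((a i)^-1 * a j)%g -> i = j) ->
  finite_set (V n `&` H_Q w) -> (c * vol (n * l))%N = vol n ->
  \sum_j divisor_sum s d (a j) = trace emb w K art L k (divisor_sum s d 1%g) *+ c.
Proof.
move=> zE aV aex ainj fin cE; have hA := H_Af_subgroup hw; have [A1 AM AV] := hA.
have hQ := H_Q_subgroup hw; have QA : H_Q w `<=` H_Af w := @H_Q_sub _ w.
have [kF Ek kab Galk] := hk; have [LF EL Lab GalL] := hL.
have AC := @H_Af_comm _ _ hw.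
have finv h h' : H_Af w h -> H_Af w h' -> setmulg (H_Q w) (V (n * l)%N) (h^-1 * h')%g ->
    divisor_sum s d h = divisor_sum s d h'.
  move=> Hh Hh' [q Qq [u Vu e]]; have -> : h' = (h * q * u)%g by rewrite -mulgA e mulKVg.
  rewrite (divisor_sum_inv _ nlN zE _ Vu); last exact/AM/QA.
  by rewrite (divisor_sum_Q _ _ Hh Qq).
apply: (art_trace_sum hA hQ AC art_surj artM artK VnS VlS VlV VA kF Ek kab Galk LF EL Lab GalL
  QA aV aex ainj finv _ fin cE) => h Vh.
have Hh := VA Vh; case: xgetP => [t _ [tG tL]|/(_ (art h))].
  move: tG; rewrite -art_surj => -[h' Hh' h't]; rewrite -h't gal_act_divisor_sum // mulg1.
  apply: finv => //.
  apply/(art_eq_on hA hQ art_surj artM artK VlV VA GalL QA Hh' Hh) => x Lx.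
  by rewrite h't tL // /res_art asboolT.
case; split; first by rewrite -art_surj; exists h.
by move=> x Lx; rewrite /res_art asboolT.
Qed.

Lemma vol_dvdn m p : in_N w K m -> in_N w K p -> V p `<=` V m -> finite_set (V m `&` H_Q w) ->
  (vol p %| vol m)%N.
Proof.
move=> mN pN sub fin; apply: finite_subgroup_dvdn => //.
- apply: setI_subgroup (H_Q_subgroup hw); exact: (U_subgroup hK oK lam hU UK mN).
- apply: setI_subgroup (H_Q_subgroup hw); exact: (U_subgroup hK oK lam hU UK pN).
- by move=> u [Vu Qu]; split=> //; exact: sub.
Qed.

Lemma vol_gt0 m : in_N w K m -> finite_set (V m `&` H_Q w) -> (0 < vol m)%N.
Proof.
move=> mN fin; rewrite cardfs_gt0; apply/fset0Pn; exists 1%g; rewrite in_fset_set //.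
apply/mem_set; split; first by case: (U_subgroup hK oK lam hU UK mN).
by case: (H_Q_subgroup hw).
Qed.

Lemma euler_system_step : Hecke_poly emb w K art l phi (y n) =
  trace emb w K art L k (y (n * l)%N).
Proof.
have [s [m [a [zE [aV aex ainj] ->]]]] := Hecke_poly_y.
(* If the group of global units is infinite, [fset_set] is empty by convention, v_1 = 0, and both
   divisors vanish. Otherwise all the v_p below are cardinals of finite groups. *)
rewrite (y_sum zE); have [fin|inf] := pselect (finite_set (U `&` H_Q w)); last first.
  have v1 : vol 1 = 0%N by rewrite /v_ (U_1 w hK oK lam UK) /fset_set; case: pselect => //; rewrite cardfs0.
  rewrite v1 !div0n; have z0 h : divisor_sum s 0 h = 0.
    by rewrite /divisor_sum big1 // => z _; rewrite mulr0 mulr0z.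
  rewrite big1 => [|j _]; last exact: z0.
  by rewrite z0 /trace fsbig1 // => t _; rewrite /gal_act act0.
have finV p : finite_set (V p `&` H_Q w).
  by apply: sub_finite_set fin => u [/VU Uu Qu].
have U1 := U_1 w hK oK lam UK.
have [c cE] := dvdnP (vol_dvdn nN nlN VlV (finV n)).
have n1 : (vol n %| vol 1)%N.
  by apply: (vol_dvdn (in_N1 w K) nN _ (finV 1%N)); rewrite U1; exact: VU.
have vl0 := vol_gt0 nlN (finV _); have vn0 := vol_gt0 nN (finV _).
have c0 : (0 < c)%N by move: vn0; rewrite cE muln_gt0 => /andP[].
have mE : (vol 1 %/ vol (n * l) = vol 1 %/ vol n * c)%N.
  by rewrite -{1}(divnK n1) {2}cE mulnA mulnK.
apply: (fct_mulrn_inj c0); rewrite -(trace_y _ zE aV aex ainj (finV n) (esym cE)) mE.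
rewrite -sumrMnl; apply: eq_bigr => j _; rewrite -sumrMnl; apply: eq_bigr => z _.
by rewrite PoszM mulrA [in RHS]mulrzA pmulrn.
Qed.

(** The sum over representatives of U_n / U_(nl) of translates of a U_(nl)-invariant divisor is
    invariant under U_n, which permutes the cosets. *)
Lemma Hecke_poly_invariant : Div_inv emb w K (V n) (Hecke_poly emb w K art l phi (y n)).
Proof.
have [s [m [a [zE [aV aex ainj] ->]]]] := Hecke_poly_y; set d := (_ %/ _)%N.
have XE h : \sum_j divisor_sum s d (h * a j)%g =
    \sum_(p <- [seq (j, z) | j <- index_enum 'I_m, z <- s]) D (h * (a p.1 * p.2.1))%g *~ (p.2.2 * d%:Z).
  rewrite big_allpairs_dep /=; apply: eq_bigr => j _; apply: eq_bigr => z _.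
  by rewrite mulgA.
have X1 : \sum_j divisor_sum s d (a j) =
    \sum_(p <- [seq (j, z) | j <- index_enum 'I_m, z <- s]) D (a p.1 * p.2.1)%g *~ (p.2.2 * d%:Z).
  have := XE 1%g; under eq_bigr do rewrite mul1g; move=> ->.
  by apply: eq_bigr => p _; rewrite mul1g.
split; first by rewrite X1; exact: (Div_sum hw hE).
move=> h Vh; rewrite {1}X1 (act_sum hw hE hK _ _ _ (VA Vh)) -XE.
apply: (sum_reps VnS VlS aV aex ainj _ Vh) => x b Vx Vb.
exact: (divisor_sum_inv _ nlN zE (VA Vx) Vb).
Qed.
End Step.
End EulerSystem.

Theorem theorem3p29 (R : realType) (E : fieldExtType rat)
    (emb : {rmorphism E -> R[i]}) (w : 2.-tuple E)
    (hE : imaginary_quadratic emb) (hw : basis_of {: E} w)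
    (K : set (GL2 Af)) (hK : compact_open_in setT K)
    (art : GL2 Af -> R[i] -> R[i]) (hart : is_Artin_map emb w art)
    (lam : place -> set E) (hlam : forall l, in_R w K l -> prime_ideal_above l (lam l))
    (U : set (GL2 Af)) (hU : compact_open_in (H_Af w) U) (hUK : U `<=` K)
    (hUR : forall l, in_R w K l -> unramified_at (O_at_units w l) U)
    (F : nat -> set R[i])
    (hF : forall n, in_N w K n -> class_field emb w art (U_ w K lam U n) (F n))
    (zetaR : set (GL2 Af) -> int) (hzeta : tame_datum w K U zetaR)
    (l : place) (hl : in_R w K l) (n : nat) (hn : in_N w K n) (hln : ~~ (l %| n)%N)
    (phi : R[i] -> R[i]) (hphi : geometric_Frobenius emb (lam l) phi) :
  let y := y_ emb w K lam U zetaR in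
  Div_inv emb w K (U_ w K lam U n) (Hecke_poly emb w K art l phi (y n)) /\
  Hecke_poly emb w K art l phi (y n) =
    trace emb w K art (F (n * l)%N) (F n) (y (n * l)%N).
Proof.
have [sK _ _ [O oO KE]] := hK; have [sU UA _ oU] := hU.
have oK : exists2 O, open O & K = O `&` setT by exists O.
have [art_surj artM artK _ hFrob] := hart.
(* The normalization of the Artin map presents the given geometric Frobenius as the image of a
   uniformizer, so that it acts on divisors by translation. *)
have [v hv phiE] := (hFrob l (lam l) (hlam l hl) phi).1 hphi.
have {}phiE : phi = art (gat (gl_of (iota w v))) by rewrite phiE gat.unlock.
have nlN := in_N_mul hn hl hln.
rewrite phiE; split.
  exact: (Hecke_poly_invariant hE hw sK oK artM artK sU UA hUK oU hUR hzeta hn hl hln (hlam l hl) hv).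
exact: (euler_system_step hE hw sK oK artM artK art_surj sU UA hUK oU hUR hzeta hn hl hln
  (hF n hn) (hF _ nlN) (hlam l hl) hv).
Qed.
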